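(* Let $K$ be a field and let $\Lambda$ be a Nakayama $K$-algebra of global dimension $d$ with $2\le d<\infty$. Then $\Lambda$ admits a $d$-cluster tilting subcategory $\mathcal{C}$ if and only if $\Lambda=\Lambda_{m,l}$ for some $m\ge3$, $l\ge2$ such that $l\mid m-1$ or $l=2$. Moreover, in that case, $\mathcal{C}=\mathrm{add}(\Lambda\oplus D\Lambda)$ and $d=2\,\frac{m-1}{l}$.
   Context: $Q_m$ is the quiver $m\to m-1\to m-2\to\cdots\to2\to1$ and $\Lambda_{m,l}=KQ_m/(\mathrm{rad}\,KQ_m)^l$. A Nakayama algebra is either acyclic, i.e. $KQ_m/I$ for some $m$ and some admissible ideal $I$, or cyclic, i.e. $K\tilde Q/I$ where $\tilde Q$ is an oriented cycle and $I$ is an admissible ideal. $\mathrm{mod}\,\Lambda$ is the category of finitely generated right $\Lambda$-modules, $D=\mathrm{Hom}_K(-,K)$ is the standard duality, and $\mathrm{add}\,M$ is the full subcategory of modules isomorphic to direct summands of finite direct sums of copies of $M$. A full subcategory $\mathcal{C}$ of $\mathrm{mod}\,\Lambda$ closed under direct sums and summands is an $n$-cluster tilting subcategory if it is functorially finite (every $M\in\mathrm{mod}\,\Lambda$ has a left and a right $\mathcal{C}$-approximation) and $\mathcal{C}=\{X\mid \mathrm{Ext}^i_\Lambda(\mathcal{C},X)=0 \text{ for all } 0<i<n\}=\{X\mid \mathrm{Ext}^i_\Lambda(X,\mathcal{C})=0\text{ for all }0<i<n\}$. *)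

(* Defs.v *)
From HB Require Import structures.
From mathcomp Require Import all_boot all_order all_algebra all_field.
From mathcomp Require Import finmap.
From mathcomp.multinomials Require Import monalg.

Set Implicit Arguments.
Unset Strict Implicit.
Unset Printing Implicit Defensive.

Import GRing.Theory.
Local Open Scope ring_scope.

Record quiver := Quiver {
  vertex : finType;
  arrow : finType;
  src : arrow -> vertex;
  tgt : arrow -> vertex }.

Section Paths.
Variable Q : quiver.

Fixpoint is_walk (x : vertex Q) (s : seq (arrow Q)) : bool :=
  if s is a :: s' then (src a == x) && is_walk (tgt a) s' else true.

(* A path is its starting vertex together with its consecutive arrows, read in
   the order in which they are followed; [(x, [::])] is the trivial path at x. *)
Record qpath := QPath {
  walk : vertex Q * seq (arrow Q);
  walkP : is_walk walk.1 walk.2 }.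
HB.instance Definition _ := [isSub for walk].
HB.instance Definition _ := [Choice of qpath by <:].

Definition psrc (p : qpath) : vertex Q := (walk p).1.
Definition ptgt (p : qpath) : vertex Q := last (walk p).1 (map (@tgt Q) (walk p).2).

Definition ptriv (x : vertex Q) : qpath := @QPath (x, [::]) isT.

Lemma parrow_subproof (a : arrow Q) : is_walk (src a) [:: a].
Proof. by rewrite /= eqxx. Qed.
Definition parrow (a : arrow Q) : qpath := @QPath (src a, [:: a]) (parrow_subproof a).

Lemma is_walk_cat x s1 s2 :
  is_walk x (s1 ++ s2) = is_walk x s1 && is_walk (last x (map (@tgt Q) s1)) s2.
Proof. by elim: s1 x => //= a s1 IH x; rewrite IH andbA. Qed.

(* Concatenation [p] then [q], undefined unless [q] starts where [p] ends. *)
Definition pcat (p q : qpath) : option qpath :=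
  if ptgt p == psrc q then insub (psrc p, (walk p).2 ++ (walk q).2) else None.

Lemma pcatE p q : ptgt p = psrc q ->
  exists r : qpath, pcat p q = Some r /\ walk r = (psrc p, (walk p).2 ++ (walk q).2).
Proof.
move=> pq; rewrite /pcat pq eqxx.
have w : is_walk (psrc p) ((walk p).2 ++ (walk q).2).
  rewrite is_walk_cat; apply/andP; split; first exact: (walkP p).
  by have := walkP q; rewrite -/(psrc q) -pq.
by exists (@QPath (_, _) w); rewrite insubT.
Qed.

Lemma pcat_tgt p q r : pcat p q = Some r -> ptgt r = ptgt q.
Proof.
have [pq|npq] := eqVneq (ptgt p) (psrc q); last by rewrite /pcat (negPf npq).
have [t [-> tv]] := pcatE pq; case=> <-; rewrite /ptgt tv /= map_cat last_cat.
by congr last; rewrite -/(psrc q) -pq.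
Qed.

Lemma pcat_src p q r : pcat p q = Some r -> psrc r = psrc p.
Proof.
have [pq|npq] := eqVneq (ptgt p) (psrc q); last by rewrite /pcat (negPf npq).
by have [t [-> tv]] := pcatE pq; case=> <-; rewrite /psrc tv.
Qed.

Lemma pcat_def p q : ptgt p != psrc q -> pcat p q = None.
Proof. by rewrite /pcat => /negPf->. Qed.

Lemma pcatA p q r :
  obind (pcat^~ r) (pcat p q) = obind (pcat p) (pcat q r).
Proof.
have [pq|npq] := eqVneq (ptgt p) (psrc q); last first.
  rewrite (pcat_def npq) /=; case E: (pcat q r) => [t|] //=.
  by rewrite pcat_def // (pcat_src E).
have [t [Et tv]] := pcatE pq; rewrite Et /=.
have [qr|nqr] := eqVneq (ptgt q) (psrc r); last first.
  by rewrite (pcat_def nqr) /= pcat_def // (pcat_tgt Et).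
have [u [Eu uv]] := pcatE qr; rewrite Eu /=.
have tr : ptgt t = psrc r by rewrite (pcat_tgt Et).
have pu : ptgt p = psrc u by rewrite (pcat_src Eu).
have [v [-> vv]] := pcatE tr; have [w [-> wv]] := pcatE pu.
congr Some; apply: val_inj => /=; rewrite vv wv /= tv uv /=.
by rewrite (pcat_src Et) catA.
Qed.

Lemma pcat1p x p : pcat (ptriv x) p = if x == psrc p then Some p else None.
Proof.
have [xp|nxp] := eqVneq x (psrc p); last by rewrite pcat_def.
have [t [-> tv]] := pcatE (p := ptriv x) xp; congr Some; apply: val_inj => /=.
by rewrite tv /= /psrc /= xp /psrc; case: (walk p).
Qed.

Lemma pcatp1 x p : pcat p (ptriv x) = if x == ptgt p then Some p else None.
Proof.
have [xp|nxp] := eqVneq x (ptgt p); last by rewrite pcat_def // eq_sym.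
have [t [-> tv]] := pcatE (q := ptriv x) (esym xp); congr Some; apply: val_inj => /=.
by rewrite tv /= cats0 /psrc; case: (walk p).
Qed.

End Paths.

(* The path algebra KQ: finitely supported formal K-linear combinations of the
   paths of Q.  It is the zero ring when Q has no vertex. *)
Section PathAlgebra.
Variables (K : fieldType) (Q : quiver).

Definition path_algebra : Type := {malg K[qpath Q]}.
HB.instance Definition _ := GRing.Lmodule.on path_algebra.

Implicit Types (f g h : path_algebra) (p q r : qpath Q).

Definition pelt (p : qpath Q) : path_algebra := << p >>.

Definition path_mul p q : path_algebra := oapp pelt 0 (pcat p q).

Definition pa_one : path_algebra := \sum_(x : vertex Q) pelt (ptriv x).

Definition pa_mul f g : path_algebra :=
  \sum_(p <- msupp f) \sum_(q <- msupp g) (f@_p * g@_q) *: path_mul p q.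

Lemma pa_mulEw (d1 d2 : {fset qpath Q}) f g :
    (msupp f `<=` d1)%fset -> (msupp g `<=` d2)%fset ->
  pa_mul f g = \sum_(p <- d1) \sum_(q <- d2) (f@_p * g@_q) *: path_mul p q.
Proof.
move=> le1 le2; rewrite /pa_mul.
rewrite (big_fset_incl _ le1) /=; last first.
  by move=> p _ /mcoeff_outdom ->; rewrite big1 // => q _; rewrite mul0r scale0r.
apply: eq_bigr => p _; apply: (big_fset_incl _ le2) => q _ /mcoeff_outdom ->.
by rewrite mulr0 scale0r.
Qed.

Lemma pa_mulDl : left_distributive pa_mul +%R.
Proof.
move=> f g h; pose d := (msupp f `|` msupp g)%fset.
rewrite (@pa_mulEw d (msupp h)) ?msuppD_le //.
rewrite (@pa_mulEw d (msupp h) f) ?fsubsetUl // (@pa_mulEw d (msupp h) g) ?fsubsetUr //.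
rewrite -big_split; apply: eq_bigr => p _; rewrite -big_split; apply: eq_bigr => q _.
by rewrite mcoeffD mulrDl scalerDl.
Qed.

Lemma pa_mulDr : right_distributive pa_mul +%R.
Proof.
move=> h f g; pose d := (msupp f `|` msupp g)%fset.
rewrite (@pa_mulEw (msupp h) d) ?msuppD_le //.
rewrite (@pa_mulEw (msupp h) d h f) ?fsubsetUl // (@pa_mulEw (msupp h) d h g) ?fsubsetUr //.
rewrite -big_split; apply: eq_bigr => p _; rewrite -big_split; apply: eq_bigr => q _.
by rewrite mcoeffD mulrDr scalerDl.
Qed.

Lemma pa_scaleAl (c : K) f g : c *: pa_mul f g = pa_mul (c *: f) g.
Proof.
rewrite (@pa_mulEw (msupp f) (msupp g) (c *: f)) ?msuppZ_le //.
rewrite scaler_sumr; apply: eq_bigr => p _; rewrite scaler_sumr; apply: eq_bigr => q _.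
by rewrite mcoeffZ scalerA mulrA.
Qed.

Lemma pa_scaleAr (c : K) f g : c *: pa_mul f g = pa_mul f (c *: g).
Proof.
rewrite (@pa_mulEw (msupp f) (msupp g) f (c *: g)) ?msuppZ_le //.
rewrite scaler_sumr; apply: eq_bigr => p _; rewrite scaler_sumr; apply: eq_bigr => q _.
by rewrite mcoeffZ scalerA mulrCA.
Qed.

Lemma pa_mul0l f : pa_mul 0 f = 0.
Proof. by apply: (addIr (pa_mul 0 f)); rewrite -pa_mulDl !add0r. Qed.
Lemma pa_mul0r f : pa_mul f 0 = 0.
Proof. by apply: (addIr (pa_mul f 0)); rewrite -pa_mulDr !add0r. Qed.

Lemma pa_mul_pelt p q : pa_mul (pelt p) (pelt q) = path_mul p q.
Proof.
rewrite /pa_mul /pelt !msuppU !oner_eq0 !big_seq_fset1.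
by rewrite !mcoeffUU mulr1 scale1r.
Qed.

Lemma pa_ind (P : path_algebra -> Prop) :
    P 0 -> (forall f g, P f -> P g -> P (f + g)) ->
    (forall c f, P f -> P (c *: f)) -> (forall p, P (pelt p)) -> forall f, P f.
Proof.
move=> P0 PD PZ Pp f; rewrite [f]monalgE.
apply: (big_ind P) => // p _.
suff -> : << f@_p *g p >> = f@_p *: pelt p :> {malg K[qpath Q]} by apply: PZ.
by apply/malgP => q; rewrite mcoeffZ !mcoeffU mulrnAr mulr1.
Qed.

Lemma pa_mulA : associative pa_mul.
Proof.
move=> f g h; elim/pa_ind: f => [|f1 f2 I1 I2|c f I|p].
- by rewrite !pa_mul0l.
- by rewrite !pa_mulDl I1 I2.
- by rewrite -!pa_scaleAl I.
elim/pa_ind: g => [|f1 f2 I1 I2|c f I|q].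
- by rewrite !(pa_mul0l, pa_mul0r).
- by rewrite !(pa_mulDl, pa_mulDr) I1 I2.
- by rewrite -!(pa_scaleAl, pa_scaleAr) I.
elim/pa_ind: h => [|f1 f2 I1 I2|c f I|r].
- by rewrite !pa_mul0r.
- by rewrite !pa_mulDr I1 I2.
- by rewrite -!pa_scaleAr I.
rewrite !pa_mul_pelt /path_mul; have := pcatA p q r.
case: (pcat p q) => [t|] /=; case: (pcat q r) => [u|] /=;
  rewrite ?pa_mul0l ?pa_mul0r ?pa_mul_pelt /path_mul //.
- by move->.
- by move->.
- by move=> <-.
Qed.

Lemma pa_suml (I : Type) (s : seq I) (F : I -> path_algebra) g :
  pa_mul (\sum_(i <- s) F i) g = \sum_(i <- s) pa_mul (F i) g.
Proof.
by apply: (big_morph (pa_mul^~ g)) => [a b|]; rewrite (pa_mulDl, pa_mul0l).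
Qed.
Lemma pa_sumr (I : Type) (s : seq I) (F : I -> path_algebra) g :
  pa_mul g (\sum_(i <- s) F i) = \sum_(i <- s) pa_mul g (F i).
Proof. by apply: (big_morph (pa_mul g)) => [a b|]; rewrite (pa_mulDr, pa_mul0r). Qed.

Lemma pa_mul1l : left_id pa_one pa_mul.
Proof.
move=> f; elim/pa_ind: f => [|f1 f2 I1 I2|c f I|p].
- by rewrite pa_mul0r.
- by rewrite pa_mulDr I1 I2.
- by rewrite -pa_scaleAr I.
rewrite pa_suml (bigD1 (psrc p)) //= pa_mul_pelt /path_mul pcat1p eqxx /= big1 ?addr0 //.
by move=> x /negPf nx; rewrite pa_mul_pelt /path_mul pcat1p nx.
Qed.

Lemma pa_mul1r : right_id pa_one pa_mul.
Proof.
move=> f; elim/pa_ind: f => [|f1 f2 I1 I2|c f I|p].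
- by rewrite pa_mul0l.
- by rewrite pa_mulDl I1 I2.
- by rewrite -pa_scaleAl I.
rewrite pa_sumr (bigD1 (ptgt p)) //= pa_mul_pelt /path_mul pcatp1 eqxx /= big1 ?addr0 //.
by move=> x /negPf nx; rewrite pa_mul_pelt /path_mul pcatp1 nx.
Qed.

HB.instance Definition _ := GRing.Zmodule_isPzRing.Build path_algebra
  pa_mulA pa_mul1l pa_mul1r pa_mulDl pa_mulDr.

End PathAlgebra.

(* Subsets of a ring, and in particular ideals, are Prop-valued predicates. *)
Section Ideals.
Variable R : pzRingType.
Implicit Types I J : R -> Prop.

Definition right_ideal I :=
  [/\ I 0, forall x y, I x -> I y -> I (x + y) & forall x r, I x -> I (x * r)].

Definition ideal I := right_ideal I /\ (forall r x, I x -> I (r * x)).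

Definition maximal_right_ideal I :=
  [/\ right_ideal I, ~ (forall x, I x) &
      forall J, right_ideal J -> (forall x, I x -> J x) ->
        (forall x, J x -> I x) \/ (forall x, J x)].

Definition jacobson (x : R) := forall I, maximal_right_ideal I -> I x.

Definition generated_ideal (S : R -> Prop) (x : R) :=
  forall I, ideal I -> (forall y, S y -> I y) -> I x.

Definition ideal_mul I J (x : R) :=
  exists s : seq (R * R),
    (forall p, p \in s -> I p.1 /\ J p.2) /\ x = \sum_(p <- s) p.1 * p.2.

Definition ideal_pow I (n : nat) : R -> Prop :=
  iter n (ideal_mul I) (fun=> True).

End Ideals.

(* The quiver m -> m-1 -> ... -> 2 -> 1: vertex [i : 'I_m] is vertex i+1, and
   the arrow i+1 -> i is indexed by its source [i > 0]. *)
Definition lin_tgt m (a : {i : 'I_m | (0 < i)%N}) : 'I_m :=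
  Ordinal (leq_ltn_trans (leq_pred (val a)) (ltn_ord (val a))).
Definition linear_quiver (m : nat) : quiver :=
  @Quiver 'I_m {i : 'I_m | (0 < i)%N} val (@lin_tgt m).

(* The oriented cycle on n vertices (a loop if n = 1). *)
Definition cyclic_quiver (n : nat) : quiver :=
  @Quiver 'I_n 'I_n id (@ordS n).

Section BoundQuiverAlgebras.
Variable K : fieldType.

Definition arrow_ideal (Q : quiver) : path_algebra K Q -> Prop :=
  generated_ideal (fun x => exists a : arrow Q, x = pelt K (parrow a)).

Definition admissible (Q : quiver) (I : path_algebra K Q -> Prop) :=
  [/\ ideal I,
      forall x, I x -> ideal_pow (@arrow_ideal Q) 2 x &
      exists2 N, (2 <= N)%N & forall x, ideal_pow (@arrow_ideal Q) N x -> I x].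

(* A is isomorphic to KQ/I as a K-algebra: there is a surjective K-algebra
   morphism KQ -> A with kernel I. *)
Definition iso_quotient (Q : quiver) (I : path_algebra K Q -> Prop) (A : falgType K) :=
  exists f : {rmorphism path_algebra K Q -> A},
    [/\ scalable f, forall a, exists x, f x = a & forall x, f x = 0 <-> I x].

Definition nakayama (A : falgType K) :=
  (exists2 m, (1 <= m)%N & exists2 I, admissible I & @iso_quotient (linear_quiver m) I A)
  \/
  (exists2 n, (1 <= n)%N & exists2 I, admissible I & @iso_quotient (cyclic_quiver n) I A).

Definition iso_Lambda (m l : nat) (A : falgType K) :=
  @iso_quotient (linear_quiver m) (ideal_pow (@jacobson _) l) A.

End BoundQuiverAlgebras.

(* Modules over a ring R; mod R is the full subcategory of those satisfying
   [fin_gen]. *)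
Section Modules.
Variable R : pzRingType.
Implicit Types (M N X Y : lmodType R) (C : lmodType R -> Prop).

Definition fin_gen M :=
  exists n (g : 'I_n -> M), forall x, exists c : 'I_n -> R, x = \sum_i c i *: g i.

Definition iso_mod M N := exists f : {linear M -> N}, bijective f.

Definition summand X M := exists Y, iso_mod (X * Y)%type M.

(* add M : the power [{ffun 'I_n -> M}] is the direct sum of n copies of M. *)
Definition add_subcat M X := exists n, summand X {ffun 'I_n -> M}.

Definition projective P :=
  forall M N (g : {linear M -> N}) (f : {linear P -> N}),
    (forall y, exists x, g x = y) -> exists h : {linear P -> M}, forall x, g (h x) = f x.

Record proj_resolution M := ProjResolution {
  res_obj :> nat -> lmodType R;
  res_d : forall i, {linear res_obj i.+1 -> res_obj i};
  res_eps : {linear res_obj 0%N -> M};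
  res_fg : forall i, fin_gen (res_obj i);
  res_proj : forall i, projective (res_obj i);
  res_eps_surj : forall y, exists x, res_eps x = y;
  res_exact0 : forall x, res_eps x = 0 <-> exists y, res_d 0%N y = x;
  res_exact : forall i x, res_d i x = 0 <-> exists y, res_d i.+1 y = x }.

Definition coboundary M N (P : proj_resolution M) (i : nat) : {linear P i -> N} -> Prop :=
  if i is j.+1 then fun h => exists g : {linear P j -> N}, forall x, h x = g (res_d P j x)
  else fun h => forall x, h x = 0.

(* Ext^i(M, N) = H^i(Hom(P, N)) for a projective resolution P of M, which does
   not depend on P; [Ext_zero i M N] is Ext^i(M, N) = 0. *)
Definition Ext_zero (i : nat) M N :=
  exists P : proj_resolution M, forall h : {linear P i -> N},
    (forall x, h (res_d P i x) = 0) -> coboundary h.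

Definition pd_le M (n : nat) :=
  exists P : proj_resolution M, forall i, (n < i)%N -> forall x : P i, x = 0.

Definition gldim_le (n : nat) := forall M, fin_gen M -> pd_le M n.

Definition gldim_eq (d : nat) := gldim_le d /\ forall e, gldim_le e -> (d <= e)%N.

Definition right_approx C M :=
  exists X (f : {linear X -> M}), C X /\
    forall X' (g : {linear X' -> M}), C X' ->
      exists h : {linear X' -> X}, forall x, g x = f (h x).

Definition left_approx C M :=
  exists X (f : {linear M -> X}), C X /\
    forall X' (g : {linear M -> X'}), C X' ->
      exists h : {linear X -> X'}, forall x, g x = h (f x).

Definition functorially_finite C :=
  forall M, fin_gen M -> left_approx C M /\ right_approx C M.

Definition sum_summand_closed C :=
  (forall X Y, C X -> C Y -> C (X * Y)%type) /\ (forall X Y, summand X Y -> C Y -> C X).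

Definition cluster_tilting (n : nat) C :=
  [/\ forall X, C X -> fin_gen X,
      sum_summand_closed C,
      functorially_finite C,
      forall X, C X <-> fin_gen X /\
        (forall Y i, C Y -> (0 < i < n)%N -> Ext_zero i Y X) &
      forall X, C X <-> fin_gen X /\
        (forall Y i, C Y -> (0 < i < n)%N -> Ext_zero i X Y)].

End Modules.

(* Right A-modules are the modules over the converse ring A^c. *)
Section RegularModules.
Variables (K : fieldType) (A : falgType K).

Definition reg_mod : lmodType A^c := (A^c)^o.

(* D A = Hom_K(A, K), with (f . a) x = f (a x). *)
Definition dual_reg : Type := 'Hom(A, K^o).
HB.instance Definition _ := GRing.Zmodule.on dual_reg.

Definition dual_scale (a : A^c) (f : dual_reg) : dual_reg :=
  (f \o amull (a : A))%VF.

Lemma dual_scaleE a f x : dual_scale a f x = f ((a : A) * x).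
Proof. by rewrite comp_lfunE lfunE. Qed.

Lemma dual_scaleA a b f : dual_scale a (dual_scale b f) = dual_scale (a * b) f.
Proof. by apply/lfunP => x; rewrite !dual_scaleE mulrA. Qed.
Lemma dual_scale1 : left_id 1 dual_scale.
Proof. by move=> f; apply/lfunP => x; rewrite dual_scaleE mul1r. Qed.
Lemma dual_scaleDr : right_distributive dual_scale +%R.
Proof. by move=> a f g; apply/lfunP => x; rewrite !(dual_scaleE, add_lfunE). Qed.
Lemma dual_scaleDl f : {morph dual_scale^~ f : a b / a + b}.
Proof.
by move=> a b; apply/lfunP => x; rewrite !(dual_scaleE, add_lfunE) mulrDl raddfD.
Qed.
HB.instance Definition _ := GRing.Zmodule_isLmodule.Build A^c dual_reg
  dual_scaleA dual_scale1 dual_scaleDr dual_scaleDl.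

Definition dual_mod : lmodType A^c := dual_reg.

End RegularModules.

(* Main.v *)
(* A Nakayama algebra is described by positions 0, 1, 2, ... read modulo n and a nondecreasing
   function f, where f x ([endp D x] below) is the first position not reached by a nonzero path
   from x; a linear quiver is a cycle whose last arrow is zero.  The indecomposable modules are
   the intervals [a, b[ with a < b <= f a, and the syzygy of [a, b[ is [b, f a[.  So projective
   resolutions alternate between the f-orbits of a and b, and the vanishing of Ext is an
   inequality between endpoints.

   A d-cluster tilting subcategory contains A and DA, hence Ext^i(DA, A) = 0 for 0 < i < d, and
   every nonprojective indecomposable injective has projective dimension exactly d.  In the
   cyclic case this is incompatible with the finite projective dimension of the simple modules.
   In the linear case it forces f x = min(x + l, m) with m = kl + 1 if d = 2k and m = (k + 1)l
   if d = 2k + 1.  In the odd case l >= 3 is excluded: the simple module at position m - 2 would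
   belong to the subcategory although Ext^1 from it to A is nonzero.  Conversely, for the
   remaining algebras every interval that is neither projective nor injective has a nonzero Ext^i
   from DA and a nonzero Ext^j to A with 0 < i, j < d, while Ext^i(DA, A) = 0. *)

Require Import Defs.
From HB Require Import structures.
From mathcomp Require Import all_boot all_order all_algebra all_field.
From mathcomp Require Import finmap.
From mathcomp.multinomials Require Import monalg.
From Stdlib Require Import Classical ClassicalEpsilon.
From mathcomp Require Import zify.
Set Implicit Arguments.
Unset Strict Implicit.
Unset Printing Implicit Defensive.
Import GRing.Theory.
Local Open Scope ring_scope.

(** * Comparison of projective resolutions *)

(** Vanishing of [Ext] is stated through one unspecified resolution, and cluster tilting quantifies
    over all finitely generated modules; so resolutions must be compared, and every such module
    decomposed into intervals, before any counting can begin. Positions stay unreduced in [nat]: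
    then [endp] is monotone and commutes with the shift by n, and a resolution is read off from the
    iterates of this single function at two points. The projective dimension of a nonprojective
    injective cannot be smaller than d because an interval of finite projective dimension p > 0 has
    nonzero Ext^p into A. The constants for m come from the last syzygy, which starts at the last
    position m - 1: once f is translation by l, the 2k-th syzygy of [0, 1[ starts at kl and the
    (2k+1)-st syzygy of [0, l-1[ at kl + l - 1. For odd d and l >= 3 the position m - 2 = kl + l - 2
    lies beyond kl, which bounds the starting points of the i-th syzygies, i < d, of the
    nonprojective injectives; this is why the simple module there escapes them. *)

Section Kernel.
Variables (R : pzRingType) (M N : lmodType R) (f : {linear M -> N}).

Definition ker_pred : pred M := fun x => f x == 0.
Lemma ker_pred_closed : submod_closed ker_pred.
Proof.
split; first by rewrite unfold_in raddf0.
by move=> a x y; rewrite !unfold_in linearP => /eqP-> /eqP->; rewrite scaler0 addr0.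
Qed.
HB.instance Definition _ := GRing.isSubmodClosed.Build R M ker_pred ker_pred_closed.

Record ker_mod := KerMod { ker_val :> M; _ : ker_val \in ker_pred }.
HB.instance Definition _ := [isSub for ker_val].
HB.instance Definition _ := [Choice of ker_mod by <:].
HB.instance Definition _ := [SubChoice_isSubLmodule of ker_mod by <:].

Lemma ker_val_linear : linear ker_val.
Proof. by move=> a x y; exact: (linearP (\val : ker_mod -> M)). Qed.
HB.instance Definition _ := GRing.isLinear.Build R ker_mod M _ ker_val ker_val_linear.

Lemma ker_valP (x : ker_mod) : f (ker_val x) = 0.
Proof. by case: x => x /= /eqP. Qed.

Definition to_ker (x : M) (fx : f x = 0) : ker_mod := KerMod (introT eqP fx : x \in ker_pred).

Section Lift.
Variables (L : lmodType R) (g : {linear L -> M}) (fg : forall x, f (g x) = 0).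
Definition ker_lift (x : L) : ker_mod := to_ker (fg x).
Lemma ker_lift_linear : linear ker_lift.
Proof. by move=> a x y; apply: val_inj; rewrite linearP /= linearP. Qed.
HB.instance Definition _ := GRing.isLinear.Build R L ker_mod _ ker_lift ker_lift_linear.
End Lift.

End Kernel.

Section MakeLinear.
Variables (R : pzRingType) (M N : lmodType R) (f : M -> N) (Hf : linear f).
Definition linear_map of linear f := f.
HB.instance Definition _ := GRing.isLinear.Build R M N _ (linear_map Hf) Hf.
Definition mklin : {linear M -> N} := linear_map Hf.
Lemma mklinE x : mklin x = f x. Proof. by []. Qed.
End MakeLinear.

Section Comparison.
Variable R : pzRingType.

(** Exactness at [Y] makes [g] surjective onto the kernel of [h], so projectivity is applied to the
    corestrictions of [f] and [g] to that kernel. *)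
Lemma proj_lift (P X Y Z : lmodType R) (f : {linear P -> Y}) (g : {linear X -> Y})
    (h : {linear Y -> Z}) : projective P ->
  (forall y, h y = 0 <-> exists x, g x = y) ->
  (forall x, h (f x) = 0) -> exists f' : {linear P -> X}, forall x, g (f' x) = f x.
Proof.
move=> Pp ex hf0.
have hg0 x : h (g x) = 0 by apply/ex; exists x.
have [|f' Hf'] := Pp _ _ (ker_lift hg0) (ker_lift hf0).
  move=> y; have [x gx] := proj1 (ex _) (ker_valP y).
  by exists x; apply: val_inj.
by exists f' => x; have /(congr1 (@ker_val _ _ _ _)) := Hf' x.
Qed.

Variables (M M' : lmodType R) (phi : {linear M -> M'}).
Variables (P : proj_resolution M) (Q : proj_resolution M').

(** Two consecutive components travel together with their commuting square, which is exactly what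
    the recursion on the degree needs in order to lift once more. *)
Definition chain_step i := {u : {linear P i -> Q i} * {linear P i.+1 -> Q i.+1} |
  forall x, res_d Q i (u.2 x) = u.1 (res_d P i x)}.

Lemma chain_start : exists u : chain_step 0,
  forall x, res_eps Q ((sval u).1 x) = phi (res_eps P x).
Proof.
have [u0 Hu0] := @res_proj _ _ P 0%N _ _ (res_eps Q)
  (phi \o res_eps P : {linear _ -> _}) (@res_eps_surj _ _ Q).
have [|u1 Hu1] := proj_lift (f := (u0 \o res_d P 0 : {linear _ -> _})) (@res_proj _ _ P 1%N)
  (@res_exact0 _ _ Q).
  move=> x /=; rewrite Hu0 /=; have -> : res_eps P (res_d P 0 x) = 0.
    by apply/(@res_exact0 _ _ P); exists x.
  by rewrite raddf0.
by exists (exist _ (u0, u1) Hu1).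
Qed.

Lemma chain_next i (u : chain_step i) :
  {v : chain_step i.+1 | (sval v).1 = (sval u).2}.
Proof.
apply: constructive_indefinite_description.
case: u => -[u0 u1] /= Hu.
have [|u2 Hu2] := proj_lift (f := (u1 \o res_d P i.+1 : {linear _ -> _}))
  (@res_proj _ _ P i.+2) (@res_exact _ _ Q i).
  move=> x /=; rewrite Hu.
  have -> : res_d P i (res_d P i.+1 x) = 0 by apply/res_exact; exists x.
  by rewrite raddf0.
by exists (exist _ (u1, u2) Hu2).
Qed.

Lemma chain_map : exists u : forall i, {linear P i -> Q i},
  (forall x, res_eps Q (u 0%N x) = phi (res_eps P x)) /\
  (forall i x, res_d Q i (u i.+1 x) = u i (res_d P i x)).
Proof.
have [s0 Hs0] := chain_start.
pose s := nat_rect chain_step s0 (fun j sj => sval (chain_next sj)).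
exists (fun i => (sval (s i)).1); split=> [//|i x].
by rewrite /= (svalP (chain_next (s i))) (svalP (s i)).
Qed.

End Comparison.

Section Homotopy.
Variables (R : pzRingType) (M : lmodType R) (P : proj_resolution M).
Variable u : forall i, {linear P i -> P i}.
Hypothesis u_eps : forall x, res_eps P (u 0%N x) = 0.
Hypothesis u_d : forall i x, res_d P i (u i.+1 x) = u i (res_d P i x).

Lemma res_dd i x : res_d P i (res_d P i.+1 x) = 0.
Proof. by apply/res_exact; exists x. Qed.

(** The induction carries only [s] with d (u - s d) = 0, the condition under which the next
    component lifts. [Ext] in one degree needs no coherent family of homotopies. *)
Lemma null_homotopy i : exists (s : {linear P i -> P i.+1}) (t : {linear P i.+1 -> P i.+2}),
  forall x, u i.+1 x = res_d P i.+1 (t x) + s (res_d P i x).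
Proof.
suff [s Hs] : exists s : {linear P i -> P i.+1},
    forall x, res_d P i (u i.+1 x - s (res_d P i x)) = 0.
  have [|t Ht] := proj_lift (f := (u i.+1 \- (s \o res_d P i) : {linear _ -> _}))
    (@res_proj _ _ P i.+1) (@res_exact _ _ P i).
    exact: Hs.
  by exists s, t => x; rewrite Ht /= subrK.
elim: i => [|i [s Hs]].
  have [|s Hs] := proj_lift (f := u 0%N) (@res_proj _ _ P 0%N) (@res_exact0 _ _ P) => //.
  by exists s => x; rewrite raddfB /= u_d Hs subrr.
have [|t Ht] := proj_lift (f := (u i.+1 \- (s \o res_d P i) : {linear _ -> _}))
    (@res_proj _ _ P i.+1) (@res_exact _ _ P i).
  exact: Hs.
exists t => x; rewrite raddfB /= u_d Ht /= res_dd raddf0 subr0 subrr //.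
Qed.
End Homotopy.

(** For chain maps u, v over [rho], [iota], the map uv - 1 lifts zero, hence is null homotopic. A
    cocycle h on [Q] yields the cocycle hu on the other resolution, so hu = gd and h = (gv - hs)d.
    The identity retraction gives independence of the resolution. *)
Lemma Ext_zero_retract_res (R : pzRingType) (X M N : lmodType R) (iota : {linear X -> M})
    (rho : {linear M -> X}) (Q : proj_resolution X) i : cancel iota rho -> Ext_zero i.+1 M N ->
  forall h : {linear Q i.+1 -> N}, (forall x, h (res_d Q i.+1 x) = 0) ->
  exists g : {linear Q i -> N}, forall x, h x = g (res_d Q i x).
Proof.
move=> iK [P HP] h Hh.
have [u [u_eps u_d]] := chain_map rho P Q.
have [v [v_eps v_d]] := chain_map iota Q P.
have [||s [t Hst]] := @null_homotopy _ _ Q (fun i => (u i \o v i) \- idfun : {linear _ -> _}) _ _ i.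
- by move=> x /=; rewrite raddfB /= u_eps v_eps iK subrr.
- by move=> j x /=; rewrite raddfB /= u_d v_d.
have [|g Hg] := HP (h \o u i.+1 : {linear _ -> _}).
  by move=> x /=; rewrite -u_d Hh.
exists ((g \o v i) \- (h \o s) : {linear _ -> _}) => x /=.
have e : h (u i.+1 (v i.+1 x)) - h x = h (s (res_d Q i x)).
  rewrite -[LHS](raddfB h).
  have hD a b : h (a + b) = h a + h b by exact: linearD.
  move: (Hst x) => /=; set p := u _ _; set q := res_d _ _ _; set r := s _ => e.
  have qh : h q = 0 by exact: Hh.
  by rewrite -[h r]add0r -qh -hD -e.
have gg : h (u i.+1 (v i.+1 x)) = g (v i (res_d Q i x)) by rewrite -v_d; exact: Hg.
by rewrite /= -gg -e opprB addrCA subrr addr0.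
Qed.

Lemma Ext_zero_res (R : pzRingType) (M N : lmodType R) (Q : proj_resolution M) i :
  Ext_zero i.+1 M N <-> forall h : {linear Q i.+1 -> N},
    (forall x, h (res_d Q i.+1 x) = 0) ->
    exists g : {linear Q i -> N}, forall x, h x = g (res_d Q i x).
Proof.
split=> [H h Hh|H]; last by exists Q.
by apply: (Ext_zero_retract_res (iota := idfun) (rho := idfun) _ H).
Qed.

Lemma Ext_zero_retractr (R : pzRingType) (M N N' : lmodType R) (iota : {linear N' -> N})
    (rho : {linear N -> N'}) i : cancel iota rho -> Ext_zero i.+1 M N -> Ext_zero i.+1 M N'.
Proof.
move=> iK [P HP]; exists P => h h0.
have [x|g Hg] := HP (iota \o h : {linear _ -> _}); first by rewrite /= h0 raddf0.
by exists (rho \o g : {linear _ -> _}) => x /=; rewrite -Hg /= iK.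
Qed.

(** * Modules with a basis of intervals *)

(* [nd_w a t] is the path of length [t] starting at position [a], where positions are natural
   numbers read modulo the number [nd_n] of vertices; the product is that of the opposite
   algebra.  A linear quiver is the degenerate cyclic case in which the last arrow is zero. *)
Record nakData (K : fieldType) (R : pzRingType) := NakData {
  nd_k : {rmorphism K -> R};
  nd_central : forall c r, nd_k c * r = r * nd_k c;
  nd_n : nat;
  nd_n_gt0 : (0 < nd_n)%N;
  nd_w : nat -> nat -> R;
  nd_ell : nat -> nat;
  nd_wM : forall a s t, nd_w (a + s) t * nd_w a s = nd_w a (s + t);
  nd_wM0 : forall a s b t, b <> a + s %[mod nd_n] -> nd_w b t * nd_w a s = 0;
  nd_w_mod : forall a b t, a = b %[mod nd_n] -> nd_w a t = nd_w b t;
  nd_w_one : \sum_(a < nd_n) nd_w a 0 = 1;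
  nd_w_span : forall r, exists c : nat -> nat -> K,
    r = \sum_(a < nd_n) \sum_(t < nd_ell a) nd_k (c a t) * nd_w a t;
  nd_w_eq0 : forall a t, nd_w a t = 0 <-> (nd_ell a <= t)%N;
  nd_ell_gt0 : forall a, (0 < nd_ell a)%N }.

Section NakayamaData.
Variables (K : fieldType) (R : pzRingType) (D : nakData K R).
Notation k := (nd_k D).
Notation n := (nd_n D).
Notation w := (nd_w D).
Notation ell := (nd_ell D).

Lemma scale_central (M : lmodType R) c r (x : M) : k c *: (r *: x) = r *: (k c *: x).
Proof. by rewrite !scalerA nd_central. Qed.

Lemma ell_mod a b : a = b %[mod n] -> ell a = ell b.
Proof.
move=> ab; apply/eqP; rewrite eqn_leq; apply/andP; split; apply/nd_w_eq0.
  by rewrite (nd_w_mod _ ab); apply/nd_w_eq0.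
by rewrite -(nd_w_mod _ ab); apply/nd_w_eq0.
Qed.

Lemma ell_addr a s : (ell a <= s + ell (a + s))%N.
Proof.
apply/nd_w_eq0; rewrite -nd_wM; suff -> : w (a + s) (ell (a + s)) = 0 by rewrite mul0r.
by apply/nd_w_eq0.
Qed.

Definition endp a := (a + ell a)%N.

Lemma endp_mono a b : (a <= b)%N -> (endp a <= endp b)%N.
Proof. by move=> ab; have := ell_addr a (b - a); rewrite /endp subnKC //; lia. Qed.

Lemma endp_gt a : (a < endp a)%N.
Proof. by have := nd_ell_gt0 D a; rewrite /endp; lia. Qed.

Lemma endp_addn a : endp (a + n) = (endp a + n)%N.
Proof. by rewrite /endp (@ell_mod (a + n) a) ?modnDr // addnAC. Qed.

Lemma wM_mod a s b t : b = a + s %[mod n] -> w b t * w a s = w a (s + t).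
Proof. by move=> e; rewrite (nd_w_mod t e) nd_wM. Qed.

Lemma w_idem a t : w a t * w a 0 = w a t.
Proof. by rewrite wM_mod ?addn0. Qed.

Lemma w_idemL a t b : b = a + t %[mod n] -> w b 0 * w a t = w a t.
Proof. by move=> e; rewrite wM_mod ?addn0. Qed.

Lemma w_split a s t : (s <= t)%N -> w a t = w (a + s) (t - s) * w a s.
Proof. by move=> st; rewrite nd_wM subnKC. Qed.

Lemma w_kill (M : lmodType R) (v : M) a L t : (L <= t)%N -> w a L *: v = 0 -> w a t *: v = 0.
Proof. by move=> Lt v0; rewrite (w_split a Lt) -scalerA v0 scaler0. Qed.

(* Multiplying by the path from position [a + t] to [a + T] isolates the first nonzero term. *)
Lemma w_free (M : lmodType R) (v : M) a T (c : nat -> K) :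
  w a T *: v <> 0 -> w a T.+1 *: v = 0 ->
  \sum_(t < T.+1) k (c t) *: (w a t *: v) = 0 -> forall t, (t <= T)%N -> c t = 0.
Proof.
move=> vT v0 sum0 t; elim/ltn_ind: t => t IH tT.
have := congr1 (fun x => w (a + t) (T - t) *: x) sum0; rewrite scaler0 scaler_sumr.
have ltT : (t < T.+1)%N by [].
rewrite (bigD1 (Ordinal ltT)) //= big1 ?addr0 => [|s /eqP neq]; last first.
  have [st|ts|e] := ltngtP s t; last by case: neq; apply: val_inj.
  - by rewrite IH ?rmorph0 ?scale0r ?scaler0 // (leq_trans (ltnW st)).
  - rewrite -scale_central (scalerA (w (a + t) _)).
    have [e|ne] := boolP (a + t == a + s %[mod n]).
      rewrite wM_mod ?(eqP e) // (w_kill (L := T.+1)) ?scaler0 //; lia.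
    by rewrite nd_wM0 ?scale0r ?scaler0 //; apply/eqP.
rewrite -scale_central (scalerA (w (a + t) _)) nd_wM subnKC // => kT.
apply/eqP/negPn/negP => ct0; apply: vT.
by rewrite -[w a T]mul1r -(rmorph1 k) -(mulVf ct0) rmorphM -mulrA -scalerA -scalerA kT scaler0.
Qed.

Lemma w_free_reg a (c : nat -> K) : \sum_(t < ell a) k (c t) * w a t = 0 ->
  forall t, (t < ell a)%N -> c t = 0.
Proof.
have := nd_ell_gt0 D a; case E: (ell a) => [//|T] _ sum0 t tT.
have wr t' : w a t' *: (w a 0 : R^o) = w a t' by exact: w_idem.
apply: (@w_free R^o (w a 0) a T c) => //.
- by rewrite wr => e; have := proj1 (nd_w_eq0 D a T) e; rewrite E ltnn.
- by rewrite wr; apply: (proj2 (nd_w_eq0 D a T.+1)); rewrite E.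
- by rewrite -[RHS]sum0; apply: eq_bigr => i _; rewrite wr.
Qed.

Lemma w_span_at r a : exists c : nat -> K, r * w a 0 = \sum_(t < ell a) k (c t) * w a t.
Proof.
have [c ->] := nd_w_span D r; exists (c (a %% n)%N).
have lt : (a %% n < n)%N by rewrite ltn_mod nd_n_gt0.
rewrite mulr_suml (bigD1 (Ordinal lt)) //= [X in _ + X]big1 ?addr0 => [|b /eqP neq].
  rewrite mulr_suml (@ell_mod (a %% n) a) ?modn_mod //; apply: eq_bigr => t _.
  by rewrite -mulrA wM_mod ?addn0 ?add0n ?modn_mod //.
rewrite mulr_suml big1 // => t _; rewrite -mulrA nd_wM0 ?mulr0 //.
by rewrite addn0 => e; apply: neq; apply: val_inj; rewrite /= -e modn_small.
Qed.

Lemma w_factor a u m (c : nat -> K) : (forall t, (t < m)%N -> (t < u)%N -> c t = 0) ->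
  exists r, \sum_(t < m) k (c t) * w a t = r * w a u.
Proof.
move=> c0; exists (\sum_(t < m | (u <= t)%N) k (c t) * w (a + u) (t - u)).
rewrite mulr_suml [LHS](bigID (fun t : 'I_m => (u <= t)%N)) /= [X in _ + X]big1 ?addr0.
  by apply: eq_bigr => t ut; rewrite -mulrA nd_wM subnKC.
by move=> t; rewrite -ltnNge => tu; rewrite c0 ?rmorph0 ?mul0r.
Qed.

(** This is the syzygy of an interval: whatever annihilates the path from [a] to [a + s] is a
    multiple of its continuation to [endp D a], because the nonzero paths from [a] are
    independent. *)
Lemma w_exact r a s : (s <= ell a)%N -> r * w (a + s) 0 = r -> r * w a s = 0 ->
  exists q, r = q * w (a + s) (ell a - s).
Proof.
move=> sl rE r0; have [c Ec] := w_span_at r (a + s); rewrite rE in Ec.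
rewrite Ec; apply: w_factor => t tl tu.
have lt : (s + t < ell a)%N by lia.
pose c' u := if (s <= u)%N then c (u - s)%N else 0.
have -> : c t = c' (s + t)%N by rewrite /c' leq_addr addKn.
apply: (w_free_reg (a := a)) => //; rewrite -[RHS]r0 {}Ec mulr_suml.
have lsl := ell_addr a s.
transitivity (\sum_(u < s + ell (a + s)) k (c' u) * w a u).
  rewrite (big_ord_widen _ (fun u => k (c' u) * w a u) lsl) big_mkcond /=.
  apply: eq_bigr => u _; case: ltnP => // ul.
  by rewrite (proj2 (nd_w_eq0 _ _ _) ul) mulr0.
rewrite big_split_ord /= big1 ?add0r => [|i _].
  by apply: eq_bigr => i _; rewrite -mulrA nd_wM /c' leq_addr addKn.
by rewrite /c' leqNgt ltn_ord rmorph0 mul0r.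
Qed.

Section IntervalBasis.
Variables (M : lmodType R) (I : finType) (a L : I -> nat) (v : I -> M).

(* [M] is the direct sum of the uniserial submodules generated by the [v j]; the [j]-th one
   has top at position [a j] and length [L j]. *)
Record ibasis : Prop := IBasis {
  ib_e : forall j, w (a j) 0 *: v j = v j;
  ib_0 : forall j, w (a j) (L j) *: v j = 0;
  ib_span : forall x, exists c : I -> nat -> K,
    x = \sum_j \sum_(t < L j) k (c j t) *: (w (a j) t *: v j);
  ib_free : forall c : I -> nat -> K,
    \sum_j \sum_(t < L j) k (c j t) *: (w (a j) t *: v j) = 0 ->
    forall j t, (t < L j)%N -> c j t = 0 }.

Hypothesis ib : ibasis.

Lemma ib_inj (c c' : I -> nat -> K) :
    \sum_j \sum_(t < L j) k (c j t) *: (w (a j) t *: v j) =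
    \sum_j \sum_(t < L j) k (c' j t) *: (w (a j) t *: v j) ->
  forall j t, (t < L j)%N -> c j t = c' j t.
Proof.
move=> e j t tL; apply/eqP; rewrite -subr_eq0; apply/eqP.
apply: (ib_free ib (c := fun j t => c j t - c' j t)) => //.
rewrite -[RHS](subrr (\sum_j \sum_(t < L j) k (c j t) *: (w (a j) t *: v j))) [X in _ = _ - X]e.
rewrite -sumrB; apply: eq_bigr => i _; rewrite -sumrB; apply: eq_bigr => u _.
by rewrite rmorphB scalerBl.
Qed.

Lemma ib_neq0 j t : (t < L j)%N -> w (a j) t *: v j <> 0.
Proof.
move=> tL e; suff /eqP : (1 : K) = 0 by rewrite oner_eq0.
pose c i s : K := ((i == j) && (s == t))%:R.
have <- : c j t = 1 by rewrite /c !eqxx.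
apply: (ib_free ib) => //; rewrite big1 // => i _; rewrite big1 // => s _.
have [st|st] := eqVneq (s : nat) t; last by rewrite /c (negPf st) andbF rmorph0 scale0r.
have [ij|ij] := eqVneq i j; last by rewrite /c (negPf ij) rmorph0 scale0r.
by rewrite st ij e scaler0.
Qed.

Lemma ib_le j : (L j <= ell (a j))%N.
Proof.
rewrite leqNgt; apply/negP => lt; apply: (ib_neq0 lt).
by rewrite (proj2 (nd_w_eq0 _ _ _)) ?scale0r.
Qed.

Lemma ib_gen x : exists r : I -> R, x = \sum_j r j *: v j.
Proof.
have [c ->] := ib_span ib x; exists (fun j => \sum_(t < L j) k (c j t) * w (a j) t).
by apply: eq_bigr => j _; rewrite scaler_suml; apply: eq_bigr => t _; rewrite scalerA.
Qed.

Lemma ib_rel (r : I -> R) : \sum_j r j *: v j = 0 ->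
  forall j, exists q, r j * w (a j) 0 = q * w (a j) (L j).
Proof.
move=> sum0 j.
have /choice [c Hc] : forall i, exists c : nat -> K, r i * w (a i) 0 =
    \sum_(t < ell (a i)) k (c t) * w (a i) t by move=> i; apply: w_span_at.
rewrite Hc; apply: w_factor => t tl tL.
apply: (ib_free ib (c := c)) => //; rewrite -[RHS]sum0; apply: eq_bigr => i _.
rewrite -(ib_e ib i) [RHS]scalerA Hc scaler_suml (ib_e ib).
rewrite (big_ord_widen _ (fun t => k (c i t) *: (w (a i) t *: v i)) (ib_le i)) big_mkcond /=.
apply: eq_bigr => u _; rewrite scalerA; case: ltnP => // ul.
by rewrite -scalerA (w_kill ul) ?scaler0 // (ib_0 ib).
Qed.

(** By [ib_rel] every relation among the generators follows from the two imposed on the images, so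
    the value does not depend on the chosen coefficients. *)
Lemma ib_hom (N : lmodType R) (u : I -> N) :
    (forall j, w (a j) 0 *: u j = u j) -> (forall j, w (a j) (L j) *: u j = 0) ->
  exists f : {linear M -> N}, forall j, f (v j) = u j.
Proof.
move=> ue u0.
have [r Hr] := choice _ ib_gen.
have wd (q q' : I -> R) : \sum_j q j *: v j = \sum_j q' j *: v j ->
    \sum_j q j *: u j = \sum_j q' j *: u j.
  move=> e; have sum0 : \sum_j (q j - q' j) *: v j = 0.
    transitivity (\sum_j q j *: v j - \sum_j q' j *: v j); last by rewrite e subrr.
    by rewrite -sumrB; apply: eq_bigr => i _; rewrite scalerBl.
  apply/eqP; rewrite -subr_eq0 -sumrB; apply/eqP/big1 => j _.
  by rewrite -scalerBl -ue scalerA; have [p ->] := ib_rel sum0 j; rewrite -scalerA u0 scaler0.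
have lin : linear (fun x => \sum_j r x j *: u j).
  move=> p x y; rewrite scaler_sumr -big_split /=.
  transitivity (\sum_j (p * r x j + r y j) *: u j); last first.
    by apply: eq_bigr => j _; rewrite scalerDl scalerA.
  apply: wd; rewrite -Hr [in LHS](Hr x) [in LHS](Hr y) scaler_sumr -big_split /=.
  by apply: eq_bigr => j _; rewrite scalerDl scalerA.
exists (mklin lin) => j; rewrite mklinE.
transitivity (\sum_i (i == j)%:R *: u i).
  apply: wd; rewrite -Hr (bigD1 j) //= eqxx scale1r big1 ?addr0 // => i /negPf->.
  by rewrite scale0r.
rewrite (bigD1 j) //= eqxx scale1r big1 ?addr0 // => i /negPf->.
by rewrite scale0r.
Qed.

Lemma ib_hom_eq (N : lmodType R) (f g : {linear M -> N}) :
  (forall j, f (v j) = g (v j)) -> forall x, f x = g x.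
Proof.
move=> e x; have [r ->] := ib_gen x; rewrite !linear_sum.
by apply: eq_bigr => j _; rewrite !linearZ /= e.
Qed.

Lemma ib_fin_gen : fin_gen M.
Proof.
exists #|I|, (fun i => v (enum_val i)) => x; have [r ->] := ib_gen x.
exists (fun i => r (enum_val i)).
by rewrite (reindex (enum_val (A := I))) //; exact: onW_bij (@enum_val_bij I).
Qed.

End IntervalBasis.
End NakayamaData.

(** * Projective resolutions of interval modules *)

Section IdempotentProjective.
Variables (R : pzRingType) (I : finType) (E : I -> R).
Hypothesis E_idem : forall j, E j * E j = E j.

(** The left ideal R E_j consists of the x with x E_j = x; a sum of such ideals is therefore a
    kernel and gets its module structure from [ker_mod]. *)
Definition coker_idem (x : {ffun I -> R^o}) : {ffun I -> R^o} := [ffun j => x j - x j * E j].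
Lemma coker_idem_linear : linear coker_idem.
Proof.
move=> r x y; apply/ffunP => j; rewrite !ffunE /= mulrDl scalerBr.
by rewrite -[r *: (x j * E j)]/(r * (x j * E j)) mulrA opprD addrACA.
Qed.
HB.instance Definition _ :=
  GRing.isLinear.Build R {ffun I -> R^o} {ffun I -> R^o} _ coker_idem coker_idem_linear.

(* The direct sum of the left ideals [R E_j]. *)
Definition idem_mod : lmodType R := ker_mod coker_idem.

Definition coor (x : idem_mod) (j : I) : R := ker_val x j.

Lemma coor_linear j : linear (coor^~ j : idem_mod -> R^o).
Proof. by move=> r x y; rewrite /coor linearP !ffunE. Qed.

Lemma coor0 j : coor 0 j = 0.
Proof. by rewrite /coor linear0 ffunE. Qed.

Lemma coorZ r x j : coor (r *: x) j = r * coor x j.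
Proof. by rewrite /coor linearZ /= ffunE. Qed.

Lemma coor_sum (J : finType) (r : J -> R) (y : J -> idem_mod) j :
  coor (\sum_i r i *: y i) j = \sum_i r i * coor (y i) j.
Proof. by rewrite /coor linear_sum sum_ffunE; apply: eq_bigr => i _; exact: coorZ. Qed.

Lemma coorE x j : coor x j * E j = coor x j.
Proof.
by have /ffunP/(_ j) := ker_valP x; rewrite !ffunE => /eqP; rewrite subr_eq0 => /eqP <-.
Qed.

Lemma coor_inj x y : (forall j, coor x j = coor y j) -> x = y.
Proof. by move=> e; apply: val_inj; apply/ffunP. Qed.

Lemma single_subproof j0 p : p * E j0 = p ->
  coker_idem [ffun j => if j == j0 then p else 0] = 0.
Proof.
move=> pE; apply/ffunP => j; rewrite !ffunE; case: eqP => [->|_]; last by rewrite mul0r subrr.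
by rewrite pE subrr.
Qed.

Lemma exists_single j0 p : p * E j0 = p ->
  exists x : idem_mod, forall j, coor x j = if j == j0 then p else 0.
Proof. by move=> pE; exists (to_ker (single_subproof pE)) => j; rewrite /coor ffunE. Qed.

Definition idem_gen j : idem_mod := to_ker (single_subproof (E_idem j)).

Lemma coor_gen i j : coor (idem_gen i) j = if j == i then E i else 0.
Proof. by rewrite /coor ffunE. Qed.

Lemma idem_genE j : E j *: idem_gen j = idem_gen j.
Proof.
by apply: coor_inj => i; rewrite coorZ coor_gen; case: eqP; rewrite ?mulr0 ?E_idem.
Qed.

Lemma idem_mod_gen x : x = \sum_j coor x j *: idem_gen j.
Proof.
apply: coor_inj => i; rewrite coor_sum (bigD1 i) //= big1.
  by rewrite addr0 coor_gen eqxx coorE.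
by move=> j /negPf ji; rewrite coor_gen eq_sym ji mulr0.
Qed.

Lemma idem_hom_linear (N : lmodType R) (u : I -> N) : linear (fun x : idem_mod => \sum_j coor x j *: u j).
Proof.
move=> r x y; rewrite scaler_sumr -big_split; apply: eq_bigr => j _ /=.
by rewrite coor_linear scalerDl scalerA.
Qed.
Definition idem_hom (N : lmodType R) (u : I -> N) := mklin (idem_hom_linear u).

Lemma idem_hom_gen (N : lmodType R) (u : I -> N) j : idem_hom u (idem_gen j) = E j *: u j.
Proof.
rewrite mklinE (bigD1 j) //= big1; first by rewrite addr0 coor_gen eqxx.
by move=> i ij; rewrite coor_gen (negPf ij) scale0r.
Qed.

Lemma idem_mod_projective : projective idem_mod.
Proof.
move=> M N g f gsurj; have [m Hm] := choice (fun j m => g m = f (idem_gen j)) (fun j => gsurj _).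
exists (idem_hom m) => x; rewrite mklinE [in RHS](idem_mod_gen x) !linear_sum.
by apply: eq_bigr => j _; rewrite !linearZ /= Hm.
Qed.

Lemma idem_mod_fin_gen : fin_gen idem_mod.
Proof.
exists #|I|, (fun i => idem_gen (enum_val i)) => x; rewrite [x]idem_mod_gen.
exists (fun i => coor x (enum_val i)).
by rewrite (reindex (enum_val (A := I))) //; exact: onW_bij (@enum_val_bij I).
Qed.

End IdempotentProjective.
Arguments idem_hom {R I E N} u.

Section Resolution.
Variables (K : fieldType) (R : pzRingType) (D : nakData K R).
Notation k := (nd_k D).
Notation n := (nd_n D).
Notation w := (nd_w D).
Notation ell := (nd_ell D).
Notation ep := (endp D).

(* Syzygies of uniserial modules, encoded as intervals [x, y[ of positions. *)
Definition syz_step (s : nat * nat) : nat * nat :=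
  if (s.1 < s.2)%N then (s.2, ep s.1) else (s.1, s.1).
Definition syz i x y := iter i syz_step (x, y).

Lemma syzS i x y : syz i.+1 x y = syz_step (syz i x y).
Proof. by rewrite /syz iterS. Qed.

Lemma syz_ok i x y : (x <= y <= ep x)%N ->
  ((syz i x y).1 <= (syz i x y).2 <= ep (syz i x y).1)%N.
Proof.
move=> ok; elim: i => [//|i]; rewrite /syz iterS -/(syz i x y); case: (syz i x y) => p q /= /andP[pq qe].
rewrite /syz_step /=; case: ifP => [lt|_] /=; rewrite ?leqnn ?(ltnW (endp_gt _ _)) //.
by rewrite qe endp_mono.
Qed.

Variables (M : lmodType R) (I : finType) (a L : I -> nat) (v : I -> M).
Hypothesis ib : ibasis D a L v.

Definition syz_at i j := syz i (a j) (a j + L j).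

Lemma syz_at_ok i j :
  ((syz_at i j).1 <= (syz_at i j).2 <= ep (syz_at i j).1)%N.
Proof. by apply: syz_ok; rewrite leq_addr leq_add2l (ib_le ib). Qed.

(** A zero idempotent marks an exhausted resolution, so that summands of different projective
    dimension fit in one family indexed by [I]. *)
Definition res_idem i j : R := if ((syz_at i j).1 < (syz_at i j).2)%N then w (syz_at i j).1 0 else 0.
Definition res_path i j : R := if ((syz_at i j).1 < (syz_at i j).2)%N
  then w (syz_at i j).1 ((syz_at i j).2 - (syz_at i j).1)%N else 0.

Lemma res_idemP i j : res_idem i j * res_idem i j = res_idem i j.
Proof. by rewrite /res_idem; case: ifP => _; rewrite ?mul0r // w_idem. Qed.

Lemma res_path_idem i j : res_path i j * res_idem i j = res_path i j.
Proof. by rewrite /res_path /res_idem; case: ifP => _; rewrite ?mul0r // w_idem. Qed.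

Lemma syz_atS i j : syz_at i.+1 j = syz_step (syz_at i j).
Proof. by rewrite /syz_at /syz iterS. Qed.

Lemma idem_res_path i j : res_idem i.+1 j * res_path i j = res_path i j.
Proof.
rewrite /res_path /res_idem syz_atS /syz_step; have := syz_at_ok i j.
case: (syz_at i j) => x y /= /andP[xy ye]; case: (ltnP x y) => [lt|_] /=; last by rewrite ltnn mul0r.
case: ltnP => [lt'|ge]; first by rewrite w_idemL // subnKC.
rewrite mul0r; apply/esym/nd_w_eq0; move: ge; rewrite /endp; lia.
Qed.

Lemma res_path_path i j : res_path i.+1 j * res_path i j = 0.
Proof.
rewrite /res_path syz_atS /syz_step; have := syz_at_ok i j.
case: (syz_at i j) => x y /= /andP[xy ye]; case: (ltnP x y) => [lt|_] /=; last by rewrite ltnn mul0r.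
case: ltnP => [lt'|ge]; last by rewrite mul0r.
rewrite wM_mod ?subnKC //; apply/nd_w_eq0; rewrite /endp; lia.
Qed.

(** Exactness is tested summand by summand. On a nonempty interval it is [w_exact]; in the remaining
    cases the idempotent is zero and forces r = 0. *)
Lemma res_path_exact i j (r : R) : r * res_idem i.+1 j = r -> r * res_path i j = 0 ->
  exists q, q * res_idem i.+2 j = q /\ r = q * res_path i.+1 j.
Proof.
suff H : r * res_idem i.+1 j = r -> r * res_path i j = 0 -> exists q, r = q * res_path i.+1 j.
  move=> rE r0; have [q ->] := H rE r0; exists (q * res_idem i.+2 j).
  by rewrite -!mulrA res_idemP idem_res_path.
rewrite /res_path /res_idem syz_atS /syz_step; have := syz_at_ok i j.
case: (syz_at i j) => x y /= /andP[xy ye]; case: (ltnP x y) => [lt|_] /=; last first.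
  by rewrite ltnn mulr0 => <- _; exists 0; rewrite mul0r.
case: (ltnP y (ep x)) => [lt'|ge]; last first.
  by rewrite mulr0 => <- _; exists 0; rewrite mul0r.
move=> rE r0; have [||q ->] := w_exact (a := x) (s := (y - x)%N) _ _ r0.
- by move: ye; rewrite /endp; lia.
- by rewrite subnKC.
by exists q; rewrite subnKC //; congr (q * w y _); rewrite /endp; lia.
Qed.

Lemma res_diff_exists i : exists f : {linear idem_mod (res_idem i.+1) -> idem_mod (res_idem i)},
  forall x j, coor (f x) j = coor x j * res_path i j.
Proof.
have /choice [u Hu] : forall j0, exists x : idem_mod (res_idem i), forall j,
    coor x j = if j == j0 then res_path i j else 0.
  by move=> j0; have [x Hx] := exists_single (res_path_idem i j0);
    exists x => j; rewrite Hx; case: eqP => [->|].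
exists (idem_hom u) => x j; rewrite mklinE coor_sum (bigD1 j) //= big1.
  by rewrite addr0 Hu eqxx.
by move=> l /negPf lj; rewrite Hu eq_sym lj mulr0.
Qed.

Definition res_diff i := proj1_sig (constructive_indefinite_description _ (res_diff_exists i)).
Lemma coor_diff i x j : coor (res_diff i x) j = coor x j * res_path i j.
Proof. by rewrite /res_diff; case: constructive_indefinite_description. Qed.

Definition res_aug : {linear idem_mod (res_idem 0) -> M} := idem_hom v.

Lemma res_idem0 j : res_idem 0 j *: v j = v j.
Proof.
rewrite /res_idem /syz_at /= -[X in (X < _)%N]addn0 ltn_add2l.
case: posnP => [L0|_]; last exact: (ib_e ib).
by rewrite scale0r; have := ib_0 ib j; rewrite L0 (ib_e ib).
Qed.

Lemma res_aug_surj y : exists x, res_aug x = y.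
Proof.
have [r ->] := ib_gen ib y; exists (\sum_j r j *: idem_gen (res_idemP 0) j).
rewrite linear_sum; apply: eq_bigr => j _.
by rewrite linearZ /= [X in _ *: X](idem_hom_gen (res_idemP 0)) res_idem0.
Qed.

Lemma idem_mod_build (E : I -> R) (r : I -> R) : (forall j, r j * E j = r j) ->
  exists x : idem_mod E, forall j, coor x j = r j.
Proof.
move=> rE; have e0 : coker_idem E [ffun j => r j] = 0.
  by apply/ffunP => j; rewrite !ffunE rE subrr.
by exists (to_ker e0) => j; rewrite /coor ffunE.
Qed.

Lemma res_aug_exact x : res_aug x = 0 <-> exists y, res_diff 0 y = x.
Proof.
split=> [x0|[y <-]]; last first.
  rewrite mklinE big1 // => j _; rewrite coor_diff -scalerA.
  suff -> : res_path 0 j *: v j = 0 by rewrite scaler0.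
  rewrite /res_path; case: ifP => _; last by rewrite scale0r.
  by rewrite /= addKn (ib_0 ib).
have rel := ib_rel ib x0.
have [q Hq] : exists q : I -> R, forall j, coor x j = q j * res_path 0 j.
  apply: (choice (fun j q => coor x j = q * res_path 0 j)) => j.
  have [q] := rel j; have := coorE x j; rewrite /res_idem /res_path /=.
  rewrite addKn; case: ltnP => _; last first.
    by rewrite mulr0 => <-; exists 0; rewrite mul0r.
  by move=> -> ->; exists q.
have [|y Hy] := @idem_mod_build (res_idem 1) (fun j => q j * res_idem 1 j).
  by move=> j; rewrite -mulrA res_idemP.
by exists y; apply: coor_inj => j; rewrite coor_diff Hy -mulrA idem_res_path Hq.
Qed.

Lemma res_diff_exact i x : res_diff i x = 0 <-> exists y, res_diff i.+1 y = x.
Proof.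
split=> [x0|[y <-]]; last first.
  apply: coor_inj => j; rewrite !coor_diff -mulrA res_path_path mulr0.
  by rewrite coor0.
have [q Hq] : exists q : I -> R, forall j,
    q j * res_idem i.+2 j = q j /\ coor x j = q j * res_path i.+1 j.
  apply: (choice (fun j q => q * res_idem i.+2 j = q /\ coor x j = q * res_path i.+1 j)) => j.
  apply: res_path_exact; first exact: coorE.
  by rewrite -coor_diff x0 coor0.
have [|y Hy] := @idem_mod_build (res_idem i.+2) q; first by move=> j; case: (Hq j).
by exists y; apply: coor_inj => j; rewrite coor_diff Hy; case: (Hq j).
Qed.

Definition interval_res : proj_resolution M :=
  ProjResolution (fun i => idem_mod_fin_gen (res_idemP i))
    (fun i => idem_mod_projective (res_idemP i))
    res_aug_surj res_aug_exact res_diff_exact.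

Lemma ib_pd_le d : (forall i j, (d < i)%N -> ~~ ((syz_at i j).1 < (syz_at i j).2)%N) -> pd_le M d.
Proof.
move=> dead; exists interval_res => i di x; apply: coor_inj => j.
by rewrite -coorE /res_idem (negPf (dead i j di)) mulr0 coor0.
Qed.

(** Homomorphisms R e_x -> N are elements of e_x N, so this is exactness at the middle of e_x N ->
    e_y N -> e_(ep x) N, a segment of Hom from a resolution into [N]. *)
Definition exact_at (N : lmodType R) x y := forall m : N, w y 0 *: m = m ->
  w y (ep x - y)%N *: m = 0 -> exists m', m = w x (y - x)%N *: m'.

Lemma ib_Ext_zero (N : lmodType R) i :
  Ext_zero i.+1 M N <-> forall j, exact_at N (syz_at i j).1 (syz_at i j).2.
Proof.
rewrite (Ext_zero_res N interval_res) /=; split=> [H j0|H h h0].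
  have := syz_at_ok i j0; have E1 := erefl (res_idem i.+1 j0); have P1 := erefl (res_path i j0).
  have P2 := erefl (res_path i.+1 j0).
  move: E1 P1 P2; rewrite {2}/res_idem {2 4}/res_path syz_atS /syz_step.
  case Es: (syz_at i j0) => [x y] /=; case: (ltnP x y) => [lt|ge] /=; last first.
    move=> _ _ _ /andP[xy ye] m me _; exists m.
    have -> : x = y by apply/eqP; rewrite eqn_leq xy ge.
    by rewrite subnn me.
  move=> E1 P1 P2 /andP[_ ye] m me m0.
  (* The test cocycle is supported on the single summand [j0]. *)
  have [|g Hg] := H (idem_hom (fun j => if j == j0 then m else 0)).
    move=> x'; rewrite mklinE big1 // => j _; case: eqP => [->|_]; last by rewrite scaler0.
    rewrite coor_diff -scalerA P2; case: ifP => _; last by rewrite scale0r scaler0.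
    by rewrite m0 scaler0.
  have := Hg (idem_gen (res_idemP i.+1) j0).
  rewrite (idem_hom_gen (res_idemP i.+1)) eqxx E1.
  have -> : res_diff i (idem_gen (res_idemP i.+1) j0) =
      res_path i j0 *: idem_gen (res_idemP i) j0.
    apply: coor_inj => j; rewrite coor_diff coor_gen coorZ coor_gen.
    case: eqP => [->|_]; last by rewrite mul0r mulr0.
    by rewrite idem_res_path res_path_idem.
  rewrite linearZ /= P1; case: ltnP => [_|ge]; first by rewrite me => ->; eexists.
  move=> _; exists 0; rewrite scaler0.
  have e : (ep x - y)%N = 0%N by apply/eqP.
  by rewrite e me in m0.
have [m Hm] : exists m : I -> N, forall j, h (idem_gen (res_idemP i.+1) j) = res_path i j *: m j.
  apply: (choice (fun j m => h (idem_gen (res_idemP i.+1) j) = res_path i j *: m)) => j.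
  have hE : res_idem i.+1 j *: h (idem_gen (res_idemP i.+1) j) = h (idem_gen (res_idemP i.+1) j).
    by rewrite -linearZ /= idem_genE.
  have hP : res_path i.+1 j *: h (idem_gen (res_idemP i.+1) j) = 0.
    rewrite -[RHS](h0 (idem_gen (res_idemP i.+2) j)) -linearZ /=; congr (h _).
    apply: coor_inj => l; rewrite coor_diff coor_gen coorZ coor_gen.
    case: eqP => [->|_]; last by rewrite mul0r mulr0.
    by rewrite idem_res_path res_path_idem.
  have := H j; have := syz_at_ok i j; move: hE hP; move: (h _) => z.
  rewrite /res_idem /res_path syz_atS /syz_step; case: (syz_at i j) => x y /=.
  case: (ltnP x y) => [lt|ge] /=; last first.
    by rewrite ltnn scale0r => <- _ _ _; exists 0; rewrite scaler0.
  case: (ltnP y (ep x)) => [lt'|ge'] ; last first.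
    by rewrite scale0r => <- _ _ _; exists 0; rewrite scaler0.
  by move=> zE z0 _; apply.
exists (idem_hom m) => x; rewrite [in LHS](idem_mod_gen (res_idemP i.+1) x) linear_sum mklinE.
by apply: eq_bigr => j _; rewrite linearZ /= Hm scalerA coor_diff.
Qed.

End Resolution.

(** * Classification of finitely generated modules *)

Lemma max_exists (P : nat -> Prop) m : (exists i, P i) -> (forall i, P i -> (i <= m)%N) ->
  exists i, P i /\ forall j, P j -> (j <= i)%N.
Proof.
elim: m => [|m IH] [i Pi] bound; first by exists i; split=> // j /bound; rewrite leqn0 => /eqP->.
have [Pm|nPm] := classic (P m.+1); first by exists m.+1.
apply: IH; first by exists i.
move=> j Pj; have := bound j Pj; rewrite leq_eqVlt ltnS => /orP[/eqP e|//].
by rewrite e in Pj.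
Qed.

Lemma sum_shift (V : zmodType) (F H : nat -> V) m s :
    (forall j, (m < j + s)%N -> F j = 0) -> (forall j, (j < s)%N -> H j = 0) ->
    (forall j, (j + s <= m)%N -> F j = H (j + s)%N) ->
  \sum_(j < m.+1) F j = \sum_(j < m.+1) H j.
Proof.
move=> F0 H0 FH; rewrite -!(big_mkord xpredT).
have [ms|sm] := ltnP m s.
  rewrite !big_nat !big1 // => j /andP[_ jm]; first by apply: H0; lia.
  by apply: F0; lia.
rewrite (@big_cat_nat _ _ _ (m - s).+1 0 m.+1) //=; last by lia.
rewrite [X in _ + X]big_nat [X in _ + X]big1 ?addr0 => [|j jm]; last by apply: F0; lia.
rewrite (@big_cat_nat _ _ _ s 0 m.+1 xpredT H) //=; last by lia.
rewrite [X in X + _]big_nat [X in X + _]big1 ?add0r => [|j jm]; last by apply: H0; lia.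
rewrite -{2}[s]add0n big_addn subSn //; rewrite !big_nat; apply: eq_bigr => j jm.
by apply: FH; lia.
Qed.

Lemma big_option (V : nmodType) (I : finType) (F : option I -> V) :
  \sum_o F o = F None + \sum_j F (Some j).
Proof.
rewrite (bigD1 None) //=; congr (_ + _).
rewrite (reindex_omap Some id) /=; last by case.
by apply: eq_bigl => j; rewrite eqxx.
Qed.

Section Classification.
Variables (K : fieldType) (R : pzRingType) (D : nakData K R).
Notation k := (nd_k D).
Notation n := (nd_n D).
Notation w := (nd_w D).
Notation ell := (nd_ell D).
Variable M : lmodType R.

Definition kspan (P : M -> Prop) := exists N (g : nat -> M),
  forall x, P x -> exists c : nat -> K, x = \sum_(i < N) k (c i) *: g i.

Lemma kspan_fin (J : finType) (g : J -> M) (P : M -> Prop) :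
  (forall x, P x -> exists c : J -> K, x = \sum_j k (c j) *: g j) -> kspan P.
Proof.
move=> span; pose ev T (h : J -> T) t0 i := oapp h t0 (nth None (map some (enum J)) i).
have evE T (h : J -> T) t0 (i : 'I_#|J|) : ev T h t0 i = h (enum_val i).
  rewrite /ev (nth_map (enum_val i)) -?cardE ?ltn_ord //=.
  by rewrite [in RHS](enum_val_nth (enum_val i)).
exists #|J|, (ev M g 0) => x /span[c ->]; exists (ev K c 0).
rewrite (reindex (enum_val (A := J))) /=; last exact: onW_bij (@enum_val_bij J).
by apply: eq_bigr => i _; rewrite !evE.
Qed.

Lemma fin_gen_kspan : fin_gen M -> kspan (fun=> True).
Proof.
move=> [N [g Hg]].
pose J := ('I_N * {b : 'I_n & 'I_(ell b)})%type.
apply: (@kspan_fin J (fun j => w (tag j.2) (tagged j.2) *: g j.1)) => x _.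
have [r ->] := Hg x.
have [c Hc] := choice _ (fun i : 'I_N => nd_w_span D (r i)).
exists (fun j : J => c j.1 (tag j.2 : 'I_n) (tagged j.2 : 'I_(ell (tag j.2)))).
transitivity (\sum_(i < N) \sum_(b : {b : 'I_n & 'I_(ell b)})
   k (c i (tag b : 'I_n) (tagged b : 'I_(ell (tag b)))) *: (w (tag b) (tagged b) *: g i)); last first.
  by rewrite pair_big.
apply: eq_bigr => i _; rewrite {1}Hc scaler_suml.
rewrite -(@sig_big_dep _ _ _ _ (fun b : 'I_n => 'I_(ell b)) xpredT (fun _ => xpredT)
  (fun (b : 'I_n) (t : 'I_(ell b)) => k (c i b t) *: (w b t *: g i))) /=.
apply: eq_bigr => b _; rewrite scaler_suml; apply: eq_bigr => t _.
by rewrite scalerA.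
Qed.

Definition ksubspace (W : M -> Prop) :=
  [/\ W 0, forall x y, W x -> W y -> W (x + y) & forall c x, W x -> W (k c *: x)].

Lemma scale_kV c (x : M) : c != 0 -> k c^-1 *: (k c *: x) = x.
Proof. by move=> c0; rewrite scalerA -rmorphM mulVf // rmorph1 scale1r. Qed.

Lemma ksubspace_scaleV W c x : ksubspace W -> c != 0 -> W (k c *: x) -> W x.
Proof. by move=> [_ _ WZ] c0 Wx; rewrite -(scale_kV x c0); apply: WZ. Qed.

(** [W] is enlarged by one generator at a time as long as [u] stays outside. In the end every vector
    is congruent to a unique multiple of [u] modulo the enlarged [U], and this multiple is the
    functional. *)
Lemma functional_exists (W : M -> Prop) u : kspan (fun=> True) -> ksubspace W -> ~ W u ->
  exists th : M -> K, [/\ forall x y, th (x + y) = th x + th y,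
    forall c x, th (k c *: x) = c * th x, forall x, W x -> th x = 0 & th u = 1].
Proof.
move=> [N [g Hg]] Wsub nWu.
have [U [Usub WU nUu HU]] : exists U : M -> Prop, [/\ ksubspace U, forall x, W x -> U x, ~ U u &
    forall i, (i < N)%N -> exists c, U (g i - k c *: u)].
  elim: (N) => [|m [U [Usub WU nUu HU]]]; first by exists W; split.
  have [U0 UD UZ] := Usub.
  pose U' x := exists c, U (x - k c *: g m).
  have UU' x : U x -> U' x by exists 0; rewrite rmorph0 scale0r subr0.
  (* If adjoining [g m] captures [u], then [g m] is already a multiple of [u] modulo [U]. *)
  have [[c Uc]|nU'] := classic (U' u).
    exists U; split=> // i; rewrite ltnS leq_eqVlt => /orP[/eqP->|]; last exact: HU.
    have c0 : c != 0 by apply/eqP => c0; rewrite c0 rmorph0 scale0r subr0 in Uc.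
    exists c^-1; apply: (ksubspace_scaleV Usub c0).
    rewrite scalerBr scalerA -rmorphM divff // rmorph1 scale1r -opprB -scaleN1r.
    by rewrite -(rmorphN1 k); apply: UZ.
  exists U'; split=> //.
  - split; first exact: UU'.
      move=> x y [c Ux] [c' Uy]; exists (c + c').
      by rewrite rmorphD scalerDl opprD addrACA; apply: UD.
    move=> c x [c' Ux]; exists (c * c').
    by rewrite rmorphM -scalerA -scalerBr; apply: UZ.
  - by move=> x /WU/UU'.
  move=> i; rewrite ltnS leq_eqVlt => /orP[/eqP->|im].
    by exists 0; rewrite rmorph0 scale0r subr0; exists 1; rewrite rmorph1 scale1r subrr.
  by have [c Hc] := HU i im; exists c; apply: UU'.
have [U0 UD UZ] := Usub.
have [th Hth] : exists th : M -> K, forall x, U (x - k (th x) *: u).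
  apply: (choice (fun x c => U (x - k c *: u))) => x.
  have [c ->] := Hg x I; elim: (N) HU => [_|m IH HU].
    by exists 0; rewrite big_ord0 rmorph0 scale0r subr0.
  have [|c1 H1] := IH; first by move=> i im; apply: HU; rewrite ltnS ltnW.
  have [c2 H2] := HU m (ltnSn m).
  exists (c1 + c m * c2); rewrite big_ord_recr /= rmorphD scalerDl opprD addrACA.
  by apply: UD => //; rewrite rmorphM -scalerA -scalerBr; apply: UZ.
have uniq x c : U (x - k c *: u) -> th x = c.
  move=> Uc; apply/eqP; rewrite -subr_eq0; apply/negPn/negP => c0; apply: nUu.
  apply: (ksubspace_scaleV Usub c0); rewrite rmorphB scalerBl.
  suff -> : k (th x) *: u - k c *: u = (x - k c *: u) + k (-1) *: (x - k (th x) *: u).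
    by apply: UD => //; apply: UZ.
  by rewrite rmorphN1 scaleN1r opprB [RHS]addrC addrA subrK.
exists th; split.
- by move=> x y; apply: uniq; rewrite rmorphD scalerDl opprD addrACA; apply: UD.
- by move=> c x; apply: uniq; rewrite rmorphM -scalerA -scalerBr; apply: UZ.
- by move=> x /WU Ux; apply: uniq; rewrite rmorph0 scale0r subr0.
- by apply: uniq; rewrite rmorph1 scale1r subrr.
Qed.

Lemma scale_span (f : M -> M) : (forall x y, f (x + y) = f x + f y) ->
    (forall c x, f (k c *: x) = k c *: f x) ->
    (forall b s x, f (w b s *: x) = w b s *: f x) -> linear f.
Proof.
move=> fD fk fw r x y; rewrite fD; congr (_ + _).
have f0 : f 0 = 0 by apply: (addIr (f 0)); rewrite -fD !add0r.
have [c ->] := nd_w_span D r.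
have fs := big_morph f fD f0.
rewrite !scaler_suml fs; apply: eq_bigr => b _; rewrite !scaler_suml fs.
by apply: eq_bigr => t _; rewrite -!scalerA fk fw.
Qed.

(* A longest uniserial submodule of a summand splits off: a functional that is nonzero on its
   socle extends to a map to the uniserial module because that module is injective among the
   modules of Loewy length at most [T.+1]. *)
Lemma uniserial_retraction (e : {linear M -> M}) a T (v : M) : kspan (fun=> True) ->
    (forall x, e (e x) = e x) -> e v = v -> w a 0 *: v = v -> w a T *: v <> 0 ->
    (forall b x, e x = x -> w b T.+1 *: x = 0) ->
  exists r : {linear M -> M}, [/\ forall x, r (e x) = r x, r v = v &
    forall x, exists c : nat -> K, r x = \sum_(t < T.+1) k (c t) *: (w a t *: v)].
Proof.
move=> sp ee ev av vT long.
have [th [thD thk thW thu]] : exists th : M -> K, [/\ forall x y, th (x + y) = th x + th y,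
    forall c x, th (k c *: x) = c * th x, forall t, (t < T)%N -> th (w a t *: v) = 0 &
    th (w a T *: v) = 1].
  pose W x := exists c : nat -> K, x = \sum_(t < T) k (c t) *: (w a t *: v).
  have [|[c Hc]|th [thD thk thW thu]] := @functional_exists W (w a T *: v) sp.
  - split.
    + by exists (fun=> 0); rewrite big1 // => t _; rewrite rmorph0 scale0r.
    + move=> x y [c ->] [c' ->]; exists (fun t => c t + c' t); rewrite -big_split.
      by apply: eq_bigr => t _; rewrite rmorphD scalerDl.
    + move=> b x [c ->]; exists (fun t => b * c t); rewrite scaler_sumr.
      by apply: eq_bigr => t _; rewrite rmorphM scalerA.
  - pose c' t := if (t < T)%N then - c t else 1.
    suff : c' T = 0 by rewrite /c' ltnn => /eqP; rewrite oner_eq0.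
    apply: (w_free vT (long a v ev)) => //.
    rewrite big_ord_recr /= {2}/c' ltnn rmorph1 scale1r Hc -big_split big1 // => t _.
    by rewrite /= /c' ltn_ord rmorphN scaleNr addNr.
  - exists th; split=> // t tT; apply: thW; exists (fun s => (s == t)%:R).
    rewrite (bigD1 (Ordinal tT)) //= eqxx rmorph1 scale1r big1 ?addr0 // => s /negPf.
    by rewrite -val_eqE /= => ->; rewrite rmorph0 scale0r.
have th0 : th 0 = 0 by apply: (addIr (th 0)); rewrite -thD !add0r.
(* The functional is evaluated on [x] transported along the path of length [j] ending at the socle
   position [a + T]; the value becomes the coordinate of the image at position [a + (T - j)]. *)
pose q x j := th (w (a + (T - j)) j *: e x).
pose r x := \sum_(j < T.+1) k (q x j) *: (w a (T - j) *: v).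
have rlin : linear r.
  apply: scale_span.
  - move=> x y; rewrite /r -big_split; apply: eq_bigr => j _.
    by rewrite /q linearD scalerDr thD rmorphD scalerDl.
  - move=> c x; rewrite /r scaler_sumr; apply: eq_bigr => j _.
    by rewrite /q linearZ /= -scale_central thk rmorphM -scalerA.
  move=> b s x; rewrite /r scaler_sumr.
  pose F j := k (q (w b s *: x) j) *: (w a (T - j) *: v).
  pose H j := w b s *: (k (q x j) *: (w a (T - j) *: v)).
  apply: (@sum_shift _ F H _ s) => j hj.
  - rewrite /F /q linearZ /= (scalerA _ (w b s)).
    have [eq|ne] := boolP (a + (T - j) == b + s %[mod n]).
      rewrite wM_mod ?(eqP eq) // (w_kill (L := T.+1)) ?th0 ?rmorph0 ?scale0r //; first by lia.
      exact: long.
    by rewrite nd_wM0 ?scale0r ?th0 ?rmorph0 ?scale0r //; apply/eqP.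
  - rewrite /H -scale_central (scalerA (w b s)).
    have [eq|ne] := boolP (b == a + (T - j) %[mod n]); last first.
      by rewrite nd_wM0 ?scale0r ?scaler0 //; apply/eqP.
    rewrite wM_mod ?(eqP eq) //; have [jT|Tj] := leqP j T.
      by rewrite (w_kill (L := T.+1)) ?scaler0 ?long //; lia.
    rewrite /q (w_kill (L := T.+1)) ?th0 ?rmorph0 ?scale0r ?long //; lia.
  - rewrite /F /H -scale_central /q linearZ /= (scalerA _ (w b s)) (scalerA (w b s)).
    have eT : (a + (T - j) = a + (T - (j + s)) + s)%N by lia.
    have [eq|ne] := boolP (b == a + (T - (j + s)) %[mod n]).
      have e2 : (a + (T - j) == b + s %[mod n]) by rewrite eT eqn_modDr eq_sym.
      rewrite (wM_mod _ (eqP e2)) (wM_mod _ (eqP eq)) (addnC s) (nd_w_mod _ (eqP eq)).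
      by congr (k _ *: (w a _ *: v)); lia.
    rewrite nd_wM0 ?scale0r ?th0 ?rmorph0 ?scale0r; last first.
      by apply/eqP; rewrite eT eqn_modDr eq_sym.
    by rewrite (@nd_wM0 _ _ D a) ?scale0r ?scaler0 //; apply/eqP.
exists (mklin rlin); split.
- by move=> x; rewrite !mklinE /r /q ee.
- rewrite mklinE /r (bigD1 ord_max) //= subnn av /q ev subnn addn0 thu rmorph1 scale1r.
  rewrite big1 ?addr0 // => j /eqP jT; rewrite -av (scalerA _ (w a 0)).
  have jT' : (j < T)%N.
    by have := ltn_ord j; rewrite ltnS leq_eqVlt => /orP[/eqP jeq|//]; case: jT; apply: val_inj.
  have [eq|ne] := boolP (a + (T - j) == a + 0 %[mod n]).
    by rewrite wM_mod ?(eqP eq) // thW // rmorph0 scale0r.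
  by rewrite nd_wM0 ?scale0r ?th0 ?rmorph0 ?scale0r //; apply/eqP.
move=> x; exists (fun t => q x (T - t)%N); rewrite mklinE /r.
rewrite (reindex_inj rev_ord_inj) /=; apply: eq_bigr => j _.
have := ltn_ord j => jT; by rewrite subSS subKn.
Qed.

Definition summand_basis (e : M -> M) (I : finType) (a L : I -> nat) (v : I -> M) :=
  [/\ forall j, e (v j) = v j, forall j, w (a j) 0 *: v j = v j,
   forall j, w (a j) (L j) *: v j = 0,
   forall x, exists c : I -> nat -> K,
     e x = \sum_j \sum_(t < L j) k (c j t) *: (w (a j) t *: v j) &
   forall c : I -> nat -> K,
     \sum_j \sum_(t < L j) k (c j t) *: (w (a j) t *: v j) = 0 ->
     forall j t, (t < L j)%N -> c j t = 0].

(** Induction on the size of a K-spanning set of the image of [e]. A longest uniserial submodule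
    splits off by [r]; the idempotent e - r needs one generator fewer because it kills the nonzero
    vector [v]. *)
Lemma summand_basis_exists N : kspan (fun=> True) -> forall (e : {linear M -> M}) (g : nat -> M),
    (forall x, e (e x) = e x) ->
    (forall x, exists c : nat -> K, e x = \sum_(i < N) k (c i) *: g i) ->
  exists (I : finType) (a L : I -> nat) (v : I -> M),
    (forall j, (0 < L j)%N) /\ summand_basis e a L v.
Proof.
move=> sp; elim: N => [|N IH] e g ee eg.
  have I0 (j : 'I_0) : False by case: j.
  exists 'I_0, (fun=> 0%N), (fun=> 0%N), (fun=> 0); split; first by case.
  split=> [[]|[]|[]|x|c _ []] //.
  by exists (fun _ _ => 0); have [c ->] := eg x; rewrite !big_ord0.
have [e0|ne0] := classic (forall x, e x = 0).
  exists 'I_0, (fun=> 0%N), (fun=> 0%N), (fun=> 0); split; first by case.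
  split=> [[]|[]|[]|x|c _ []] //.
  by exists (fun _ _ => 0); rewrite e0 big_ord0.
pose P T := exists a v, e v = v /\ w a T *: v <> 0.
have [T [[a [v' [ev' vT']]] maxT]] : exists T, P T /\ forall U, P U -> (U <= T)%N.
  apply: (@max_exists P (\max_(b < n) ell b)).
    have [x nex] := not_all_ex_not _ _ ne0.
    have [b nb] : exists b : 'I_n, w b 0 *: e x <> 0.
      apply: not_all_ex_not => all0; apply: nex.
      by rewrite -[e x]scale1r -(nd_w_one D) scaler_suml big1.
    by exists 0%N, (b : nat), (e x).
  move=> U [b [x [_ nx]]]; have lt : (b %% n < n)%N by rewrite ltn_mod nd_n_gt0.
  apply: leq_trans (leq_bigmax (Ordinal lt)) => /=; rewrite leqNgt; apply/negP => lU.
  apply: nx; rewrite (proj2 (nd_w_eq0 _ _ _)) ?scale0r //.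
  by rewrite -(@ell_mod _ _ D (b %% n) b) ?modn_mod // ltnW.
pose v := w a 0 *: v'.
have av : w a 0 *: v = v by rewrite /v scalerA w_idem.
have ev : e v = v by rewrite /v linearZ /= ev'.
have vT : w a T *: v <> 0 by rewrite /v scalerA w_idem.
have long b x : e x = x -> w b T.+1 *: x = 0.
  move=> ex; apply: NNPP => nx; have : P T.+1 by exists b, x.
  by move/maxT; rewrite ltnn.
have [r [re rv rspan]] := uniserial_retraction sp ee ev av vT long.
have rw t : r (w a t *: v) = w a t *: v by rewrite linearZ /= rv.
have ew t : e (w a t *: v) = w a t *: v by rewrite linearZ /= ev.
have er x : e (r x) = r x.
  have [c ->] := rspan x; rewrite linear_sum; apply: eq_bigr => t _.
  by rewrite linearZ /= ew.
have rr x : r (r x) = r x.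
  have [c ->] := rspan x; rewrite linear_sum; apply: eq_bigr => t _.
  by rewrite linearZ /= rw.
have wfree (c : nat -> K) : \sum_(t < T.+1) k (c t) *: (w a t *: v) = 0 ->
    forall t, (t < T.+1)%N -> c t = 0 by move=> s0 t; exact: (w_free vT (long a v ev) s0).
have [e' e'E] : exists e' : {linear M -> M}, forall x, e' x = e x - r x by exists (e \- r).
have e'e' x : e' (e' x) = e' x.
  by rewrite !e'E !raddfB /= ee er re rr opprK addNr addr0.
have [g' Hg'] : exists g' : nat -> M, forall x, exists c : nat -> K,
    e' x = \sum_(i < N) k (c i) *: g' i.
  have [c Hc] := eg v; rewrite ev in Hc.
  have [i0 ci0] : exists i : 'I_N.+1, c i != 0.
    apply: NNPP => nc; apply: vT; rewrite Hc scaler_sumr big1 // => i _.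
    have -> : c i = 0 by apply/eqP/negPn/negP => ci; apply: nc; exists i.
    by rewrite rmorph0 scale0r scaler0.
  have e'g : e' (g i0) = \sum_(i < N) k (- (c i0)^-1 * c (lift i0 i)) *: e' (g (lift i0 i)).
    have : e' v = 0 by rewrite e'E ev rv subrr.
    rewrite {1}Hc linear_sum (bigD1_ord i0) //= linearZ /= => /eqP.
    rewrite addr_eq0 => /eqP eq; rewrite -[LHS](scale_kV _ ci0) -[RHS](scale_kV _ ci0); congr (_ *: _).
    rewrite eq -sumrN scaler_sumr; apply: eq_bigr => i _.
    rewrite linearZ /= scalerA -rmorphM mulNr mulrN mulrA divff // mul1r rmorphN scaleNr.
    by [].
  exists (fun i => e' (g (bump i0 i))) => x.
  have [b Hb] := eg x.
  have -> : e' x = e' (e x) by rewrite !e'E re ee.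
  exists (fun i => b i0 * (- (c i0)^-1 * c (bump i0 i)) + b (bump i0 i)).
  rewrite Hb linear_sum (bigD1_ord i0) //= linearZ /= e'g scaler_sumr -big_split.
  apply: eq_bigr => i _ /=; rewrite linearZ /= scalerA -rmorphM.
  by rewrite rmorphD scalerDl.
have [I [a' [L [u [Lpos [e'u au Lu uspan ufree]]]]]] := IH e' g' e'e' Hg'.
have eu j : e (u j) = u j by rewrite -e'u e'E raddfB /= ee er.
have ru j : r (u j) = 0 by rewrite -e'u e'E raddfB /= re rr subrr.
exists (option I), (oapp a' a), (oapp L T.+1), (oapp u v); split; first by case.
split.
- by case.
- by case.
- by case=> //=; exact: long.
- move=> x; have [c Hc] := rspan x; have [c' Hc'] := uspan x.
  exists (fun o => if o is Some j then c' j else c).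
  by rewrite big_option /= -Hc -Hc' e'E addrC subrK.
- move=> c; rewrite big_option /= => sum0.
  have r0 : \sum_(t < T.+1) k (c None t) *: (w a t *: v) = 0.
    have := congr1 r sum0; rewrite raddfD raddf0 /= [X in _ + X]linear_sum [X in _ + X]big1 ?addr0.
      move=> eq0; rewrite -[RHS]eq0 linear_sum; apply: eq_bigr => t _.
      by rewrite linearZ /= rw.
    move=> j _; rewrite linear_sum big1 // => t _.
    by rewrite !linearZ /= ru scaler0 scaler0.
  rewrite r0 add0r in sum0; case=> [j|] t tL; last exact: wfree r0 t tL.
  exact: (ufree (fun j => c (Some j)) sum0).
Qed.

Lemma ibasis_exists : fin_gen M ->
  exists (I : finType) (a L : I -> nat) (v : I -> M), ibasis D a L v /\ forall j, (0 < L j)%N.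
Proof.
move=> /fin_gen_kspan sp; have [N [g Hg]] := sp.
have [|x|I [a [L [v [Lpos [_ av Lv span free]]]]]] := @summand_basis_exists N sp idfun g.
- by [].
- exact: Hg.
by exists I, a, L, v; split; first split.
Qed.

End Classification.

(** * Projective, uniserial and injective modules *)

Lemma big_unit (V : nmodType) (F : unit -> V) : \sum_j F j = F tt.
Proof. by rewrite (bigD1 tt) //= big_pred0 ?addr0 // => -[]. Qed.

Section TruncatedModule.
Variables (R : pzRingType) (M : lmodType R) (V : zmodType) (emb : {additive V -> M})
  (coef : {additive M -> V}).
Hypothesis embK : cancel emb coef.
Hypothesis coefZ : forall r y, coef (r *: emb (coef y)) = coef (r *: y).

(* [V], viewed as the quotient of [M] by the kernel of [coef]. *)
Definition trunc_mod of cancel emb coef & (forall r y, coef (r *: emb (coef y)) = coef (r *: y))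
  : Type := V.
Notation T := (trunc_mod embK coefZ).
HB.instance Definition _ := GRing.Zmodule.on T.
Definition trunc_scale (r : R) (x : T) : T := coef (r *: emb x).
Lemma trunc_scaleA a b x : trunc_scale a (trunc_scale b x) = trunc_scale (a * b) x.
Proof. by rewrite /trunc_scale coefZ scalerA. Qed.
Lemma trunc_scale1 : left_id 1 trunc_scale.
Proof. by move=> x; rewrite /trunc_scale scale1r embK. Qed.
Lemma trunc_scaleDr : right_distributive trunc_scale +%R.
Proof. by move=> a x y; rewrite /trunc_scale !raddfD. Qed.
Lemma trunc_scaleDl x : {morph trunc_scale^~ x : a b / a + b}.
Proof. by move=> a b; rewrite /trunc_scale scalerDl raddfD. Qed.
HB.instance Definition _ := GRing.Zmodule_isLmodule.Build R T
  trunc_scaleA trunc_scale1 trunc_scaleDr trunc_scaleDl.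
End TruncatedModule.

Section IntervalModules.
Variables (K : fieldType) (R : pzRingType) (D : nakData K R).
Notation k := (nd_k D).
Notation n := (nd_n D).
Notation w := (nd_w D).
Notation ell := (nd_ell D).
Notation ep := (endp D).

Lemma ib_scale (M : lmodType R) (I : finType) (a L : I -> nat) (v : I -> M) x s
    (b : I -> nat -> K) : ibasis D a L v ->
  w x s *: \sum_j \sum_(t < L j) k (b j t) *: (w (a j) t *: v j) =
  \sum_j \sum_(t < L j) k (if (s <= t)%N && (x == a j + (t - s) %[mod n])
    then b j (t - s)%N else 0) *: (w (a j) t *: v j).
Proof.
move=> ib; rewrite scaler_sumr; apply: eq_bigr => j _; rewrite scaler_sumr.
have v0 := ib_0 ib j; case: (L j) v0 => [|m] v0; first by rewrite !big_ord0.
apply: (@sum_shift _ (fun t => w x s *: (k (b j t) *: (w (a j) t *: v j)))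
  (fun t => k (if (s <= t)%N && (x == a j + (t - s) %[mod n])
    then b j (t - s)%N else 0) *: (w (a j) t *: v j)) m s) => t ht.
- rewrite -scale_central (scalerA (w x s)); have [e|ne] := boolP (x == a j + t %[mod n]).
    by rewrite wM_mod ?(eqP e) // (w_kill (L := m.+1)) ?scaler0 //; lia.
  by rewrite nd_wM0 ?scale0r ?scaler0 //; apply/eqP.
- by rewrite leqNgt ht rmorph0 scale0r.
- rewrite leq_addl addnK /= -scale_central (scalerA (w x s)).
  have [e|ne] := boolP (x == a j + t %[mod n]); first by rewrite wM_mod ?(eqP e).
  by rewrite nd_wM0 ?rmorph0 ?scale0r ?scaler0 //; apply/eqP.
Qed.

(* [ext_pos x y c l] says that [c, c + l[ contributes to the homology at the middle of
   [N e_x -> N e_y -> N e_(ep x)]. *)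
Definition ext_pos x y c l := exists z, [/\ z = y %[mod n], (c <= z < c + l)%N,
  (c + l <= z + (ep x - y))%N & (z < c + (y - x))%N].

(** The condition splits over the intervals of [N]. A basis vector at position z is killed by the
    path to [ep x] when z + (ep x - y) leaves [c, c + l[, and is not hit from [x] when z - (y - x)
    lies before c. *)
Lemma ib_exact_at (N : lmodType R) (I : finType) (c L : I -> nat) (u : I -> N) x y :
    ibasis D c L u -> (x <= y <= ep x)%N ->
  exact_at D N x y <-> forall j, ~ ext_pos x y (c j) (L j).
Proof.
move=> ib /andP[xy ye]; split=> [ex j [z [zy /andP[cz zl] zs zx]]|H m me m0].
  have [||m' Hm] := ex (w (c j) (z - c j) *: u j).
  - by rewrite scalerA w_idemL // subnKC.
  - by rewrite scalerA wM_mod ?subnKC // (w_kill _ (ib_0 ib j)) //; lia.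
  have [b Hb] := ib_span ib m'; rewrite Hb ib_scale // in Hm.
  pose d (i : I) (t : nat) : K := ((i == j) && (t == z - c j)%N)%:R.
  have lt : (z - c j < L j)%N by lia.
  have Hd : w (c j) (z - c j) *: u j = \sum_i \sum_(t < L i) k (d i t) *: (w (c i) t *: u i).
    rewrite (bigD1 j) //= (bigD1 (Ordinal lt)) //= /d !eqxx rmorph1 scale1r.
    rewrite big1 ?addr0 => [|t /negPf]; last first.
      by rewrite -val_eqE /= => ->; rewrite rmorph0 scale0r.
    by rewrite big1 ?addr0 // => i /negPf ij; rewrite big1 // => t _; rewrite ij rmorph0 scale0r.
  rewrite Hd in Hm; have := ib_inj ib (c' := fun j t => if (y - x <= t)%N &&
    (x == c j + (t - (y - x)) %[mod n]) then b j (t - (y - x))%N else 0) Hm lt.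
  rewrite /d !eqxx /= leqNgt (_ : (z - c j < y - x)%N) /=; last by lia.
  by move/eqP; rewrite oner_eq0.
have [b Hb] := ib_span ib m.
pose s := (ep x - y)%N.
(* Since m = e_y m, only coordinates at positions congruent to [y] survive. *)
pose b' j t := if y == c j + t %[mod n] then b j t else 0.
have Hb' : m = \sum_j \sum_(t < L j) k (b' j t) *: (w (c j) t *: u j).
  rewrite -me Hb ib_scale //; apply: eq_bigr => j _; apply: eq_bigr => t _.
  by rewrite subn0.
have b'0 j t : (t + s < L j)%N -> b' j t = 0.
  move=> ts; rewrite Hb' ib_scale // in m0.
  have := ib_free ib (c := fun j t => if (s <= t)%N && (y == c j + (t - s) %[mod n])
    then b' j (t - s)%N else 0) m0 ts.
  rewrite leq_addl addnK /= /b'; by case: (y == _ %[mod n]).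
exists (\sum_j \sum_(t < L j) k (b' j t) *: (w (c j) (t - (y - x))%N *: u j)).
rewrite {1}Hb' scaler_sumr; apply: eq_bigr => j _; rewrite scaler_sumr; apply: eq_bigr => t _.
rewrite -scale_central scalerA (scalerA (w x _)).
have [->|nz] := eqVneq (b' j t) 0; first by rewrite rmorph0 mul0r !scale0r.
have tsL : (L j <= t + s)%N by rewrite leqNgt; apply/negP => /b'0/eqP; rewrite (negPf nz).
have eqy : y = c j + t %[mod n].
  by apply/eqP; move: nz; rewrite /b'; case: (y == _ %[mod n]); rewrite ?eqxx.
have yxt : (y - x <= t)%N.
  rewrite leqNgt; apply/negP => lt; apply: (H j); exists (c j + t)%N; split=> //.
  - by rewrite leq_addr ltn_add2l ltn_ord.
  - by rewrite -addnA leq_add2l.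
  - by rewrite ltn_add2l.
rewrite -scalerA; congr (_ *: _); rewrite wM_mod ?subnK //.
apply/eqP; rewrite -(eqn_modDr (y - x)) subnKC // -addnA subnK //; exact/eqP.
Qed.

Lemma reg_ibasis : ibasis D (fun j : 'I_n => j : nat) (fun j => ell j) (fun j => w j 0 : R^o).
Proof.
split=> [j|j|x|c sum0 j t tl].
- by rewrite -[_ *: _]/(_ * _) w_idem.
- by rewrite -[_ *: _]/(_ * _) w_idem; apply: (proj2 (nd_w_eq0 D _ _)).
- have [c ->] := nd_w_span D x; exists (fun j : 'I_n => c j).
  apply: eq_bigr => j _; apply: eq_bigr => t _.
  by rewrite -[_ *: _]/(_ * _) -[w j t *: _]/(_ * _) w_idem.
- apply: (w_free_reg (a := j) _ tl).
  have := congr1 (fun r : R => r * w j 0) sum0; rewrite mul0r mulr_suml.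
  rewrite (bigD1 j) //= [X in _ + X]big1 ?addr0 => [|i /eqP ij].
    move=> e; rewrite -[RHS]e mulr_suml; apply: eq_bigr => u _.
    by rewrite -[_ *: _]/(_ * (_ * _)) !w_idem -mulrA w_idem.
  rewrite mulr_suml big1 // => u _; rewrite -[_ *: _]/(_ * (_ * _)) w_idem -mulrA.
  by rewrite nd_wM0 ?mulr0 // addn0 !modn_small // => e; apply: ij; apply: val_inj.
Qed.

Section UniserialModule.
Variables (a L : nat).
Hypothesis L_le : (0 < L <= ell a)%N.

(** The uniserial module is the quotient of R e_a by the paths of length at least [L], carried by
    K^L: [uni_coef] is the projection and [uni_emb] a K-linear section of it. *)
Definition uni_emb (x : {ffun 'I_L -> K}) : R^o := \sum_(t < L) k (x t) * w a t.
Lemma uni_emb_additive : zmod_morphism uni_emb.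
Proof.
by move=> x y; rewrite /uni_emb -sumrB; apply: eq_bigr => t _; rewrite !ffunE rmorphB mulrBl.
Qed.
HB.instance Definition _ := GRing.isZmodMorphism.Build _ _ uni_emb uni_emb_additive.

Definition path_coef (r : R) : nat -> K :=
  proj1_sig (constructive_indefinite_description _ (w_span_at D r a)).
Lemma path_coefP r : r * w a 0 = \sum_(t < ell a) k (path_coef r t) * w a t.
Proof. by rewrite /path_coef; case: constructive_indefinite_description. Qed.

Lemma path_coef_uniq r (c : nat -> K) : r * w a 0 = \sum_(t < ell a) k (c t) * w a t ->
  forall t, (t < ell a)%N -> path_coef r t = c t.
Proof.
rewrite path_coefP => e t tl; apply/eqP; rewrite -subr_eq0; apply/eqP.
apply: (w_free_reg (a := a) (c := fun t => path_coef r t - c t) _ tl).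
transitivity (\sum_(u < ell a) k (path_coef r u) * w a u - \sum_(u < ell a) k (c u) * w a u).
  by rewrite -sumrB; apply: eq_bigr => u _; rewrite rmorphB mulrBl.
by rewrite e subrr.
Qed.

Lemma lt_L_ell t : (t < L)%N -> (t < ell a)%N.
Proof. by case/andP: L_le => _ le /leq_trans; apply. Qed.

Definition uni_coef (r : R^o) : {ffun 'I_L -> K} := [ffun t : 'I_L => path_coef r t].
Lemma uni_coef_additive : zmod_morphism uni_coef.
Proof.
move=> x y; apply/ffunP => t; rewrite !ffunE.
rewrite (path_coef_uniq (c := fun t => path_coef x t - path_coef y t)) ?lt_L_ell //.
rewrite mulrBl !path_coefP -sumrB; apply: eq_bigr => u _.
by rewrite rmorphB mulrBl.
Qed.
HB.instance Definition _ := GRing.isZmodMorphism.Build _ _ uni_coef uni_coef_additive.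

Lemma uni_embK : cancel uni_emb uni_coef.
Proof.
move=> x; apply/ffunP => t; rewrite ffunE.
pose c u := if insub u is Some i then x i else 0.
have ct (i : 'I_L) : c i = x i by rewrite /c valK.
rewrite -ct; apply: path_coef_uniq; last exact: lt_L_ell.
have cL u : ~~ (u < L)%N -> c u = 0 by move=> uL; rewrite /c insubF //; apply/negbTE.
transitivity (\sum_(i < L) k (c i) * w a i).
  by rewrite mulr_suml; apply: eq_bigr => i _; rewrite ct -mulrA w_idem.
have le : (L <= ell a)%N by case/andP: L_le.
rewrite (big_ord_widen _ (fun t => k (c t) * w a t) le) big_mkcond; apply: eq_bigr => i _.
by case: ifPn => // /cL->; rewrite rmorph0 mul0r.
Qed.

(** The part discarded by the truncation lies in the left ideal generated by [w a L], and multiples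
    of it still have no coefficient below [L]. *)
Lemma uni_coefZ r (y : R^o) : uni_coef (r *: (uni_emb (uni_coef y) : R^o)) = uni_coef (r *: y).
Proof.
have [q Hq] : exists q : R, (y : R) * w a 0 - (uni_emb (uni_coef y) : R) = q * w a L.
  have -> : uni_emb (uni_coef y) = \sum_(t < L) k (path_coef y t) * w a t.
    by apply: eq_bigr => t _; rewrite ffunE.
  have le : (L <= ell a)%N by case/andP: L_le.
  rewrite path_coefP (big_ord_widen _ (fun t => k (path_coef y t) * w a t) le) [X in _ - X]big_mkcond.
  rewrite -sumrB; pose c t := if (t < L)%N then 0 else path_coef y t.
  have [|q Hq] := @w_factor _ _ D a L (ell a) c; first by move=> t _ tL; rewrite /c tL.
  exists q; rewrite -Hq; apply: eq_bigr => t _; rewrite /c.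
  by case: ifP; rewrite ?rmorph0 ?mul0r ?subrr ?subr0.
have Eemb : (uni_emb (uni_coef y) : R) * w a 0 = uni_emb (uni_coef y) :> R.
  by rewrite mulr_suml; apply: eq_bigr => t _; rewrite -mulrA w_idem.
apply/esym/eqP; rewrite -subr_eq0 -raddfB -scalerBr; apply/eqP/ffunP => t.
rewrite !ffunE; have [c Hc] := w_span_at D (r * q) (a + L).
pose c' u := if (u < L)%N then 0 else c (u - L)%N.
have lsl := ell_addr D a L; have lt := ltn_ord t.
rewrite (path_coef_uniq (c := c')) ?lt_L_ell //; first by rewrite /c' lt.
rewrite -[_ *: _]/(r * ((y : R) - (uni_emb (uni_coef y) : R))) -mulrA mulrBl Eemb Hq mulrA.
rewrite -(@w_idemL _ _ D a L (a + L)) // mulrA Hc mulr_suml.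
transitivity (\sum_(u < L + ell (a + L)) k (c' u) * w a u).
  rewrite big_split_ord /= [X in _ = X + _]big1 ?add0r => [|i _].
    by apply: eq_bigr => i _; rewrite -mulrA nd_wM /c' ltnNge leq_addr addKn.
  by rewrite /c' ltn_ord rmorph0 mul0r.
rewrite [RHS](big_ord_widen _ (fun u => k (c' u) * w a u) lsl) [RHS]big_mkcond /=.
apply: eq_bigr => u _; case: ltnP => // ul.
by rewrite (proj2 (nd_w_eq0 D _ _)) ?mulr0.
Qed.

Definition uni_mod : lmodType R := trunc_mod uni_embK uni_coefZ.

Lemma uni_ibasis : ibasis D (fun _ : unit => a) (fun _ : unit => L)
  (fun _ : unit => uni_coef (w a 0) : uni_mod).
Proof.
have uZ r y : r *: (uni_coef y : uni_mod) = uni_coef (r *: (y : R^o)) by exact: uni_coefZ.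
have uE (c : nat -> K) : \sum_(t < L) k (c t) *: (w a t *: (uni_coef (w a 0) : uni_mod)) =
    uni_coef (\sum_(t < L) k (c t) * w a t).
  rewrite raddf_sum; apply: eq_bigr => t _; rewrite !uZ.
  by rewrite -[w a t *: _]/(w a t * _) w_idem.
have emb0 : uni_coef (w a L) = 0.
  apply/ffunP => t; rewrite !ffunE.
  rewrite (path_coef_uniq (c := fun u => (u == L)%:R)) ?lt_L_ell ?w_idem //.
    by rewrite ltn_eqF.
  have [lt|ge] := ltnP L (ell a); last first.
    rewrite (proj2 (nd_w_eq0 D _ _)) // big1 // => u _.
    by rewrite (ltn_eqF (leq_trans (ltn_ord u) ge)) rmorph0 mul0r.
  rewrite (bigD1 (Ordinal lt)) //= eqxx rmorph1 mul1r big1 ?addr0 // => u /negPf.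
  by rewrite -val_eqE /= => ->; rewrite rmorph0 mul0r.
split=> [[]|[]|x|c sum0 [] t tL].
- by rewrite uZ -[_ *: _]/(_ * _) w_idem.
- by rewrite uZ -[_ *: _]/(_ * _) w_idem; exact: emb0.
- pose c t := if insub t is Some i then (x : {ffun 'I_L -> K}) i else 0.
  exists (fun _ => c); rewrite big_unit (uE c) -[LHS]uni_embK; congr uni_coef; apply: eq_bigr => t _.
  by rewrite /c valK.
- rewrite big_unit (uE (c tt)) in sum0; have /ffunP/(_ (Ordinal tL)) := sum0; rewrite !ffunE /=.
  pose c' u := if (u < L)%N then c tt u else 0.
  rewrite (path_coef_uniq (c := c')) ?lt_L_ell // /c' ?tL //.
  have le : (L <= ell a)%N by case/andP: L_le.
  rewrite mulr_suml (big_ord_widen _ (fun t => k (c tt t) * w a t * w a 0) le) big_mkcond.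
  by apply: eq_bigr => u _; case: ifP => _; rewrite ?rmorph0 ?mul0r // -mulrA w_idem.
Qed.
End UniserialModule.

(* [Dm] stands for the dual of [R], with [ev] the evaluation of functionals. *)
Section DualModule.
Variables (Dm : lmodType R) (ev : Dm -> R -> K).
Hypothesis evD : forall f g x, ev (f + g) x = ev f x + ev g x.
Hypothesis evD2 : forall f x y, ev f (x + y) = ev f x + ev f y.
Hypothesis evk : forall f c x, ev f (k c * x) = c * ev f x.
Hypothesis evZ : forall r f x, ev (r *: f) x = ev f (x * r).
Hypothesis ev_inj : forall f, (forall x, ev f x = 0) -> f = 0.
Hypothesis ev_surj : forall c : nat -> nat -> K, exists f, forall a t,
  (a < n)%N -> (t < ell a)%N -> ev f (w a t) = c a t.

(* The socles of the indecomposable injectives are at positions [inj_end i - 1]; these are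
   taken large enough that no position used below is negative. *)
Definition inj_base := (n * \max_(j < n) ell j)%N.
Definition inj_end i := (ep inj_base + i.+1)%N.

Lemma inj_start_exists i : exists a, (inj_end i <= ep a)%N.
Proof. by exists (inj_end i); rewrite ltnW // endp_gt. Qed.
(** The least start from which a projective reaches [inj_end i]: it gives the largest interval with
    that end, which is the injective hull of its socle. *)
Definition inj_start i := ex_minn (inj_start_exists i).
Definition inj_len i := (inj_end i - inj_start i)%N.

Lemma inj_startP i : (inj_end i <= ep (inj_start i))%N.
Proof. by rewrite /inj_start; case: ex_minnP. Qed.

Lemma inj_start_min i a : (inj_end i <= ep a)%N -> (inj_start i <= a)%N.
Proof. by rewrite /inj_start; case: ex_minnP => m _ min; exact: min. Qed.

Lemma inj_base_lt i : (inj_base < inj_start i)%N.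
Proof.
rewrite ltnNge; apply/negP => /(endp_mono D) le; have := inj_startP i; rewrite /inj_end; lia.
Qed.

Lemma inj_start_gt0 i : (0 < inj_start i)%N.
Proof. by have := inj_base_lt i; lia. Qed.

Lemma inj_pred i : (ep (inj_start i).-1 < inj_end i)%N.
Proof.
rewrite ltnNge; apply/negP => /inj_start_min; have := inj_start_gt0 i; lia.
Qed.

Lemma inj_start_lt_end i : (inj_start i < inj_end i)%N.
Proof. by have := inj_pred i; have := endp_gt D (inj_start i).-1; have := inj_start_gt0 i; lia. Qed.

Lemma inj_addlen i : (inj_start i + inj_len i)%N = inj_end i.
Proof. by rewrite subnKC // ltnW // inj_start_lt_end. Qed.

Lemma inj_end_inj (i j : 'I_n) : inj_end i = inj_end j %[mod n] -> i = j.
Proof.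
move=> /eqP; rewrite eqn_modDl -addn1 -[j.+1]addn1 eqn_modDr !modn_small // => /eqP.
exact: val_inj.
Qed.

Lemma inj_end_surj b : exists i : 'I_n, inj_end i = b %[mod n].
Proof.
have n0 := nd_n_gt0 D; pose s := (b + n * (ep inj_base).+1 - (ep inj_base).+1)%N.
have ls : (s %% n < n)%N by rewrite ltn_mod.
exists (Ordinal ls); rewrite /inj_end /= addnS -addSn modnDmr /s subnKC ?modnMDl //.
  by rewrite addnC mulnC modnMDl.
by rewrite (leq_trans (leq_pmull _ n0)) ?leq_addl.
Qed.

(** The functional dual to the longest nonzero path ending at the socle position. Acting by a path
    of length t gives the functional dual to that path with its first t arrows removed. *)
Definition inj_gen (i : nat) : Dm := proj1_sig (constructive_indefinite_description _
  (ev_surj (fun c u => ((c == inj_start i %[mod n]) && (u.+1 == inj_len i))%:R))).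

Lemma inj_genE i c u : ev (inj_gen i) (w c u) =
  ((c == inj_start i %[mod n]) && (u.+1 == inj_len i))%:R.
Proof.
have n0 := nd_n_gt0 D; have [ul|lu] := ltnP u (ell c); last first.
  rewrite (proj2 (nd_w_eq0 D _ _)) //; have -> : ev (inj_gen i) 0 = 0.
    by apply: (addIr (ev (inj_gen i) 0)); rewrite -evD2 !add0r.
  case: andP => // -[/eqP ci /eqP ui]; have := inj_startP i.
  by rewrite -inj_addlen -ui /endp -(ell_mod ci); lia.
rewrite -(nd_w_mod _ (a := c %% n)) ?modn_mod // -[in RHS](modn_mod c n).
rewrite /inj_gen; case: constructive_indefinite_description => f /= ->; rewrite ?ltn_mod //.
by rewrite (@ell_mod _ _ _ _ c) ?modn_mod.
Qed.

Lemma ev_genw i t c u : ev (w (inj_start i) t *: inj_gen i) (w c u) =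
  ((c == inj_start i + t %[mod n]) && ((t + u).+1 == inj_len i))%:R.
Proof.
rewrite evZ; have [e|ne] := boolP (c == inj_start i + t %[mod n]).
  by rewrite wM_mod ?(eqP e) // inj_genE eqxx.
by rewrite nd_wM0; [apply: (addIr (ev (inj_gen i) 0)); rewrite -evD2 !add0r|apply/eqP].
Qed.

Lemma ev0 f : ev f 0 = 0.
Proof. by apply: (addIr (ev f 0)); rewrite -evD2 !add0r. Qed.
Lemma ev0l x : ev 0 x = 0.
Proof. by apply: (addIr (ev 0 x)); rewrite -evD !add0r. Qed.
Lemma ev_scalek c f x : ev (k c *: f) x = c * ev f x.
Proof. by rewrite evZ -nd_central evk. Qed.

Lemma ev_ext f g : (forall c u, (c < n)%N -> (u < ell c)%N -> ev f (w c u) = ev g (w c u)) -> f = g.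
Proof.
move=> e; apply/eqP; rewrite -subr_eq0; apply/eqP/ev_inj => x.
have evB y : ev (f - g) y = ev f y - ev g y.
  by apply: (addIr (ev g y)); rewrite -evD !subrK.
have [c ->] := nd_w_span D x; rewrite (big_morph _ (evD2 _) (ev0 _)) big1 // => a _.
by rewrite (big_morph _ (evD2 _) (ev0 _)) big1 // => t _; rewrite evk evB e // subrr mulr0.
Qed.

Lemma dual_ibasis : ibasis D (fun i : 'I_n => inj_start i) (fun i => inj_len i) (fun i => inj_gen i).
Proof.
have evS (c : 'I_n -> nat -> K) a u : ev (\sum_(i < n) \sum_(t < inj_len i)
      k (c i t) *: (w (inj_start i) t *: inj_gen i)) (w a u) =
    \sum_(i < n) \sum_(t < inj_len i)
      c i t * ((a == inj_start i + t %[mod n]) && ((t + u).+1 == inj_len i))%:R.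
  rewrite (big_morph (ev^~ (w a u)) (fun f g => evD f g _) (ev0l _)); apply: eq_bigr => i _.
  rewrite (big_morph (ev^~ (w a u)) (fun f g => evD f g _) (ev0l _)); apply: eq_bigr => t _.
  by rewrite ev_scalek ev_genw.
(* Evaluation at the path from [inj_start i + t] to the socle position reads off the coordinate
   [c i t], since all other basis vectors vanish there. *)
have one (c : 'I_n -> nat -> K) (i : 'I_n) t : (t < inj_len i)%N -> ev (\sum_(i < n) \sum_(t < inj_len i)
      k (c i t) *: (w (inj_start i) t *: inj_gen i)) (w (inj_start i + t) (inj_len i - t.+1)) = c i t.
  move=> tl; rewrite evS (bigD1 i) //= (bigD1 (Ordinal tl)) //= !eqxx /=.
  rewrite (_ : (_ == _) = true) ?mulr1; last by apply/eqP; lia.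
  rewrite [X in _ + X]big1 ?addr0 => [|j ij]; last first.
    rewrite big1 // => t' _; case: andP => [[/eqP e1 /eqP e2]|]; last by rewrite mulr0.
    case/eqP: ij; apply: inj_end_inj; rewrite -!inj_addlen.
    have -> : (inj_start j + inj_len j = inj_start j + t' + (inj_len i - t.+1).+1)%N by lia.
    have -> : (inj_start i + inj_len i = inj_start i + t + (inj_len i - t.+1).+1)%N by lia.
    by rewrite -modnDml -e1 modnDml.
  rewrite big1 ?addr0 // => t' /eqP tt'; case: (_ =P inj_len i); last by rewrite andbF mulr0.
  by move=> e; case: tt'; apply: val_inj => /=; lia.
split=> [i|i|f|c sum0 i t tl].
- by apply: ev_ext => c u _ _; rewrite ev_genw inj_genE addn0 add0n.
- apply: ev_ext => c u _ _; rewrite ev_genw ev0l; case: andP => // -[_ /eqP]; lia.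
- exists (fun (i : 'I_n) t => ev f (w (inj_start i + t) (inj_len i - t.+1))).
  apply: ev_ext => c u cn ul.
  have [i Hi] := inj_end_surj (c + u.+1).
  have u_le : (u < \max_(j < n) ell j)%N.
    exact: leq_trans ul (leq_bigmax (Ordinal cn)).
  have base : (\max_(j < n) ell j <= inj_base)%N by rewrite leq_pmull // nd_n_gt0.
  have end_gt : (inj_base < inj_end i)%N.
    by rewrite (leq_trans (endp_gt D inj_base)) // leq_addr.
  have cE : c = inj_end i - u.+1 %[mod n].
    by apply/eqP; rewrite -(eqn_modDr u.+1) subnK ?Hi //; lia.
  have st_le : (inj_start i <= inj_end i - u.+1)%N.
    by apply: inj_start_min; rewrite /endp -(ell_mod cE); lia.
  have := inj_addlen i => al.
  have -> : w c u = w (inj_start i + (inj_len i - u.+1)) (inj_len i - (inj_len i - u.+1).+1).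
    by rewrite (nd_w_mod _ cE); congr (w _ _); clear -al st_le end_gt base u_le; lia.
  by rewrite (one (fun (i : 'I_n) t => ev f (w (inj_start i + t) (inj_len i - t.+1)))) //; lia.
- by rewrite -(one c i t tl) sum0 ev0l.
Qed.

(** The inequalities say that [a] is the least start reaching [b]. Once [b] is matched with some
    [inj_end i] modulo n, monotonicity of [ep] makes the two starts agree. *)
Lemma inj_interval a b : (0 < a)%N -> (ep a.-1 < b)%N -> (b <= ep a)%N ->
  exists i : 'I_n, inj_start i = a %[mod n] /\ inj_len i = (b - a)%N.
Proof.
move=> a0 eb be; have [i Hi] := inj_end_surj b; exists i.
have ep_shift x q : ep (x + n * q) = (ep x + n * q)%N.
  by elim: q => [|q IH]; rewrite ?muln0 ?addn0 // mulnS addnCA addnC endp_addn IH; lia.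
have [q [q' Hq]] : exists q q', (b + n * q = inj_end i + n * q')%N.
  exists (inj_end i %/ n)%N, (b %/ n)%N.
  rewrite {1}(divn_eq b n) {2}(divn_eq (inj_end i) n) Hi ![(n * _)%N]mulnC.
  by move: (b %/ n * n)%N (inj_end i %/ n * n)%N (b %% n)%N => *; lia.
have s0 := inj_start_gt0 i.
suff sa : (inj_start i + n * q' = a + n * q)%N.
  have al := inj_addlen i.
  split; last by clear -al sa Hq; move: (n * q)%N (n * q')%N sa Hq => *; lia.
  have eqm x m : ((x + n * m) %% n = x %% n)%N by rewrite addnC mulnC modnMDl.
  by rewrite -(eqm _ q') sa eqm.
have h1 : ((inj_start i).-1 + n * q' < a + n * q)%N.
  rewrite ltnNge; apply/negP => /(endp_mono D); rewrite !ep_shift => le.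
  have pi := inj_pred i; clear -le be Hq pi.
  by move: (ep a) (ep _) (inj_end i) (n * q)%N (n * q')%N le be Hq pi => *; lia.
have h2 : (a.-1 + n * q < inj_start i + n * q')%N.
  rewrite ltnNge; apply/negP => /(endp_mono D); rewrite !ep_shift => le.
  have pi := inj_startP i; clear -le eb Hq pi.
  by move: (ep a.-1) (ep _) (inj_end i) (n * q)%N (n * q')%N le eb Hq pi => *; lia.
clear -h1 h2 a0 s0; move: (inj_start i) (n * q)%N (n * q')%N h1 h2 s0 => *; lia.
Qed.

End DualModule.
End IntervalModules.

(** * Additive closures and approximations *)

Section ProductMaps.
Variables (R : pzRingType) (M N : lmodType R).
Lemma fst_linear : linear (fun x : (M * N)%type => x.1). Proof. by []. Qed.
Lemma snd_linear : linear (fun x : (M * N)%type => x.2). Proof. by []. Qed.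
Lemma inl_linear : linear (fun x : M => (x, 0) : (M * N)%type).
Proof.
move=> r x y; rewrite -[RHS]/((r *: x + y, r *: 0 + 0) : (M * N)%type).
by rewrite scaler0 addr0.
Qed.
Lemma inr_linear : linear (fun y : N => (0, y) : (M * N)%type).
Proof.
move=> r x y; rewrite -[RHS]/((r *: 0 + 0, r *: x + y) : (M * N)%type).
by rewrite scaler0 addr0.
Qed.
Definition prod_fst := mklin fst_linear.
Definition prod_snd := mklin snd_linear.
Definition prod_inl := mklin inl_linear.
Definition prod_inr := mklin inr_linear.
Lemma prod_inlE x : prod_inl x = (x, 0). Proof. by []. Qed.
Lemma prod_inrE x : prod_inr x = (0, x). Proof. by []. Qed.
End ProductMaps.

Section PowerMaps.
Variables (R : pzRingType) (W : lmodType R) (I : finType).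

Lemma power_proj_linear j : linear (fun x : {ffun I -> W} => x j).
Proof. by move=> r x y; rewrite !ffunE. Qed.
Definition power_proj j := mklin (power_proj_linear j).
Lemma power_projE j x : power_proj j x = x j. Proof. by []. Qed.

Lemma power_pair_linear (M : lmodType R) (f : I -> {linear M -> W}) :
  linear (fun x : M => [ffun j => f j x]).
Proof. by move=> r x y; apply/ffunP => j; rewrite !ffunE linearP. Qed.
Definition power_pair M f := mklin (@power_pair_linear M f).
Lemma power_pairE M f x j : @power_pair M f x j = f j x. Proof. by rewrite ffunE. Qed.

Lemma power_copair_linear (M : lmodType R) (f : I -> {linear W -> M}) :
  linear (fun x : {ffun I -> W} => \sum_j f j (x j)).
Proof.
move=> r x y; rewrite scaler_sumr -big_split; apply: eq_bigr => j _.
by rewrite !ffunE linearP.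
Qed.
Definition power_copair M f := mklin (@power_copair_linear M f).
End PowerMaps.

Definition retract (R : pzRingType) (X M : lmodType R) :=
  exists (iota : {linear X -> M}) (rho : {linear M -> X}), cancel iota rho.

Section Retracts.
Variable R : pzRingType.
Implicit Types X Y M N W : lmodType R.

(** The complement of a retract is the kernel of the retraction. *)
Lemma summandP X M : summand X M <-> retract X M.
Proof.
split=> [[Y [f [g fK gK]]]|[iota [rho iK]]].
  have glin : linear g.
    by move=> r x y; apply: (can_inj fK); rewrite gK linearP !gK.
  exists (f \o @prod_inl _ X Y : {linear _ -> _}), (@prod_fst _ X Y \o mklin glin : {linear _ -> _}).
  by move=> x /=; rewrite !mklinE fK.
exists (ker_mod rho).
have flin : linear (fun z : (X * ker_mod rho)%type => iota z.1 + ker_val z.2).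
  by move=> r x y; rewrite /= !linearP /= scalerDr addrACA.
exists (mklin flin); have rk m : rho (m - iota (rho m)) = 0 by rewrite raddfB /= iK subrr.
exists (fun m => (rho m, to_ker (rk m))) => [[x y]|m]; rewrite !mklinE /=; last first.
  by rewrite addrCA subrr addr0.
congr pair; first by rewrite linearD /= iK ker_valP addr0.
by apply: val_inj => /=; rewrite linearD /= iK ker_valP addr0 addrC addKr.
Qed.

Lemma retract_trans Y X M : retract X Y -> retract Y M -> retract X M.
Proof.
move=> [i [r ir]] [j [s js]]; exists (j \o i : {linear _ -> _}), (r \o s : {linear _ -> _}).
by move=> x /=; rewrite js ir.
Qed.

Lemma retract_inl X Y : retract X (X * Y)%type.
Proof. by exists (@prod_inl _ X Y), (@prod_fst _ X Y) => x; rewrite !mklinE. Qed.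
Lemma retract_inr X Y : retract Y (X * Y)%type.
Proof. by exists (@prod_inr _ X Y), (@prod_snd _ X Y) => x; rewrite !mklinE. Qed.

Lemma retract_powS W n : retract {ffun 'I_n.+1 -> W} (W * {ffun 'I_n -> W})%type.
Proof.
have l1 : linear (fun x : {ffun 'I_n.+1 -> W} => (x ord0, [ffun j => x (lift ord0 j)])
    : (W * {ffun 'I_n -> W})%type).
  move=> r x y; rewrite -[RHS]/((r *: x ord0 + y ord0, r *: [ffun j => x (lift ord0 j)]
    + [ffun j => y (lift ord0 j)]) : (W * {ffun 'I_n -> W})%type) !ffunE.
  by congr pair; apply/ffunP => j; rewrite !ffunE.
have l2 : linear (fun z : (W * {ffun 'I_n -> W})%type =>
    [ffun i : 'I_n.+1 => if unlift ord0 i is Some j then z.2 j else z.1]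
      : {ffun 'I_n.+1 -> W}).
  by move=> r x y; apply/ffunP => i; rewrite !ffunE; case: unliftP => [j _|_]; rewrite ?ffunE.
exists (mklin l1), (mklin l2) => x; rewrite !mklinE; apply/ffunP => i; rewrite ffunE /=.
by case: unliftP => [j ->|->]; rewrite ?ffunE.
Qed.

Lemma retract_pow0 W M : retract {ffun 'I_0 -> W} M.
Proof.
exists \0, \0 => x; apply/ffunP; by case.
Qed.

Lemma retract_pow1 W : retract W {ffun 'I_1 -> W}.
Proof.
exists (power_pair (fun _ : 'I_1 => idfun : {linear W -> W})), (power_proj W ord0) => x.
by rewrite power_projE power_pairE.
Qed.

Lemma retract_powD X Y W m n : retract X {ffun 'I_m -> W} -> retract Y {ffun 'I_n -> W} ->
  retract (X * Y)%type {ffun 'I_(m + n) -> W}.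
Proof.
move=> [i [r ir]] [j [s js]].
have l1 : linear (fun z : (X * Y)%type => [ffun a : 'I_(m + n) =>
    match split a with inl b => i z.1 b | inr b => j z.2 b end] : {ffun 'I_(m + n) -> W}).
  move=> c x y; apply/ffunP => a; rewrite !ffunE /=.
  by case: split => b; rewrite linearP !ffunE.
have l2 : linear (fun f : {ffun 'I_(m + n) -> W} => (r [ffun b => f (lshift n b)],
    s [ffun b => f (rshift m b)]) : (X * Y)%type).
  move=> c x y; rewrite -[RHS]/((c *: r [ffun b => x (lshift n b)] + r [ffun b => y (lshift n b)],
    c *: s [ffun b => x (rshift m b)] + s [ffun b => y (rshift m b)]) : (X * Y)%type) -!linearP.
  by congr pair; congr (_ _); apply/ffunP => b; rewrite !ffunE.
exists (mklin l1), (mklin l2) => -[x y]; rewrite !mklinE.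
congr pair; [rewrite -[RHS]ir; congr (r _)|rewrite -[RHS]js; congr (s _)];
  apply/ffunP => b; rewrite !ffunE; case: splitP => b' /= e.
- by congr (i x _); apply: val_inj.
- by have := ltn_ord b; rewrite e; lia.
- by have := ltn_ord b'; rewrite -e; lia.
- by congr (j y _); apply: val_inj => /=; lia.
Qed.

Lemma fin_gen_retract X M : retract X M -> fin_gen M -> fin_gen X.
Proof.
move=> [i [r ir]] [n [g Hg]]; exists n, (fun j => r (g j)) => x.
have [c Hc] := Hg (i x); exists c; rewrite -[LHS]ir Hc linear_sum.
by apply: eq_bigr => j _; rewrite linearZ.
Qed.

Lemma fin_gen_prod M N : fin_gen M -> fin_gen N -> fin_gen (M * N)%type.
Proof.
move=> [m [g Hg]] [n [h Hh]].
exists (m + n)%N, (fun a => match split a with inl b => prod_inl M N (g b)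
  | inr b => prod_inr M N (h b) end) => -[x y].
have [c Hc] := Hg x; have [d Hd] := Hh y.
exists (fun a => match split a with inl b => c b | inr b => d b end).
rewrite big_split_ord /=.
transitivity (prod_inl M N x + prod_inr M N y).
  by rewrite !mklinE; congr pair; rewrite /= ?addr0 ?add0r.
rewrite {1}Hc {1}Hd !linear_sum; congr (_ + _); apply: eq_bigr => a _.
  by rewrite -[lshift n a]/(unsplit (inl a)) unsplitK linearZ.
by rewrite -[rshift m a]/(unsplit (inr a)) unsplitK linearZ.
Qed.

Lemma fin_gen_pow W n : fin_gen W -> fin_gen {ffun 'I_n -> W}.
Proof.
move=> fg; elim: n => [|n IH]; first exact: fin_gen_retract (retract_pow0 _ W) fg.
exact: fin_gen_retract (retract_powS W n) (fin_gen_prod fg IH).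
Qed.

Lemma addP W X : add_subcat W X <-> exists n, retract X {ffun 'I_n -> W}.
Proof. by split=> -[n /summandP]; exists n. Qed.

Lemma add_self W : add_subcat W W.
Proof. by apply/addP; exists 1%N; exact: retract_pow1. Qed.

Lemma add_retract W X Y : retract X Y -> add_subcat W Y -> add_subcat W X.
Proof. by move=> XY /addP[n HY]; apply/addP; exists n; exact: retract_trans XY HY. Qed.

Lemma add_closed W : sum_summand_closed (add_subcat W).
Proof.
split=> [X Y /addP[m HX] /addP[n HY]|X Y /summandP HXY]; last exact: add_retract.
by apply/addP; exists (m + n)%N; exact: retract_powD.
Qed.

Lemma add_fin_gen W X : fin_gen W -> add_subcat W X -> fin_gen X.
Proof. by move=> fg /addP[n HX]; exact: fin_gen_retract HX (fin_gen_pow n fg). Qed.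

Lemma closed_add (C : lmodType R -> Prop) W X : sum_summand_closed C -> C W ->
  add_subcat W X -> C X.
Proof.
move=> [Cprod Csum] CW /addP[n /summandP HX]; apply: (Csum _ _ HX); move: n {HX}; elim=> [|n IH]; first by apply: (Csum _ _ _ CW); apply/summandP; exact: retract_pow0.
by apply: (Csum _ _ _ (Cprod _ _ CW IH)); apply/summandP; exact: retract_powS.
Qed.

Lemma Ext_zero_retractl i X M N : retract X M -> Ext_zero i.+1 M N ->
  (exists P : proj_resolution X, True) -> Ext_zero i.+1 X N.
Proof.
by move=> [j [r jr]] H [P _]; exists P => h Hh; exact: (Ext_zero_retract_res jr H).
Qed.

Lemma Ext_zero_pow i M N n : Ext_zero i.+1 M N -> Ext_zero i.+1 M {ffun 'I_n -> N}.
Proof.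
move=> [P HP]; exists P => h h0.
have /choice [g Hg] : forall j, exists g : {linear P i -> N}, forall x, h x j = g (res_d P i x).
  move=> j; have [|g Hg] := HP (power_proj N j \o h : {linear _ -> _}).
    by move=> x; rewrite /= h0 raddf0.
  by exists g.
by exists (power_pair g) => x; rewrite mklinE; apply/ffunP => j; rewrite ffunE.
Qed.

Lemma Ext_zero_prod i M N N' : Ext_zero i.+1 M N -> Ext_zero i.+1 M N' ->
  Ext_zero i.+1 M (N * N')%type.
Proof.
move=> [P HP] HN'; exists P => h h0.
have [|g Hg] := HP (prod_fst N N' \o h : {linear _ -> _}).
  by move=> x; rewrite /= h0 raddf0.
have [|g' Hg'] := proj1 (Ext_zero_res N' P i) HN' (prod_snd N N' \o h : {linear _ -> _}).
  by move=> x; rewrite /= h0 raddf0.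
exists ((prod_inl N N' \o g) \+ (prod_inr N N' \o g') : {linear _ -> _}) => x /=.
have := Hg x; have := Hg' x; rewrite /= !mklinE.
case: (h x) => a b /= -> ->; rewrite -[RHS]/((_ + 0, 0 + _) : (N * N')%type).
by rewrite addr0 add0r.
Qed.

Lemma pd_le_Ext M N d : pd_le M d -> Ext_zero d.+1 M N.
Proof.
move=> [P P0]; exists P => h _; exists \0 => x.
by rewrite (P0 d.+1 (ltnSn d) x) raddf0.
Qed.

End Retracts.

Section IntervalSums.
Variables (K : fieldType) (R : pzRingType) (D : nakData K R).
Notation k := (nd_k D).
Notation n := (nd_n D).
Notation w := (nd_w D).
Notation ell := (nd_ell D).
Notation ep := (endp D).

Lemma prod_ibasis (M N : lmodType R) (I J : finType) (a L : I -> nat) (v : I -> M)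
    (b L' : J -> nat) (u : J -> N) : ibasis D a L v -> ibasis D b L' u ->
  ibasis D (fun s : I + J => match s with inl i => a i | inr j => b j end)
    (fun s => match s with inl i => L i | inr j => L' j end)
    (fun s => match s with inl i => prod_inl M N (v i) | inr j => prod_inr M N (u j) end).
Proof.
move=> ibM ibN.
have sumE (c : I + J -> nat -> K) : \sum_s \sum_(t < match s with inl i => L i | inr j => L' j end)
    k (c s t) *: (w match s with inl i => a i | inr j => b j end t *:
      match s with inl i => prod_inl M N (v i) | inr j => prod_inr M N (u j) end) =
    prod_inl M N (\sum_i \sum_(t < L i) k (c (inl i) t) *: (w (a i) t *: v i)) +
    prod_inr M N (\sum_j \sum_(t < L' j) k (c (inr j) t) *: (w (b j) t *: u j)).
  rewrite big_sumType /= !linear_sum; congr (_ + _); apply: eq_bigr => i _;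
    rewrite linear_sum; apply: eq_bigr => t _; by rewrite !linearZ.
split.
- by case=> [i|j]; rewrite -linearZ /= ?(ib_e ibM) ?(ib_e ibN).
- by case=> [i|j]; rewrite -linearZ /= ?(ib_0 ibM) ?(ib_0 ibN) raddf0.
- move=> [x y]; have [c Hc] := ib_span ibM x; have [d Hd] := ib_span ibN y.
  pose e s := match s with inl i => c i | inr j => d j end.
  by exists e; rewrite (sumE e) -Hc -Hd prod_inlE prod_inrE; congr pair; rewrite /= ?addr0 ?add0r.
- move=> c; rewrite (sumE c) => e; case=> [i|j] t tl.
    apply: (ib_free ibM (c := fun i => c (inl i))) => //.
    by have := congr1 (prod_fst M N) e; rewrite linearD /= !mklinE /= addr0.
  apply: (ib_free ibN (c := fun j => c (inr j))) => //.
  by have := congr1 (prod_snd M N) e; rewrite linearD /= !mklinE /= add0r.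
Qed.

(** One copy of [W] is spent on each interval of [X], so multiplicities cause no trouble. *)
Lemma add_of_ibasis (W X : lmodType R) (I J : finType) (a L : I -> nat) (v : I -> X)
    (b L' : J -> nat) (u : J -> W) : ibasis D a L v -> ibasis D b L' u ->
    (forall i, exists j, a i = b j %[mod n] /\ L i = L' j) ->
  add_subcat W X.
Proof.
move=> ibX ibW match_ij; have [t Ht] := choice _ match_ij.
have /choice [f Hf] : forall i, exists f : {linear X -> W}, forall j,
    f (v j) = if j == i then u (t i) else 0.
  move=> i; apply: (ib_hom ibX) => j; case: eqP => [->|_]; rewrite ?scaler0 //;
    case: (Ht i) => e1 e2.
    by rewrite (nd_w_mod _ e1) (ib_e ibW).
  by rewrite (nd_w_mod _ e1) e2 (ib_0 ibW).
have /choice [g Hg] : forall i, exists g : {linear W -> X}, forall j,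
    g (u j) = if j == t i then v i else 0.
  move=> i; apply: (ib_hom ibW) => j; case: eqP => [->|_]; rewrite ?scaler0 //;
    case: (Ht i) => e1 e2.
    by rewrite -(nd_w_mod _ e1) (ib_e ibX).
  by rewrite -(nd_w_mod _ e1) -e2 (ib_0 ibX).
apply/addP; exists #|I|.
pose p : {linear X -> {ffun 'I_#|I| -> W}} := power_pair (fun i => f (enum_val i)).
pose q : {linear {ffun 'I_#|I| -> W} -> X} := power_copair (fun i => g (enum_val i)).
exists p, q => x; apply: (ib_hom_eq ibX (f := q \o p : {linear _ -> _}) (g := idfun)) => j.
rewrite /= !mklinE (bigD1 (enum_rank j)) //= big1 ?addr0.
  by rewrite ffunE Hf enum_rankK eqxx Hg eqxx.
move=> i ij; rewrite ffunE Hf (_ : (j == enum_val i) = false) ?raddf0 //.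
by apply/negP => /eqP e; case/eqP: ij; rewrite e enum_valK.
Qed.

(** The spanning maps send one generator [v i] to one basis vector of [N] and the other generators
    to 0. Where this is not a homomorphism the zero map is used instead, and [coef_allowed] shows
    that the corresponding coefficient vanishes. *)
Lemma hom_span (M N : lmodType R) (I J : finType) (a L : I -> nat) (v : I -> M)
    (b L' : J -> nat) (u : J -> N) : ibasis D a L v -> ibasis D b L' u ->
  exists (Q : nat) (g : 'I_Q -> {linear M -> N}), forall f : {linear M -> N},
    exists c : 'I_Q -> K, forall x, f x = \sum_q k (c q) *: g q x.
Proof.
move=> ibM ibN.
pose T := (I * {j : J & 'I_(L' j)})%type.
pose el (s : T) := w (b (tag s.2)) (tagged s.2 : 'I_(L' (tag s.2))) *: u (tag s.2).
pose allowed (s : T) := w (a s.1) 0 *: el s = el s /\ w (a s.1) (L s.1) *: el s = 0.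
have /choice [g Hg] : forall s, exists g : {linear M -> N}, allowed s ->
    forall i, g (v i) = if i == s.1 then el s else 0.
  move=> s; have [[ae a0]|nal] := classic (allowed s); last by exists \0 => /nal.
  have [||g Hg] := @ib_hom _ _ _ _ _ _ _ _ ibM N (fun i => if i == s.1 then el s else 0).
  - by move=> i; case: eqP => [->|_]; rewrite ?scaler0.
  - by move=> i; case: eqP => [->|_]; rewrite ?scaler0.
  - by exists g.
exists #|{: T}|, (fun q => g (enum_val q)) => f.
have /choice [c Hc] : forall i, exists c : J -> nat -> K,
  f (v i) = \sum_j \sum_(t < L' j) k (c j t) *: (w (b j) t *: u j).
  by move=> i; exact: (ib_span ibN).
pose coef (s : T) := c s.1 (tag s.2) (tagged s.2 : 'I_(L' (tag s.2))).
have coef_allowed s : coef s != 0 -> allowed s.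
  case: s => i [j t]; rewrite /coef /allowed /el /= => nz.
  have tl := ltn_ord t; split.
    have fe : w (a i) 0 *: f (v i) = f (v i) by rewrite -linearZ /= (ib_e ibM).
    rewrite Hc ib_scale // in fe.
    have := ib_inj ibN (c := fun j t => if (0 <= t)%N && (a i == b j + (t - 0) %[mod n])
      then c i j (t - 0)%N else 0) fe tl.
    rewrite leq0n /= subn0; case: eqP => [e _|_ c0]; last by rewrite -c0 eqxx in nz.
    by rewrite scalerA w_idemL.
  have f0 : w (a i) (L i) *: f (v i) = 0 by rewrite -linearZ /= (ib_0 ibM) raddf0.
  rewrite Hc ib_scale // in f0.
  have [e|ne] := boolP (a i == b j + t %[mod n]); last by rewrite scalerA nd_wM0 ?scale0r //; apply/eqP.
  rewrite scalerA wM_mod ?(eqP e) // (w_kill _ (ib_0 ibN j)) //.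
  rewrite leqNgt; apply/negP => lt.
  have := ib_free ibN (c := fun j t => if (L i <= t)%N && (a i == b j + (t - L i) %[mod n])
      then c i j (t - L i)%N else 0) f0 lt.
  by rewrite leq_addl addnK e /= => c0; rewrite c0 eqxx in nz.
exists (fun q => coef (enum_val q)) => x.
transitivity (\sum_s k (coef s) *: g s x); last first.
  by rewrite (reindex (enum_val (A := {: T}))) //; exact: onW_bij (@enum_val_bij _).
have lin : linear (fun x => \sum_s k (coef s) *: g s x).
  move=> r y z; rewrite scaler_sumr -big_split; apply: eq_bigr => s _ /=.
  by rewrite linearP scalerDr scale_central.
apply: (ib_hom_eq ibM (g := mklin lin)) => i; rewrite mklinE Hc.
transitivity (\sum_(i' : I) \sum_(s : {j : J & 'I_(L' j)}) k (coef (i', s)) *: g (i', s) (v i));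
  last by rewrite pair_big; apply: eq_bigr => -[].
rewrite (bigD1 i) //= [X in _ = _ + X]big1 ?addr0 => [|i' ii']; last first.
  rewrite big1 // => s _; have [->|/coef_allowed al] := eqVneq (coef (i', s)) 0.
    by rewrite rmorph0 scale0r.
  by rewrite Hg //= eq_sym (negPf ii') scaler0.
rewrite (@sig_big_dep _ _ _ _ (fun j => 'I_(L' j)) xpredT (fun _ => xpredT)
  (fun j t => k (c i j t) *: (w (b j) t *: u j))) /=.
apply: eq_bigr => -[j t] _ /=; have [e|/coef_allowed al] := eqVneq (coef (i, Tagged _ t)) 0.
  by rewrite -[c i j t]/(coef (i, Tagged (fun j => 'I_(L' j)) t)) e rmorph0 !scale0r.
by rewrite Hg //= eqxx.
Qed.

(** A finite K-spanning family of maps gives both approximations: M -> W^q with these components,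
    and W^q -> M summing them. Any map to or from a power of [W] has K-combinations of the family as
    components, hence factors. *)
Lemma add_functorially_finite (W : lmodType R) (J : finType) (b L' : J -> nat) (u : J -> W) :
  ibasis D b L' u -> functorially_finite (add_subcat W).
Proof.
move=> ibW M /(ibasis_exists D)[I [a [L [v [ibM _]]]]]; split.
  have [q [g Hg]] := hom_span ibM ibW.
  exists {ffun 'I_q -> W}, (power_pair g); split.
    by apply/addP; exists q, idfun, idfun.
  move=> X f /addP[r [i [p ip]]].
  have /choice [c Hc] := fun s => Hg (power_proj W s \o i \o f : {linear M -> W}).
  have lin : linear (fun x : {ffun 'I_q -> W} => [ffun s : 'I_r => \sum_t k (c s t) *: x t]).
    move=> z x y; apply/ffunP => s; rewrite !ffunE scaler_sumr -big_split.
    by apply: eq_bigr => t _; rewrite !ffunE scalerDr scale_central.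
  exists (p \o mklin lin : {linear _ -> _}) => x /=; rewrite -[LHS]ip mklinE; congr (p _).
  apply/ffunP => s; rewrite ffunE; have := Hc s x; rewrite /= mklinE => ->.
  by apply: eq_bigr => t _; rewrite mklinE ffunE.
have [q [g Hg]] := hom_span ibW ibM.
exists {ffun 'I_q -> W}, (power_copair g); split.
  by apply/addP; exists q, idfun, idfun.
move=> X f /addP[r [i [p ip]]].
have inj_lin s : linear (fun x : W => [ffun s' : 'I_r => if s' == s then x else 0]).
  by move=> z x y; apply/ffunP => s'; rewrite !ffunE; case: eqP; rewrite // scaler0 addr0.
have /choice [c Hc] := fun s => Hg (f \o p \o mklin (inj_lin s) : {linear W -> M}).
have lin : linear (fun x : {ffun 'I_r -> W} => [ffun t : 'I_q => \sum_s k (c s t) *: x s]).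
  move=> z x y; apply/ffunP => s; rewrite !ffunE scaler_sumr -big_split.
  by apply: eq_bigr => t _; rewrite !ffunE scalerDr scale_central.
exists (mklin lin \o i : {linear _ -> _}) => x /=; rewrite -[in LHS](ip x) !mklinE.
set y := i x; have yE : y = \sum_s mklin (inj_lin s) (y s).
  apply/ffunP => t; rewrite sum_ffunE (bigD1 t) //= mklinE ffunE eqxx big1 ?addr0 //.
  by move=> s st; rewrite mklinE ffunE eq_sym (negPf st).
rewrite {1}yE !linear_sum.
transitivity (\sum_s \sum_t k (c s t) *: g t (y s)).
  by apply: eq_bigr => s _; have := Hc s (y s).
rewrite exchange_big; apply: eq_bigr => t _; rewrite ffunE linear_sum.
by apply: eq_bigr => s _; rewrite linearZ.
Qed.
End IntervalSums.

(** * Combinatorics of the injective intervals *)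

Lemma divn_lt x l q : (0 < l)%N -> (x < q * l)%N ->
  exists j r, [/\ x = (j * l + r)%N, (r < l)%N & (j < q)%N].
Proof.
by move=> l0 xq; exists (x %/ l)%N, (x %% l)%N; rewrite -divn_eq ltn_mod ltn_divLR.
Qed.

Section Combinatorics.
Variable f : nat -> nat.
Notation F i x := (iter i f x).

(* The minimal projective resolution of the interval [a, b[ has terms at positions
   [zig a b 0], [zig a b 1], and so on. *)
Definition zig a b i := F i./2 (if odd i then b else a).

Lemma zig_even a b i : zig a b i.*2 = F i a.
Proof. by rewrite /zig odd_double doubleK. Qed.
Lemma zig_odd a b i : zig a b i.*2.+1 = F i b.
Proof. by rewrite /zig /= odd_double uphalf_double. Qed.
Lemma zigS2 a b i : zig a b i.+2 = f (zig a b i).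
Proof. by rewrite /zig /= negbK. Qed.

(* What projective dimension [d] of [a, b[ and Ext^i([a, b[, A) = 0 for [0 < i < d] say about
   the resolution. *)
Record good d a b : Prop := Good {
  good_lt : forall i, (i <= d)%N -> (zig a b i < zig a b i.+1)%N;
  good_end : zig a b d.+1 = zig a b d.+2;
  good_step : forall j, (j.+2 <= d)%N -> (f (zig a b j) < f (zig a b j).+1)%N }.

Variables (n d : nat).
Hypothesis n_gt0 : (0 < n)%N.
Hypothesis f_addn : forall x, f (x + n) = (f x + n)%N.
Hypothesis f_mono : forall x y, (x <= y)%N -> (f x <= f y)%N.
Hypothesis f_gt : forall x, (x < f x)%N.
Hypothesis d_ge2 : (2 <= d)%N.
(* The nonprojective injective intervals, up to a shift by [n]. *)
Hypothesis inj_good : forall a b, (f (a + n).-1 < b + n)%N -> (b < f a)%N -> good d a b.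

Lemma F_mono i x y : (x <= y)%N -> (F i x <= F i y)%N.
Proof. by move=> xy; elim: i => //= i; exact: f_mono. Qed.

(** Away from position 0 the shift by n in [inj_good] can be undone; at 0 it is what gives the
    predecessor a meaning. *)
Lemma pred_good x b : (0 < x)%N -> (f x.-1 < b)%N -> (b < f x)%N -> good d x b.
Proof.
move=> x0 fb bf; apply: inj_good => //.
by rewrite (_ : (x + n).-1 = (x.-1 + n)%N) ?f_addn ?ltn_add2r //; lia.
Qed.

Section Even.
Variable k : nat.
Hypothesis dk : d = k.*2.
Variables (a b : nat).
Hypothesis g : good d a b.

Lemma good_even_lt i : (i <= k)%N -> (F i a < F i b)%N.
Proof. by move=> ik; rewrite -(zig_even a b) -(zig_odd a b); apply: (good_lt g); lia. Qed.
Lemma good_even_ltS i : (i < k)%N -> (F i b < F i.+1 a)%N.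
Proof. by move=> ik; rewrite -(zig_odd a b) -(zig_even a b i.+1); apply: (good_lt g); lia. Qed.
Lemma good_even_end : F k b = F k.+1 a.
Proof. by rewrite -(zig_odd a b) -(zig_even a b k.+1); have := good_end g; rewrite dk. Qed.
Lemma good_even_step i : (i < k)%N -> (f (F i a) < f (F i a).+1)%N.
Proof. by move=> ik; rewrite -(zig_even a b); apply: (good_step g); lia. Qed.
Lemma good_even_stepS i : (i.+1 < k)%N -> (f (F i b) < f (F i b).+1)%N.
Proof. by move=> ik; rewrite -(zig_odd a b); apply: (good_step g); lia. Qed.
End Even.

Section Odd.
Variable k : nat.
Hypothesis dk : d = k.*2.+1.
Variables (a b : nat).
Hypothesis g : good d a b.

Lemma good_odd_lt i : (i <= k)%N -> (F i a < F i b)%N.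
Proof. by move=> ik; rewrite -(zig_even a b) -(zig_odd a b); apply: (good_lt g); lia. Qed.
Lemma good_odd_ltS i : (i <= k)%N -> (F i b < F i.+1 a)%N.
Proof. by move=> ik; rewrite -(zig_odd a b) -(zig_even a b i.+1); apply: (good_lt g); lia. Qed.
Lemma good_odd_end : F k.+1 b = F k.+1 a.
Proof. by rewrite -(zig_odd a b) -(zig_even a b k.+1); have := good_end g; rewrite dk. Qed.
Lemma good_odd_step i : (i < k)%N -> (f (F i a) < f (F i a).+1)%N.
Proof. by move=> ik; rewrite -(zig_even a b); apply: (good_step g); lia. Qed.
Lemma good_odd_stepS i : (i < k)%N -> (f (F i b) < f (F i b).+1)%N.
Proof. by move=> ik; rewrite -(zig_odd a b); apply: (good_step g); lia. Qed.
End Odd.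

(** * Cyclic quivers: incompatibility of the endpoint conditions *)

Section Cyclic.
Hypothesis f_gt2 : forall x, (x.+2 <= f x)%N.
(* The simple module at [a] has projective dimension at most [d]. *)
Hypothesis simple_pd : forall a, exists i, (i <= d)%N /\ zig a a.+1 i.+1 = zig a a.+1 i.+2.

Lemma simple_cases a : exists j, (j.*2 <= d)%N /\ F j a.+1 = F j.+1 a \/
  (0 < j)%N /\ (j.*2.-1 <= d)%N /\ F j a = F j a.+1.
Proof.
have [i [id e]] := simple_pd a.
have := odd_double_half i; case: (odd i) => /= ii; rewrite ?add0n in ii.
  exists i./2.+1; right; split=> //; split; first lia.
  by move: e; rewrite -{1 2}ii -[(1 + _).+1]/(i./2.+1.*2) zig_even zig_odd.
exists i./2; left; split; first lia.
by move: e; rewrite -{1 2}ii zig_odd -[_.+2]/(i./2.+1.*2) zig_even.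
Qed.

(** If [f] never jumped by more than one, periodicity would make it a translation, the selfinjective
    case, and the resolution of the simple module at 0 would never end. A larger jump at [a]
    provides a nonprojective injective starting there. *)
Lemma excess_exists : exists a, (0 < a)%N /\ ((f a.-1).+1 < f a)%N.
Proof.
apply: NNPP => no; have step x : (f x.+1 <= (f x).+1)%N.
  by rewrite leqNgt; apply/negP => lt; apply: no; exists x.+1.
have steps x i : (f (x + i) <= f x + i)%N.
  elim: i => [|i IH]; first by rewrite !addn0.
  by rewrite !addnS (leq_trans (step _)).
have f1 x : f x.+1 = (f x).+1.
  apply/eqP; rewrite eqn_leq step /=; have := steps x.+1 n.-1.
  by rewrite addSnnS prednK // f_addn; lia.
have F1 i x : F i x.+1 = (F i x).+1 by elim: i => //= i ->.
have [j [[_ e]|[_ [_ e]]]] := simple_cases 0; rewrite F1 /= in e; last by move: e; clear; lia.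
by have := f_gt2 (F j 0); rewrite -e ltnn.
Qed.

(** Put b = f a - 1. The end of its resolution makes [f] equal at F^k a and its successor. A jump of
    more than one at some F^i a, 0 < i <= k, would give an injective whose Ext condition denies
    this. Without such jumps F^i b + 1 = F^(i+1) a for all i <= k, which contradicts F^(k+1) b =
    F^(k+1) a as f x >= x + 2. *)
Lemma cyclic_odd_absurd k : d = k.*2.+1 -> False.
Proof.
move=> dk; have [a [a0 ex]] := excess_exists.
have k0 : (0 < k)%N by lia.
have ga : good d a (f a).-1 by apply: pred_good => //; have := f_gt a; lia.
have no_zero : f (F k a).+1 = f (F k a).
  apply/eqP; rewrite eqn_leq [X in _ && X]f_mono // andbT.
  rewrite -[X in (_ <= X)%N]/(F k.+1 a) -(good_odd_end dk ga) /=; apply: f_mono.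
  by apply: (good_odd_lt dk ga).
have s_gap i : (0 < i)%N -> (i <= k)%N -> (f (F i a) <= (f (F i a).-1).+1)%N.
  move=> i0 ik; rewrite leqNgt; apply/negP => lt.
  have Fi0 : (0 < F i a)%N by case: (i) i0 => //= i' _; exact: leq_ltn_trans (f_gt _).
  have gi := pred_good Fi0 (ltnSn _) lt.
  have := good_odd_step dk gi (i := (k - i)%N); rewrite -iterD subnK // no_zero ltnn.
  by move=> /(_ ltac:(lia)).
have Fb i : (i <= k)%N -> (F i (f a).-1).+1 = F i.+1 a.
  elim: i => [|i IH] ik; first by have := f_gt a => /=; lia.
  have := good_odd_ltS dk ga ik; have := s_gap i.+1 isT ik.
  by rewrite -{2}(IH (ltnW ik)) /= => g1 g2; apply/eqP; rewrite eqn_leq g2.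
have := f_gt2 (F k (f a).-1); rewrite -[f (F _ _)]/(F k.+1 _) (good_odd_end dk ga).
by rewrite -(Fb k (leqnn k)) ltnn.
Qed.

(** By [y_gt], the resolution of the simple module at [a] can only end with F^i (a+1) = F^(i+1) a.
    Starting from adjacent points, the orbits must separate at some step j < i, which yields an
    injective starting at F^j (a+1). Its Ext condition makes [f] increase strictly at F^(i-1) (a+1);
    but minimality of i puts this point strictly below F^i a, where [f] takes the same value. *)
Lemma cyclic_even_absurd k : d = k.*2 -> False.
Proof.
move=> dk; have [a [a0 ex]] := excess_exists.
have k0 : (0 < k)%N by lia.
have ga := pred_good a0 (ltnSn _) ex.
have y_gt i : (i <= k)%N -> (F i a < F i a.+1)%N.
  elim: i => // i IH ik /=; apply: leq_trans (good_even_step dk ga ik) _.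
  by apply: f_mono; apply: IH; exact: ltnW.
have [i [ik yi min]] : exists i, [/\ (i <= k)%N, F i a.+1 = F i.+1 a &
    forall j, (j < i)%N -> F j a.+1 <> F j.+1 a].
  have H : exists j, (j <= k)%N && (F j a.+1 == F j.+1 a).
    have [j [[jd e]|[j0 [jd e]]]] := simple_cases a.
      by exists j; rewrite e eqxx andbT; lia.
    have jk : (j <= k)%N by lia.
    by have := y_gt j jk; rewrite e ltnn.
  case: (ex_minnP H) => i /andP[ik /eqP e] min; exists i; split=> // j ji e'.
  by have := min j; rewrite e' eqxx andbT => /(_ (ltnW (leq_trans ji ik))); rewrite leqNgt ji.
have i0 : (0 < i)%N.
  by case: (i) yi => //= e; have := f_gt2 a; lia.
have [j [ji yj yj1]] : exists j, [/\ (j < i)%N, F j a.+1 = (F j a).+1 &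
    ((F j.+1 a).+1 < F j.+1 a.+1)%N].
  apply: NNPP => no.
  have : forall j, (j <= i)%N -> F j a.+1 = (F j a).+1.
    elim=> [//|j IH] ji; have := y_gt j.+1 (leq_trans ji ik).
    rewrite leq_eqVlt => /orP[/eqP-> //|lt]; case: no; exists j; split=> //.
    by apply: IH; exact: ltnW.
  by move/(_ i (leqnn i)); rewrite yi /=; have := f_gt2 (F i a); lia.
have gs : good d (F j a).+1 (F j.+1 a).+1.
  by apply: pred_good => //=; rewrite -yj.
have := good_even_step dk gs (i := (i.-1 - j)%N); rewrite -yj -iterD subnK; last lia.
have yi1 : f (F i.-1 a.+1) = F i.+1 a by rewrite -yi -iterS prednK.
have lt : (F i.-1 a.+1 < F i a)%N.
  have le : (F i.-1 a.+1 <= F i a)%N.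
    by have := F_mono i.-1 (f_gt a); rewrite -iterSr prednK.
  rewrite ltn_neqAle le andbT; apply/eqP => e.
  by apply: (min i.-1); rewrite ?prednK.
have := f_mono lt; rewrite yi1 /=; move: (f _) => z le /(_ ltac:(lia)).
by rewrite ltnNge le.
Qed.

End Cyclic.

(** * Linear quivers: determination of the endpoint function *)

Section Linear.
Hypothesis n_gt1 : (1 < n)%N.
Hypothesis f_gt2 : forall x, (x < n.-1)%N -> (x.+2 <= f x)%N.
Hypothesis f_last : f n.-1 = n.
Notation l := (f 0).

Lemma l_ge2 : (2 <= l)%N. Proof. by apply: f_gt2; lia. Qed.

Lemma good0 b : (0 < b)%N -> (b < l)%N -> good d 0 b.
Proof. by move=> b0 bl; apply: inj_good => //; rewrite add0n f_last; lia. Qed.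

Lemma F0_lt k : (forall i, (i <= k)%N -> (F i 0 < F i 1)%N) ->
    (forall i, (i < k)%N -> (F i 1 < F i.+1 0)%N) ->
  forall i, (i <= k)%N -> (F i 0 < n)%N /\ (F i 1 <= n)%N.
Proof.
move=> lt1 lt2; elim=> [|i IH] ik; first by split => //=; lia.
have [F0 F1] := IH (ltnW ik).
have le0 : (F i.+1 0 <= n)%N by rewrite -f_last /=; apply: f_mono; lia.
have le1 : (F i.+1 1 <= n)%N.
  by rewrite -f_last /=; apply: f_mono; have := lt2 i ik; lia.
by split=> //; have := lt1 i.+1 ik; lia.
Qed.

Lemma F_translate x j b : (forall y, (y < x)%N -> f y = (y + l)%N) ->
  (0 < j -> (j.-1 * l + b < x)%N)%N -> F j b = (j * l + b)%N.
Proof.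
move=> fx; elim: j => [//|j IH] /= lt; rewrite IH.
  by rewrite fx ?lt // mulSn; lia.
by move=> j0; have := lt isT; case: (j) j0 => //= j' _; rewrite mulSn; lia.
Qed.

(** Translation by l is propagated upwards from 0. The Ext conditions for injectives starting at 0
    give f (x+1) > f x; a jump of more than one would make [x+1, x+l+1[ injective, and its
    conditions collide with the end of the resolution of some [0, c[. *)
Lemma linear_even k : d = k.*2 -> n = (k * l).+1 /\ forall x, (x < n)%N -> f x = minn (x + l) n.
Proof.
move=> dk; have k0 : (0 < k)%N by lia.
have l2 := l_ge2; have g1 : good d 0 1 by apply: good0.
have glast : good d 0 l.-1 by apply: good0; lia.
have low y : (y <= k.-1 * l)%N -> f y = (y + l)%N.
  elim/ltn_ind: y => -[//|x] IH xk.
  have fx y : (y < x.+1)%N -> f y = (y + l)%N by move=> yx; apply: IH => //; lia.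
  have [j [r [xE rl jk]]] := divn_lt (ltnW l2) xk.
  have {}jk : (j.+1 < k)%N by lia.
  have FE c : (0 < c)%N -> (c <= l)%N -> (c <= r.+1)%N -> F j c = (j * l + c)%N.
    move=> c0 cl cr; apply: (F_translate fx) => j0.
    by move: xE; rewrite -{1}(prednK j0) mulSn; lia.
  have F0E : F j 0 = (j * l)%N.
    rewrite (F_translate fx) ?addn0 // => j0.
    by move: xE; rewrite -{1}(prednK j0) mulSn; lia.
  have up : (x + l < f x.+1)%N.
    rewrite -fx // xE; have [r0|r0] := posnP r.
      by rewrite r0 addn0 -F0E; exact: (good_even_step dk g1 (ltnW jk)).
    by rewrite -FE // ?(ltnW rl) //; apply: (good_even_stepS dk (good0 r0 rl) jk).
  apply/eqP; rewrite addSn eqn_leq up andbT leqNgt; apply/negP => lt.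
  have gx : good d x.+1 (x + l).+1 by apply: pred_good => //=; rewrite fx.
  (* The cases differ in the orbit that contains x + 1: that of 0 if r + 1 = l, that of r + 1
     otherwise. Accordingly the collision is with [0, l-1[ or with [0, r+1[. *)
  move: (rl); rewrite leq_eqVlt => /orP[/eqP rE|rl'].
    have xS : x.+1 = F j.+1 0.
      by rewrite iterSr /= FE ?rE ?leqnn ?(ltnW l2) // {1}xE -addnS rE.
    have Fl1 : F j.+1 l.-1 = (x + l)%N.
      have e : (j * l + l.-1 = x)%N by rewrite xE -rE.
      have l1 : (0 < l.-1)%N by rewrite ltn_predRL.
      have lr : (l.-1 <= r.+1)%N by rewrite rE leq_pred.
      have := FE _ l1 (leq_pred l) lr; rewrite e => e'.
      by rewrite iterS e' fx.
    pose t := (k.-2 - j)%N.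
    have t1 : (t.+1 < k)%N by lia.
    have Ft : (F t (x + l).+1 < F k 0)%N.
      have := good_even_ltS dk gx (ltnW t1); rewrite xS -iterD.
      by rewrite (_ : (t.+1 + j.+1)%N = k) //; lia.
    have := leq_trans (good_even_stepS dk gx t1) (f_mono Ft).
    rewrite ltnNge -[f (F k 0)]/(F k.+1 0) -(good_even_end dk glast) => /negP; apply.
    have -> : F k l.-1 = f (F t (F j.+1 l.-1)).
      by rewrite -iterD -iterS; congr (F _ _); lia.
    by apply: f_mono; apply: F_mono; rewrite Fl1.
  have g := good0 (ltn0Sn r) rl'.
  have xS : x.+1 = F j r.+1 by rewrite FE //; lia.
  have := good_even_step dk gx (i := (k.-1 - j)%N); rewrite xS -iterD subnK; last by lia.
  have lt2 : (F k.-1 r.+1 < F k 0)%N.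
    by have := good_even_ltS dk g (i := k.-1); rewrite prednK //; apply; lia.
  move=> /(_ ltac:(lia)); rewrite ltnNge => /negP; apply.
  apply: leq_trans (f_mono lt2) _; rewrite -[f (F k 0)]/(F k.+1 0) -(good_even_end dk g).
  by rewrite -iterS prednK.
have FE j c : (j <= k)%N -> (c <= 1)%N -> (j = k -> c = 0)%N -> F j c = (j * l + c)%N.
  move=> jk c1 ck; apply: (@F_translate (k.-1 * l).+1) => [y yk|j0]; first exact: low.
  rewrite ltnS; have [jk'|kj] := ltnP j k; last first.
    by rewrite ck ?addn0; [rewrite (_ : j = k) //|]; lia.
  apply: (@leq_trans (j * l)).
    by rewrite -{2}(prednK j0) mulSn addnC leq_add2r (leq_trans c1) // ltnW.
  by rewrite leq_mul2r; apply/orP; right; lia.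
have kS : (k * l = k.-1 * l + l)%N by case: (k) k0 => // k' _; rewrite mulSn addnC.
(* The end of the resolution of [0, 1[ makes [f] constant from (k-1)l + 1 to kl. Its value there
   turns out to be kl + 1, which by [f_gt2] is possible only if kl is the last position. *)
have e1 : f (k.-1 * l).+1 = f (k * l).
  have ek : F k 1 = f (F k.-1 1) by rewrite -iterS prednK.
  have := good_even_end dk g1; rewrite ek iterS (FE k.-1) ?leq_pred //; last by lia.
  by rewrite addn1 FE // addn0.
have lt1 : ((k.-1 * l).+1 < k * l)%N.
  by rewrite kS; lia.
have kl : (k * l < f (k.-1 * l).+1)%N.
  have := good_even_step dk g1 (i := k.-1); rewrite FE //; last lia.
  rewrite addn0 low // => /(_ ltac:(lia)).
  by rewrite kS.
have e2 : f (k * l) = (k * l).+1.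
  apply/eqP; rewrite -e1 eqn_leq kl andbT leqNgt; apply/negP => lt.
  have flow := low _ (leqnn (k.-1 * l)%N).
  have gx : good d (k.-1 * l).+1 (k * l).+1.
    by apply: pred_good => //=; rewrite flow kS.
  have := good_even_step dk gx (i := 0) => /(_ k0) /=.
  by rewrite e1 ltnNge f_mono.
have [kn _] := F0_lt (fun i => good_even_lt dk g1 (i := i)) (fun i => good_even_ltS dk g1 (i := i)) (leqnn k).
rewrite FE // addn0 in kn.
have nE : n = (k * l).+1.
  have [lt|ge] := ltnP (k * l) n.-1; last lia.
  by have := f_gt2 lt; rewrite e2; lia.
split=> // x xn; have [xk|kx] := leqP x (k.-1 * l)%N.
  rewrite low //; apply/esym/minn_idPl; rewrite nE kS; lia.
have -> : f x = n.
  apply/eqP; rewrite eqn_leq; apply/andP; split.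
    by rewrite -[X in (_ <= X)%N]f_last f_mono //; lia.
  by rewrite {1}nE -e2 -e1 f_mono.
by apply/esym/minn_idPr; rewrite nE kS; lia.
Qed.

(** All F^(k+1) c with 0 <= c < l coincide, because the resolution of each injective [0, c[ ends
    there. A jump of more than one at x + 1 would separate two of them: 0 and 1 if r + 1 = l,
    otherwise r and r + 1. *)
Lemma linear_odd k : d = k.*2.+1 ->
  n = (k.+1 * l)%N /\ forall x, (x < n)%N -> f x = minn (x + l) n.
Proof.
move=> dk; have k0 : (0 < k)%N by lia.
have l2 := l_ge2; have g1 : good d 0 1 by apply: good0.
have glast : good d 0 l.-1 by apply: good0; lia.
have low y : (y <= k * l)%N -> f y = (y + l)%N.
  elim/ltn_ind: y => -[//|x] IH xk.
  have fx y : (y < x.+1)%N -> f y = (y + l)%N by move=> yx; apply: IH => //; lia.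
  have [j [r [xE rl jk]]] := divn_lt (ltnW l2) xk.
  have FE c : (c <= l)%N -> (c <= r.+1)%N -> F j c = (j * l + c)%N.
    move=> cl cr; apply: (F_translate fx) => j0.
    by move: xE; rewrite -{1}(prednK j0) mulSn; lia.
  have up : (x + l < f x.+1)%N.
    rewrite -fx // xE; have [r0|r0] := posnP r.
      by rewrite r0 -FE ?r0 //; exact: (good_odd_step dk g1 jk).
    by rewrite -FE // ?(ltnW rl) //; apply: (good_odd_stepS dk (good0 r0 rl) jk).
  apply/eqP; rewrite addSn eqn_leq up andbT leqNgt; apply/negP => lt.
  have gx : good d x.+1 (x + l).+1 by apply: pred_good => //=; rewrite fx.
  move: (rl); rewrite leq_eqVlt => /orP[/eqP rE|rl'].
    have xS : x.+1 = F j.+1 0.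
      by rewrite iterSr /= FE ?rE ?leqnn // {1}xE -addnS rE.
    have := good_odd_step dk gx (i := (k - j.+1)%N); rewrite xS -iterD subnK // => /(_ ltac:(lia)).
    rewrite ltnNge => /negP; apply; rewrite -[f (F k 0)]/(F k.+1 0) -(good_odd_end dk g1).
    by apply: f_mono; exact: (good_odd_lt dk g1).
  have g := good0 (ltn0Sn r) rl'.
  have xS : x.+1 = F j r.+1 by rewrite FE //; lia.
  have Fr : F k.+1 r = F k.+1 r.+1.
    rewrite (good_odd_end dk g); have [->//|r0] := posnP r; exact: (good_odd_end dk (good0 r0 rl)).
  have := good_odd_ltS dk gx (leq_subr j k); rewrite xS -iterD.
  rewrite (_ : ((k - j).+1 + j)%N = k.+1); last lia.
  rewrite ltnNge -Fr => /negP; apply.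
  rewrite (_ : k.+1 = (k - j + j.+1)%N); last lia.
  rewrite iterD; apply: F_mono; rewrite /= FE //; [|lia].
  by rewrite -xE fx // ltnW.
have FE c : (c <= l)%N -> F k c = (k * l + c)%N.
  move=> cl; apply: (@F_translate (k * l).+1) => [y yk|_]; first exact: low.
  have kS : (k * l = k.-1 * l + l)%N by case: (k) k0 => // k' _; rewrite mulSn addnC.
  by rewrite kS; lia.
(* The resolution of [0, l-1[ ends at this value; by [f_gt2] an endpoint only one step away singles
   out kl + l - 1 as the last position. *)
have e1 : f (k * l + l.-1) = (k * l + l)%N.
  have := good_odd_end dk glast => /=; rewrite !FE //; last lia.
  by rewrite addn0 => ->; rewrite low.
have [kn _] := F0_lt (fun i => good_odd_lt dk g1 (i := i))
  (fun i ik => good_odd_ltS dk g1 (i := i) (ltnW ik)) (leqnn k).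
have kl : (k * l + l.-1 < n)%N.
  have := good_odd_ltS dk glast (leqnn k); rewrite FE; last lia.
  move=> lt; apply: leq_trans lt _; rewrite -[X in (_ <= X)%N]f_last /=; apply: f_mono; lia.
have nE : n = (k.+1 * l)%N.
  rewrite mulSn; have [lt|ge] := ltnP (k * l + l.-1) n.-1; last lia.
  by have := f_gt2 lt; rewrite e1; lia.
have nE' : n = (k * l + l)%N by rewrite nE mulSn addnC.
split=> // x xn; have [xk|kx] := leqP x (k * l)%N.
  by rewrite low //; apply/esym/minn_idPl; lia.
have -> : f x = n.
  apply/eqP; rewrite eqn_leq; apply/andP; split.
    by rewrite -[X in (_ <= X)%N]f_last f_mono //; lia.
  by rewrite [X in (X <= _)%N]nE' -low // f_mono // ltnW.
by apply/esym/minn_idPr; lia.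
Qed.

End Linear.
End Combinatorics.

(** * Quotients of path algebras *)

Section LengthFiltration.
Variables (K : fieldType) (Q : quiver).
Notation PA := (path_algebra K Q).

(** Powers of the arrow ideal and of the radical are compared through this filtration, where
    membership is visible on the support. *)
Definition long_paths s (f : PA) :=
  forall p, p \in msupp (f : {malg K[qpath Q]}) -> (s <= size (walk p).2)%N.

Lemma long_paths0 s : long_paths s 0.
Proof. by move=> p; rewrite msupp0 in_fset0. Qed.

Lemma long_pathsD s f g : long_paths s f -> long_paths s g -> long_paths s (f + g).
Proof. by move=> Hf Hg p /(fsubsetP (msuppD_le _ _)); rewrite in_fsetU => /orP[/Hf|/Hg]. Qed.

Lemma long_pathsZ s c f : long_paths s f -> long_paths s (c *: f).
Proof. by move=> Hf p /(fsubsetP (msuppZ_le _ _)) /Hf. Qed.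

Lemma long_paths_sum s (I : Type) (r : seq I) (F : I -> PA) :
  (forall i, long_paths s (F i)) -> long_paths s (\sum_(i <- r) F i).
Proof.
move=> HF; elim/big_rec: _ => [|i x _ Hx]; [exact: long_paths0|exact: long_pathsD].
Qed.

Lemma long_paths_le s t f : (s <= t)%N -> long_paths t f -> long_paths s f.
Proof. by move=> st Hf p /Hf; exact: leq_trans. Qed.

Lemma long_paths_pelt s p : (s <= size (walk p).2)%N -> long_paths s (pelt K p).
Proof. by move=> sp q; rewrite msuppU oner_eq0 in_fset1 => /eqP->. Qed.

Lemma pelt_long_paths s p : long_paths s (pelt K p) -> (s <= size (walk p).2)%N.
Proof. by apply; rewrite msuppU oner_eq0 in_fset1. Qed.

Lemma long_paths_pred s f : (forall p, f@_p != 0 :> K -> (s <= size (walk p).2)%N) -> long_paths s f.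
Proof. by move=> H p; rewrite -mcoeff_neq0 => /H. Qed.

Lemma sum_pelt (f : PA) : f = \sum_(p <- msupp (f : {malg K[qpath Q]})) f@_p *: pelt K p.
Proof.
rewrite {1}[f]monalgE; apply: eq_bigr => p _.
suff -> : << f@_p *g p >> = f@_p *: << p >> :> {malg K[qpath Q]} by [].
apply/malgP => q.
etransitivity; first exact: mcoeffU.
symmetry; etransitivity; first exact: mcoeffZ.
by rewrite [X in _ * X]mcoeffU mulr_natr.
Qed.

Lemma long_pathsM s t f g : long_paths s f -> long_paths t g -> long_paths (s + t) (f * g).
Proof.
move=> Hf Hg; rewrite -[f * g]/(pa_mul f g) /pa_mul.
have sumin (r : seq (qpath Q)) (F : qpath Q -> PA) :
    (forall p, p \in r -> long_paths (s + t) (F p)) -> long_paths (s + t) (\sum_(p <- r) F p).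
  move=> HF; rewrite big_seq; elim/big_rec: _ => [|i x ir Hx]; first exact: long_paths0.
  by apply: long_pathsD => //; exact: HF.
apply: (sumin) => p pf; apply: sumin => q qg; apply: long_pathsZ; rewrite /path_mul.
have [pq|npq] := eqVneq (ptgt p) (psrc q); last by rewrite pcat_def //; exact: long_paths0.
have [r [-> rw]] := pcatE pq; apply: long_paths_pelt.
by rewrite rw /= size_cat leq_add ?Hf ?Hg.
Qed.

Lemma long_pathsMl s f g : long_paths s f -> long_paths s (f * g).
Proof. by move=> Hf; rewrite -[s]addn0; apply: long_pathsM => // p _. Qed.
Lemma long_pathsMr s f g : long_paths s g -> long_paths s (f * g).
Proof. by move=> Hf; rewrite -[s]add0n; apply: long_pathsM => // p _. Qed.

Lemma pelt_cons (p : qpath Q) a s : (walk p).2 = a :: s -> psrc p = src a /\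
  exists p' : qpath Q, [/\ psrc p' = tgt a, (walk p').2 = s & pelt K p = pelt K (parrow a) * pelt K p'].
Proof.
case: p => -[x s'] /= wp ws; rewrite /psrc /=.
have /andP[/eqP xa ws1] : (src a == x) && is_walk (tgt a) s by move: (wp); rewrite ws.
have wp' : is_walk (tgt a, s).1 (tgt a, s).2 by [].
split=> //; exists (QPath wp'); split=> //.
rewrite -[_ * _]/(pa_mul _ _) pa_mul_pelt /path_mul.
have e : ptgt (parrow a) = psrc (QPath wp') by [].
have [r [-> rw]] := pcatE e; congr pelt; apply: val_inj.
by rewrite /= rw /psrc /= ws xa.
Qed.

Lemma arrow_ideal_long f : arrow_ideal f <-> long_paths 1 f.
Proof.
split=> [|Hf I [Iid Il] Ia].
  apply; last by move=> _ [a ->]; exact: long_paths_pelt.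
  split; last by move=> r x; exact: long_pathsMr.
  split; [exact: long_paths0|by move=> x y; exact: long_pathsD|by move=> x r; exact: long_pathsMl].
have [I0 ID Ir] := Iid; rewrite (sum_pelt f) big_seq; elim/big_rec: _ => // p x pf Ix.
apply: ID => //; have -> : f@_p *: pelt K p = (f@_p *: (1 : PA) : PA) * pelt K p.
  by rewrite -[RHS]/(pa_mul _ _) -pa_scaleAl -[pa_mul _ _]/((1 : PA) * pelt K p) mul1r.
apply: Il; have := Hf p pf; case E: (walk p).2 => [//|a s] _.
by have [_ [p' [_ _ ->]]] := pelt_cons E; apply: Ir; apply: Ia; exists a.
Qed.

(** [J] is left abstract so that the statement serves the arrow ideal of any quiver and the Jacobson
    radical of a linear one. *)
Lemma ideal_pow_long (J : PA -> Prop) l f : (forall x, J x <-> long_paths 1 x) ->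
  ideal_pow J l f <-> long_paths l f.
Proof.
move=> HJ; elim: l f => [|l IH] f; first by split=> // _ p _.
rewrite /ideal_pow iterS -/(ideal_pow J l); split=> [[s [Hs ->]]|Hf].
  rewrite big_seq; elim/big_rec: _ => [|q x qs Hx]; first exact: long_paths0.
  apply: long_pathsD => //; have [J1 J2] := Hs q qs.
  by rewrite -add1n; apply: long_pathsM; [exact/HJ|exact/IH].
suff H (s : seq (qpath Q)) : {subset s <= msupp (f : {malg K[qpath Q]})} ->
    ideal_mul J (ideal_pow J l) (\sum_(p <- s) f@_p *: pelt K p).
  by rewrite (sum_pelt f); exact: H.
elim: s => [|p s IHs] sub; first by exists [::]; rewrite !big_nil.
have [|r [Hr Er]] := IHs; first by move=> q qs; apply: sub; rewrite inE qs orbT.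
have pf : p \in msupp (f : {malg K[qpath Q]}) by apply: sub; rewrite inE eqxx.
have := Hf p pf; case E: (walk p).2 => [//|a t] tl.
have [_ [p' [_ wp' pE]]] := pelt_cons E.
exists ((f@_p *: pelt K (parrow a), pelt K p') :: r); split.
  move=> q; rewrite inE => /orP[/eqP->|/Hr//]; split=> /=.
    by apply/HJ/long_pathsZ/long_paths_pelt.
  by apply/IH/long_paths_pelt; rewrite wp'; move: tl; rewrite ltnS.
rewrite !big_cons -Er pE /=; congr (_ + _).
exact: pa_scaleAl.
Qed.

End LengthFiltration.

Section OppositeScalars.
Variables (K : fieldType) (A : falgType K).
Definition opp_alg (c : K) : A^c := c%:A.
Lemma opp_alg_additive : zmod_morphism opp_alg.
Proof. by move=> x y; rewrite /opp_alg scalerBl. Qed.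
Lemma opp_alg_multiplicative : monoid_morphism opp_alg.
Proof.
split; first by rewrite /opp_alg scale1r.
by move=> x y; rewrite /opp_alg -[RHS]/((y%:A : A) * x%:A) -scalerAl mul1r scalerA mulrC.
Qed.
HB.instance Definition _ := GRing.isZmodMorphism.Build K A^c opp_alg opp_alg_additive.
HB.instance Definition _ := GRing.isMonoidMorphism.Build K A^c opp_alg opp_alg_multiplicative.
Lemma opp_algM c (x : A^c) : opp_alg c * x = c *: (x : A).
Proof. by rewrite -[LHS]/((x : A) * c%:A) -scalerAr mulr1. Qed.
Lemma opp_alg_central c (x : A^c) : opp_alg c * x = x * opp_alg c.
Proof. by rewrite opp_algM -[RHS]/((c%:A : A) * x) -scalerAl mul1r. Qed.
End OppositeScalars.

Section QuiverData.
Variables (K : fieldType) (Q : quiver) (n : nat).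
Variables (vtx : nat -> vertex Q) (arr : nat -> option (arrow Q)).
Hypothesis n_gt0 : (0 < n)%N.
Hypothesis vtx_eq : forall x y, vtx x = vtx y <-> x = y %[mod n].
Hypothesis vtx_surj : forall v, exists x, vtx x = v.
Hypothesis arr_mod : forall x y, x = y %[mod n] -> arr x = arr y.
Hypothesis arrP : forall x a, arr x = Some a <-> src a = vtx x.
Hypothesis arr_tgt : forall x a, arr x = Some a -> tgt a = vtx x.+1.
Notation PA := (path_algebra K Q).

Definition videm x : PA := pelt K (ptriv (vtx x)).
(** A missing arrow counts as 0, which lets positions run past the end of a linear quiver as if it
    were a cycle. *)
Definition arrow_elt x : PA := oapp (fun a => pelt K (parrow a)) 0 (arr x).
Fixpoint path_elt x t : PA := if t is t'.+1 then path_elt x t' * arrow_elt (x + t') else videm x.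

Lemma videm_mod x y : x = y %[mod n] -> videm x = videm y.
Proof. by move/vtx_eq; rewrite /videm => ->. Qed.

Lemma path_elt_mod x y t : x = y %[mod n] -> path_elt x t = path_elt y t.
Proof.
move=> xy; elim: t => [|t IH] /=; first exact: videm_mod.
by rewrite IH /arrow_elt (arr_mod (y := y + t)) // -modnDml xy modnDml.
Qed.

Lemma videm_pelt x p : videm x * pelt K p = if vtx x == psrc p then pelt K p else 0.
Proof. by rewrite -[LHS]/(pa_mul _ _) pa_mul_pelt /path_mul pcat1p; case: eqP. Qed.

Lemma pelt_videm x p : pelt K p * videm x = if vtx x == ptgt p then pelt K p else 0.
Proof. by rewrite -[LHS]/(pa_mul _ _) pa_mul_pelt /path_mul pcatp1; case: eqP. Qed.

Lemma videm_arrow x : videm x * arrow_elt x = arrow_elt x.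
Proof.
rewrite /arrow_elt; case E: (arr x) => [a|] /=; last by rewrite mulr0.
by rewrite videm_pelt -[psrc _]/(src a) (proj1 (arrP x a) E) eqxx.
Qed.

Lemma arrow_videm x : arrow_elt x * videm x.+1 = arrow_elt x.
Proof.
rewrite /arrow_elt; case E: (arr x) => [a|] /=; last by rewrite mul0r.
by rewrite pelt_videm -[ptgt _]/(tgt a) (arr_tgt E) eqxx.
Qed.

Lemma videm_path x t : videm x * path_elt x t = path_elt x t.
Proof.
elim: t => [|t IH] /=; last by rewrite mulrA IH.
by rewrite videm_pelt eqxx.
Qed.

Lemma path_videm x t : path_elt x t * videm (x + t) = path_elt x t.
Proof.
case: t => [|t] /=; first by rewrite addn0 videm_pelt eqxx.
by rewrite addnS -mulrA arrow_videm.
Qed.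

Lemma path_eltD x s t : path_elt x s * path_elt (x + s) t = path_elt x (s + t).
Proof.
elim: t => [|t IH] /=; first by rewrite addn0 path_videm.
by rewrite addnS /= mulrA IH addnA.
Qed.

Lemma path_elt_orth x s y t : y <> x + s %[mod n] -> path_elt x s * path_elt y t = 0.
Proof.
move=> ne; rewrite -path_videm -(videm_path y t) -mulrA (mulrA (videm _)) videm_pelt.
rewrite -[psrc _]/(vtx y) (_ : (_ == _) = false) ?mul0r ?mulr0 //.
by apply/negP => /eqP/vtx_eq e; apply: ne.
Qed.

Lemma sum_videm : \sum_(x < n) videm x = 1.
Proof.
rewrite -[RHS]/(\sum_(v : vertex Q) pelt K (ptriv v)) /videm.
rewrite [RHS](reindex (fun x : 'I_n => vtx x)) //.
apply: onW_bij; apply: inj_card_bij => [x y /vtx_eq|].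
  by rewrite !modn_small // => /val_inj.
rewrite card_ord.
pose h v : 'I_n := Ordinal (ltn_pmod (proj1_sig (constructive_indefinite_description _ (vtx_surj v))) n_gt0).
rewrite -[X in (_ <= X)%N](card_ord n); apply: (leq_card h) => v1 v2 /(congr1 val) /=.
case: constructive_indefinite_description => x1 /= <-.
case: constructive_indefinite_description => x2 /= <-.
by move=> e; apply/vtx_eq.
Qed.

Lemma pelt_path p x : psrc p = vtx x -> pelt K p = path_elt x (size (walk p).2).
Proof.
elim: {p}(size _) {-2}p x (erefl (size (walk p).2)) => [|t IH] p x.
  case: p => -[v s] /= wp; rewrite /psrc /= => sz vx.
  by rewrite sz /= /videm; congr pelt; apply: val_inj; rewrite /= (size0nil sz) vx.
case E: (walk p).2 => [|a s] szE px; first by discriminate szE.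
case: szE => st.
have [pa [p' [pt ws ->]]] := pelt_cons K E.
have ax : arr x = Some a by apply/arrP; rewrite -pa.
rewrite (IH p' x.+1); first last.
- by rewrite pt (arr_tgt ax).
- by rewrite ws.
have -> : pelt K (parrow a) = path_elt x 1.
  by rewrite /= addn0 videm_arrow /arrow_elt ax.
by rewrite ws -[x.+1]addn1 path_eltD.
Qed.

Lemma path_elt_long x t : long_paths t (path_elt x t).
Proof.
elim: t => [|t IH] /=; first by move=> p _.
rewrite -addn1; apply: long_pathsM => //; rewrite /arrow_elt; case: (arr _) => [a|] /=.
  exact: long_paths_pelt.
exact: long_paths0.
Qed.

Variables (A : falgType K) (phi : {rmorphism PA -> A}) (I : PA -> Prop).
Hypothesis phi_scal : scalable phi.
Hypothesis phi_surj : forall a, exists x, phi x = a.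
Hypothesis phi_ker : forall x, phi x = 0 <-> I x.
Hypothesis I_long : forall x, I x -> long_paths 2 x.
Hypothesis I_pow : exists N, forall x, long_paths N x -> I x.

(** The value lies in the opposite algebra, so in a product the path followed first is the right
    factor. *)
Definition qw x t : A^c := phi (path_elt x t).

Lemma qw_zero x : exists t, qw x t == 0.
Proof.
have [N HN] := I_pow; exists N; apply/eqP; apply/phi_ker; apply: HN; exact: path_elt_long.
Qed.
Definition qell x := ex_minn (qw_zero x).

Lemma qwM a s t : qw (a + s) t * qw a s = qw a (s + t).
Proof. by rewrite -[LHS]/((phi _ : A) * phi _) -rmorphM path_eltD. Qed.

Lemma qw_eq0 x t : qw x t = 0 <-> (qell x <= t)%N.
Proof.
rewrite /qell; case: ex_minnP => m /eqP wm min; split=> [/eqP/min//|mt].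
by rewrite -(subnKC mt) -qwM wm mulr0.
Qed.

Lemma qell_gt0 x : (0 < qell x)%N.
Proof.
rewrite lt0n; apply/eqP => e; have : qw x 0 = 0 by apply/qw_eq0; rewrite e.
by move=> /phi_ker /I_long /pelt_long_paths.
Qed.

Lemma qell_ge2 x : arr x -> (2 <= qell x)%N.
Proof.
move=> ax; rewrite leqNgt ltnS; apply/negP => e; have : qw x 1 = 0 by apply/qw_eq0.
move=> /phi_ker; rewrite /= addn0 videm_arrow /arrow_elt; case: (arr x) ax => //= a _.
by move/I_long/pelt_long_paths.
Qed.

Lemma qwM0 a s b t : b <> a + s %[mod n] -> qw b t * qw a s = 0.
Proof.
by move=> ne; rewrite -[LHS]/((phi _ : A) * phi _) -rmorphM path_elt_orth ?rmorph0.
Qed.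

Lemma qw_mod a b t : a = b %[mod n] -> qw a t = qw b t.
Proof. by move=> ab; rewrite /qw (path_elt_mod t ab). Qed.

Lemma qw_one : \sum_(a < n) qw a 0 = 1.
Proof. by rewrite -[RHS](rmorph1 phi) -sum_videm rmorph_sum. Qed.

Lemma qw_span (r : A^c) : exists c : nat -> nat -> K,
  r = \sum_(a < n) \sum_(t < qell a) opp_alg A (c a t) * qw a t.
Proof.
have [y <-] := phi_surj r; elim/(@pa_ind K Q): y => [|f g [c Hc] [d Hd]|b f [c Hc]|p].
- exists (fun _ _ => 0); rewrite rmorph0 big1 // => a _; rewrite big1 // => t _.
  by rewrite rmorph0 mul0r.
- exists (fun a t => c a t + d a t); rewrite rmorphD Hc Hd -big_split; apply: eq_bigr => a _.
  by rewrite -big_split; apply: eq_bigr => t _; rewrite rmorphD mulrDl.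
- exists (fun a t => b * c a t); rewrite phi_scal Hc -[LHS](opp_algM b) mulr_sumr.
  apply: eq_bigr => a _; rewrite mulr_sumr; apply: eq_bigr => t _.
  by rewrite rmorphM mulrA.
have [x Hx] := vtx_surj (psrc p); rewrite (pelt_path (esym Hx)).
set t := size _; have lx : (x %% n < n)%N by rewrite ltn_mod.
rewrite -[phi _]/(qw x t) -(qw_mod t (a := (x %% n)%N)) ?modn_mod //.
exists (fun a u => ((a == x %% n)%N && (u == t))%:R).
rewrite (bigD1 (Ordinal lx)) //= [X in _ = _ + X]big1 ?addr0; last first.
  move=> a /negPf ax; rewrite big1 // => u _.
  by rewrite -val_eqE /= in ax; rewrite ax rmorph0 mul0r.
have [tl|lt] := ltnP t (qell (x %% n)).
  rewrite (bigD1 (Ordinal tl)) //= !eqxx rmorph1 mul1r big1 ?addr0 // => u /negPf.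
  by rewrite -val_eqE /= => ->; rewrite ?andbF rmorph0 mul0r.
rewrite (proj2 (qw_eq0 _ _) lt) big1 // => u _.
have -> : (nat_of_ord u == t) = false by rewrite (ltn_eqF (leq_trans (ltn_ord u) lt)).
by rewrite ?andbF rmorph0 mul0r.
Qed.

Definition quiver_data : nakData K A^c := @NakData K A^c (opp_alg A) (@opp_alg_central K A)
  n n_gt0 qw qell qwM qwM0 qw_mod qw_one qw_span qw_eq0 qell_gt0.

End QuiverData.

Section Cyclic.
Variable n : nat.
Hypothesis n_gt0 : (0 < n)%N.

Definition cyc_vtx x : vertex (cyclic_quiver n) := Ordinal (ltn_pmod x n_gt0).
Definition cyc_arr x : option (arrow (cyclic_quiver n)) := Some (cyc_vtx x).

Lemma cyc_vtx_eq x y : cyc_vtx x = cyc_vtx y <-> x = y %[mod n].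
Proof. by split=> [/(congr1 val)|e]; [|apply: val_inj]. Qed.
Lemma cyc_vtx_surj v : exists x, cyc_vtx x = v.
Proof. by exists (v : 'I_n); apply: val_inj; rewrite /= modn_small. Qed.
Lemma cyc_arr_mod x y : x = y %[mod n] -> cyc_arr x = cyc_arr y.
Proof. by move=> e; congr Some; apply/cyc_vtx_eq. Qed.
Lemma cyc_arrP x a : cyc_arr x = Some a <-> src a = cyc_vtx x.
Proof. by split=> [[<-]|e] //; rewrite /cyc_arr -e. Qed.
Lemma cyc_arr_tgt x a : cyc_arr x = Some a -> tgt a = cyc_vtx x.+1.
Proof. by case=> <-; apply: val_inj; rewrite /= -[(x %% n).+1]addn1 modnDml addn1. Qed.

End Cyclic.

Section LinearQuiver.
Variables (K : fieldType) (m : nat).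
Hypothesis m_gt0 : (0 < m)%N.
Notation Q := (linear_quiver m).
Notation PA := (path_algebra K Q).

Lemma lin_vtx_subproof x : (m.-1 - x %% m < m)%N.
Proof. by lia. Qed.
(** Arrows lower the index of a vertex, whereas positions grow along paths; hence the reversal. *)
Definition lin_vtx x : vertex Q := Ordinal (lin_vtx_subproof x).
Definition lin_arr x : option (arrow Q) := insub (lin_vtx x : 'I_m).

Lemma lin_vtx_eq x y : lin_vtx x = lin_vtx y <-> x = y %[mod m].
Proof.
split=> [/(congr1 val) /= e|e]; last by apply: val_inj; rewrite /= e.
by have := ltn_pmod x m_gt0; have := ltn_pmod y m_gt0; move: e; clear; lia.
Qed.
Lemma lin_vtx_surj v : exists x, lin_vtx x = v.
Proof.
exists (m.-1 - (v : 'I_m))%N; apply: val_inj; rewrite /= modn_small.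
  by have := ltn_ord (v : 'I_m); lia.
by lia.
Qed.
Lemma lin_arr_mod x y : x = y %[mod m] -> lin_arr x = lin_arr y.
Proof. by move/lin_vtx_eq => e; rewrite /lin_arr e. Qed.
Lemma lin_arrP x a : lin_arr x = Some a <-> src a = lin_vtx x.
Proof.
rewrite /lin_arr; split=> [|e].
  by case: insubP => // u _ <- [<-].
by rewrite -e; exact: valK.
Qed.
Lemma lin_arr_tgt x a : lin_arr x = Some a -> tgt a = lin_vtx x.+1.
Proof.
move/lin_arrP => e; apply: val_inj; rewrite /= -[val a]/(src a) e /=.
have := valP a; rewrite -[val a]/(src a) e /= => pos.
have := ltn_pmod x m_gt0 => lt; rewrite -[x.+1]addn1 -modnDml addn1.
by rewrite (@modn_small (x %% m).+1); move: pos lt; clear; lia.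
Qed.

Lemma lin_arr_some x : lin_arr x = (x %% m < m.-1)%N :> bool.
Proof.
rewrite /lin_arr; case: insubP => [u /= pos _|/=]; first by move: pos; clear; lia.
by have := ltn_pmod x m_gt0; clear; lia.
Qed.

Lemma linear_walk_size (x : vertex Q) s : is_walk x s -> (size s <= (x : 'I_m))%N.
Proof.
elim: s x => //= a s IH x /andP[/eqP <- /IH]; have := valP a.
by rewrite /lin_tgt /=; lia.
Qed.

Lemma long_paths_linear0 (f : PA) : long_paths m f -> f = 0.
Proof.
move=> Hf; apply/malgP => p; rewrite mcoeff0; apply/eqP/negPn/negP => nz.
have := Hf p; rewrite -mcoeff_neq0 => /(_ nz); have := linear_walk_size (walkP p).
by have := ltn_ord (psrc p : 'I_m); rewrite /psrc; lia.
Qed.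

Notation pe := (path_elt K lin_vtx lin_arr).

Lemma lin_path_elt_pelt x t : (x < m)%N -> (x + t < m)%N -> exists p : qpath Q,
  size (walk p).2 = t /\ pe x t = pelt K p.
Proof.
move=> xm xt; elim: t x xm xt => [|t IH] x xm xt.
  by exists (ptriv (lin_vtx x)).
have [p [ps pE]] := IH x.+1 ltac:(lia) ltac:(lia).
have [a Ea] : exists a, lin_arr x = Some a.
  have := lin_arr_some x; rewrite modn_small //.
  have -> : (x < m.-1)%N by lia.
  by case: (lin_arr x) => // a _; exists a.
have sp : psrc p = lin_vtx x.+1.
  have [y Hy] := lin_vtx_surj (psrc p).
  have := videm_path K lin_vtx lin_arr x.+1 t; rewrite pE videm_pelt; case: eqP => // _ /eqP.
  by rewrite eq_sym -[pelt K p == 0]/(<< p >> == 0 :> {malg _[_]}) monalgU_eq0 oner_eq0.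
have e : ptgt (parrow a) = psrc p by rewrite sp -(lin_arr_tgt Ea).
have [r [Er rw]] := pcatE e.
exists r; rewrite rw; split; first by rewrite /= ps.
have -> : pe x t.+1 = pe x 1 * pe x.+1 t.
  by rewrite -[x.+1]addn1 path_eltD; [|exact: lin_arr_tgt].
rewrite pE /= addn0 videm_arrow; last exact: lin_arrP.
rewrite /arrow_elt Ea.
rewrite -[LHS]/(pa_mul (pelt K (parrow a)) (pelt K p)).
rewrite pa_mul_pelt.
rewrite /path_mul Er.
exact: erefl.
Qed.

Lemma lin_path_elt0 x t : (x < m)%N -> (m <= x + t)%N -> pe x t = 0.
Proof.
move=> xm mt; have -> : t = ((m - x.+1) + (t - (m - x)).+1)%N by lia.
rewrite -path_eltD; [|exact: lin_arr_tgt].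
have -> : (x + (m - x.+1))%N = m.-1 by lia.
suff -> : pe m.-1 (t - (m - x)).+1 = 0 by rewrite mulr0.
rewrite -add1n -path_eltD; [|exact: lin_arr_tgt].
rewrite /= addn0 {1}/arrow_elt; have := lin_arr_some m.-1.
rewrite modn_small ?ltnn; last by lia.
by case: (lin_arr m.-1) => // _; rewrite /= mulr0 mul0r.
Qed.

End LinearQuiver.

(** * The Jacobson radical of the path algebra of a linear quiver *)

Section TrivialCoefficient.
Variables (K : fieldType) (Q : quiver) (x : vertex Q).
Notation PA := (path_algebra K Q).

(** The character of KQ given by the simple module at [x]; its kernel is a maximal right ideal and
    bounds the radical from above. *)
Definition triv_coef (f : PA) : K := (f : {malg K[qpath Q]})@_(ptriv x).

Lemma triv_coefD f g : triv_coef (f + g) = triv_coef f + triv_coef g.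
Proof. exact: mcoeffD. Qed.
Lemma triv_coefZ c f : triv_coef (c *: f) = c * triv_coef f.
Proof. exact: mcoeffZ. Qed.
Lemma triv_coef0 : triv_coef 0 = 0.
Proof. exact: mcoeff0. Qed.
Lemma triv_coef_pelt p : triv_coef (pelt K p) = (p == ptriv x)%:R.
Proof. exact: mcoeffU. Qed.

Lemma triv_coef_mul p q : triv_coef (path_mul K p q) = (p == ptriv x)%:R * (q == ptriv x)%:R.
Proof.
have trivP r : (r == ptriv x) = (psrc r == x) && ((walk r).2 == [::]).
  apply/eqP/andP => [->|[]]; first by rewrite /psrc /= !eqxx.
  case: r => -[y s] wr /eqP; rewrite /psrc /= => yx /eqP s0.
  by apply: val_inj; rewrite /= yx s0.
rewrite /path_mul; have [pq|npq] := eqVneq (ptgt p) (psrc q).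
  have [r [-> rw]] := pcatE pq; rewrite /= triv_coef_pelt -natrM mulnb !trivP.
  congr (nat_of_bool _)%:R; rewrite {1}/psrc rw /= -[LHS]/((psrc p == x) && (_ ++ _ == [::])) -pq.
  rewrite -size_eq0 size_cat addn_eq0 !size_eq0.
  rewrite andbACA; case: eqP => //= px; case: eqP => //= p0; case: eqP => _; rewrite /= ?andbF //.
  by rewrite /ptgt p0 /= -[_.1]/(psrc p) px eqxx.
rewrite (pcat_def npq) triv_coef0 -natrM mulnb.
case: andP => // -[/eqP ep /eqP eq]; case/eqP: npq.
by rewrite ep eq.
Qed.

Lemma triv_coefM f g : triv_coef (f * g) = triv_coef f * triv_coef g.
Proof.
elim/(@pa_ind K Q): f => [|f1 f2 I1 I2|c f I|p].
- by rewrite mul0r triv_coef0 mul0r.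
- etransitivity; first exact: (congr1 triv_coef (mulrDl f1 f2 g)).
  etransitivity; first exact: triv_coefD.
  etransitivity; first exact: (congr2 +%R I1 I2).
  symmetry; etransitivity; first exact: (congr1 ( *%R^~ (triv_coef g)) (triv_coefD f1 f2)).
  exact: mulrDl.
- etransitivity; first exact: (congr1 triv_coef (esym (pa_scaleAl c f g))).
  etransitivity; first exact: triv_coefZ.
  etransitivity; first exact: (congr1 ( *%R c) I).
  etransitivity; first exact: mulrA.
  symmetry; exact: (congr1 ( *%R^~ (triv_coef g)) (triv_coefZ c f)).
elim/(@pa_ind K Q): g => [|f1 f2 I1 I2|c f I|q].
- by rewrite mulr0 triv_coef0 mulr0.
- etransitivity; first exact: (congr1 triv_coef (mulrDr (pelt K p) f1 f2)).
  etransitivity; first exact: triv_coefD.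
  etransitivity; first exact: (congr2 +%R I1 I2).
  symmetry; etransitivity; first exact: (congr1 ( *%R (triv_coef (pelt K p))) (triv_coefD f1 f2)).
  exact: mulrDr.
- etransitivity; first exact: (congr1 triv_coef (esym (pa_scaleAr c (pelt K p) f))).
  etransitivity; first exact: triv_coefZ.
  etransitivity; first exact: (congr1 ( *%R c) I).
  etransitivity; first exact: mulrCA.
  symmetry; exact: (congr1 ( *%R (triv_coef (pelt K p))) (triv_coefZ c f)).
etransitivity; first exact: (congr1 triv_coef (pa_mul_pelt K p q)).
etransitivity; first exact: triv_coef_mul.
symmetry; exact: (congr2 *%R (triv_coef_pelt p) (triv_coef_pelt q)).
Qed.

Lemma triv_coef1 : triv_coef 1 = 1.
Proof.
rewrite -[1 in LHS]/(\sum_(v : vertex Q) pelt K (ptriv v)).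
rewrite (big_morph _ triv_coefD triv_coef0) (bigD1 x) //= triv_coef_pelt eqxx.
rewrite big1 ?addr0 // => v vx; rewrite triv_coef_pelt (_ : (_ == _) = false) //.
by apply/negP => /eqP/(congr1 (@psrc Q)) e; case/eqP: vx.
Qed.

Lemma maximal_triv_coef : maximal_right_ideal (fun f => triv_coef f = 0).
Proof.
split.
- split; first exact: triv_coef0.
    by move=> f g f0 g0; rewrite triv_coefD f0 g0 addr0.
  by move=> f g f0; rewrite triv_coefM f0 mul0r.
- by move=> /(_ 1); rewrite triv_coef1 => /eqP; rewrite oner_eq0.
move=> J [J0 JD Jr] sub; have [|nJ] := classic (forall y, J y -> triv_coef y = 0); first by left.
right; have [g ng] := not_all_ex_not _ _ nJ; have [Jg /eqP g0] := imply_to_and _ _ ng.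
suff J1 : J 1 by move=> y; rewrite -[y]mul1r; exact: Jr.
pose h : PA := g * ((triv_coef g)^-1 *: (1 : PA)).
rewrite -[1](subrK h) addrC; apply: JD; first exact: Jr.
apply: sub; have e : triv_coef h = 1 by rewrite triv_coefM triv_coefZ triv_coef1 mulr1 divff.
apply: (addIr (triv_coef h)).
by rewrite -triv_coefD subrK triv_coef1 e add0r.
Qed.
End TrivialCoefficient.

Section LinearRadical.
Variables (K : fieldType) (m : nat).
Hypothesis m_gt0 : (0 < m)%N.
Notation Q := (linear_quiver m).
Notation PA := (path_algebra K Q).

(** The characters [triv_coef] exclude trivial paths from the support of a radical element.
    Conversely, if f has no trivial path and lies outside a maximal right ideal J, then 1 = i + f r
    with i in J; as a linear quiver has no path of length m, f r is nilpotent and i is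
    invertible. *)
Lemma jacobson_long (f : PA) : jacobson f <-> long_paths 1 f.
Proof.
split=> [Jf|Lf J [[J0 JD Jr] Jne Jmax]].
  apply: long_paths_pred => p; rewrite lt0n; apply: contraNneq => s0.
  have -> : p = ptriv (psrc p).
    by case: p s0 => -[y s] wp /= sz; apply: val_inj; rewrite /psrc /= (size0nil sz).
  by apply/eqP; exact: (Jf _ (maximal_triv_coef K (psrc p))).
apply: NNPP => nf.
have [||allJ|allT] := Jmax (fun y => exists i r, J i /\ y = i + f * r).
- split.
  + by exists 0, 0; split; rewrite // mulr0 addr0.
  + move=> _ _ [i [r [Ji ->]]] [i' [r' [Ji' ->]]]; exists (i + i'), (r + r').
    by split; [exact: JD|rewrite mulrDr addrACA].
  + move=> _ s [i [r [Ji ->]]]; exists (i * s), (r * s).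
    by split; [exact: Jr|rewrite mulrDl mulrA].
- by move=> i Ji; exists i, 0; split; rewrite // mulr0 addr0.
- by apply: nf; apply: allJ; exists 0, 1; split; rewrite // mulr1 add0r.
have [i [r [Ji e1]]] := allT 1.
have Lu : long_paths 1 (f * r) by exact: long_pathsMl.
have Lum j : long_paths j ((f * r) ^+ j).
  elim: j => [|j IH]; first by move=> p _.
  by rewrite exprS -add1n; exact: long_pathsM.
have um : (f * r) ^+ m = 0 by apply: long_paths_linear0.
apply: Jne => y; rewrite -[y]mul1r; apply: (Jr).
have ii : i = 1 - f * r by rewrite e1 addrK.
have := subrX1 (f * r) m; rewrite um sub0r => /(congr1 -%R).
by rewrite opprK -mulNr opprB -ii => ->; exact: Jr.
Qed.

Lemma ideal_pow_jacobson l (f : PA) : ideal_pow (@jacobson _) l f <-> long_paths l f.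
Proof. by apply: ideal_pow_long; exact: jacobson_long. Qed.

End LinearRadical.

(** * Interval data of a Nakayama algebra *)

Section AdmissibleIdeals.
Variables (K : fieldType) (Q : quiver) (I : path_algebra K Q -> Prop).
Hypothesis adm : admissible I.

Lemma admissible_long x : I x -> long_paths 2 x.
Proof.
by case: adm => _ H _ /H Hx; exact: (proj1 (ideal_pow_long 2 x (@arrow_ideal_long K Q)) Hx).
Qed.

Lemma long_admissible : exists N, forall x, long_paths N x -> I x.
Proof.
case: adm => _ _ [N _ H]; exists N => x Lx; apply: H.
exact: (proj2 (ideal_pow_long N x (@arrow_ideal_long K Q)) Lx).
Qed.
End AdmissibleIdeals.

Lemma sum_delta (K : fieldType) (V : lmodType K) (F : nat -> nat -> V) m x t :
  (x < m)%N -> (t < m)%N ->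
  \sum_(a < m) \sum_(u < m) ((a == x :> nat) && (u == t :> nat))%:R *: F a u = F x t.
Proof.
move=> xm tm; rewrite (bigD1 (Ordinal xm)) //= (bigD1 (Ordinal tm)) //= !eqxx /= scale1r.
rewrite [X in _ + X + _]big1 ?addr0; last first.
  by move=> u /negPf; rewrite -val_eqE /= => ->; rewrite ?andbF scale0r.
rewrite big1 ?addr0 // => a /negPf; rewrite -val_eqE /= => ax.
by rewrite big1 // => u _; rewrite ax scale0r.
Qed.

Section DataExists.
Variables (K : fieldType) (A : falgType K).

Definition standard (D : nakData K A^c) := forall c, nd_k D c = opp_alg A c.

Lemma cyclic_data n I : (0 < n)%N -> admissible I -> @iso_quotient K (cyclic_quiver n) I A ->
  exists D : nakData K A^c, standard D /\ forall x, (x.+2 <= endp D x)%N.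
Proof.
move=> n0 adm [phi [phi_scal phi_surj phi_ker]].
exists (quiver_data n0 (cyc_vtx_eq n0) (cyc_vtx_surj n0) (@cyc_arr_mod n n0) (@cyc_arrP n n0)
  (@cyc_arr_tgt n n0) phi_scal phi_surj phi_ker (admissible_long adm) (long_admissible adm)).
split=> // x; rewrite /endp /= -addn2 leq_add2l.
by apply: qell_ge2; [exact: cyc_arrP|exact: cyc_arr_tgt|exact: admissible_long|].
Qed.

Section Linear.
Variables (m : nat) (I : path_algebra K (linear_quiver m) -> Prop).
Hypothesis m_gt0 : (0 < m)%N.
Hypothesis I_long : forall x, I x -> long_paths 2 x.
Hypothesis I_pow : exists N, forall x, long_paths N x -> I x.
Variable phi : {rmorphism path_algebra K (linear_quiver m) -> A}.
Hypothesis phi_scal : scalable phi.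
Hypothesis phi_surj : forall a, exists x, phi x = a.
Hypothesis phi_ker : forall x, phi x = 0 <-> I x.
Notation pe := (path_elt K (lin_vtx m_gt0) (lin_arr m_gt0)).

Lemma linear_data : exists D : nakData K A^c, [/\ standard D, nd_n D = m,
  forall x t, nd_w D x t = phi (pe x t),
  forall x, (x < m.-1)%N -> (x.+2 <= endp D x)%N & endp D m.-1 = m].
Proof.
exists (quiver_data m_gt0 (lin_vtx_eq m_gt0) (lin_vtx_surj m_gt0) (@lin_arr_mod m m_gt0)
  (@lin_arrP m m_gt0) (@lin_arr_tgt m m_gt0) phi_scal phi_surj phi_ker I_long I_pow).
split=> // [x xm|]; rewrite /endp /=.
  rewrite -addn2 leq_add2l; apply: qell_ge2; [exact: lin_arrP|exact: lin_arr_tgt|by []|].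
  by rewrite lin_arr_some modn_small //; lia.
have le1 : (qell (lin_vtx m_gt0) (lin_arr m_gt0) phi_ker I_pow m.-1 <= 1)%N.
  apply/(qw_eq0 (@lin_arr_tgt m m_gt0)); rewrite /qw lin_path_elt0 ?rmorph0 //; lia.
have := qell_gt0 (@lin_arr_tgt m m_gt0) phi_ker I_long I_pow m.-1; lia.
Qed.

Lemma linear_span (y : path_algebra K (linear_quiver m)) : exists c : nat -> nat -> K,
  y = \sum_(x < m) \sum_(t < m) c x t *: pe x t.
Proof.
elim/(@pa_ind K (linear_quiver m)): y => [|f g [c Hc] [d Hd]|b f [c Hc]|p].
- exists (fun _ _ => 0); rewrite big1 // => a _; rewrite big1 // => t _.
  by rewrite scale0r.
- exists (fun a t => c a t + d a t); rewrite {1}Hc {1}Hd -big_split; apply: eq_bigr => a _.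
  by rewrite -big_split; apply: eq_bigr => t _; rewrite scalerDl.
- exists (fun a t => b * c a t); rewrite {1}Hc scaler_sumr; apply: eq_bigr => a _.
  by rewrite scaler_sumr; apply: eq_bigr => t _; rewrite scalerA.
pose x := (m.-1 - (psrc p : 'I_m))%N; have xm : (x < m)%N by rewrite /x; lia.
have xv : psrc p = lin_vtx m_gt0 x.
  apply: val_inj; rewrite /= modn_small // /x.
  by have := ltn_ord (psrc p : 'I_m); clear; lia.
have := linear_walk_size m_gt0 (walkP p); rewrite -/(psrc p); set t := size _ => tm.
have tm' : (t < m)%N by have := ltn_ord (psrc p : 'I_m); lia.
exists (fun a u => ((a == x) && (u == t))%:R).
etransitivity; last exact: (esym (sum_delta (fun a u => pe a u) xm tm')).
by apply: pelt_path xv; [exact: lin_arrP|exact: lin_arr_tgt].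
Qed.

(** The endpoints determine the algebra: min(x + l, m) means that exactly the paths of length less
    than l survive. Their images are independent by [reg_ibasis], so nothing else lies in the
    kernel. *)
Lemma linear_kernel (D : nakData K A^c) l : standard D -> nd_n D = m -> (0 < l)%N ->
    (forall x t, nd_w D x t = phi (pe x t)) ->
    (forall x, (x < m)%N -> endp D x = minn (x + l) m) ->
  forall y, phi y = 0 <-> long_paths l y.
Proof.
move=> std nm l0 wE eE y.
have ellE x : (x < m)%N -> nd_ell D x = minn l (m - x).
  by move=> xm; have := eE x xm; rewrite /endp; lia.
split=> [y0|Ly]; last first.
  rewrite (sum_pelt y) rmorph_sum big_seq big1 // => p py.
  rewrite phi_scal; have [x' Hx'] := lin_vtx_surj m_gt0 (psrc p).
  have Hx : psrc p = lin_vtx m_gt0 (x' %% m) by rewrite -Hx'; apply/lin_vtx_eq; rewrite modn_mod.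
  rewrite (pelt_path K (@lin_arrP m m_gt0) (@lin_arr_tgt m m_gt0) Hx) -wE.
  rewrite [nd_w _ _ _](proj2 (nd_w_eq0 D _ _)) ?scaler0 // ellE ?ltn_mod //.
  by have := Ly p py; lia.
have [c yE] := linear_span y.
suff c0 x t : (x < m)%N -> (t < m)%N -> (t < nd_ell D x)%N -> c x t = 0.
  rewrite yE; apply: long_paths_sum => x; apply: long_paths_sum => t.
  have [tl|lt] := ltnP t (nd_ell D x).
    by rewrite c0 // scale0r; exact: long_paths0.
  rewrite ellE // in lt; have [lt'|tl] := leqP l t.
    by apply: long_pathsZ; apply: long_paths_le lt' _; exact: path_elt_long.
  rewrite lin_path_elt0 //; last by lia.
  by rewrite scaler0; exact: long_paths0.
move=> xm tm tl.
pose c' (a : 'I_(nd_n D)) (u : nat) := if (u < m)%N then c a u else 0.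
have xn : (x < nd_n D)%N by rewrite nm.
have : c' (Ordinal xn) t = 0.
  apply: (ib_free (reg_ibasis D)) => //; rewrite -[RHS]y0 yE rmorph_sum.
  have -> : \sum_(i < m) phi (\sum_(t < m) c i t *: pe i t) =
      \sum_(i < nd_n D) phi (\sum_(t < m) c i t *: pe i t) by rewrite nm.
  apply: eq_bigr => a _; have am : (a < m)%N by rewrite -nm.
  have le : (nd_ell D a <= m)%N by rewrite ellE //; lia.
  rewrite rmorph_sum.
  transitivity (\sum_(u < nd_ell D a) (fun u => c' a u *: phi (pe a u)) u).
    apply: eq_bigr => u _; rewrite std -[_ *: _]/((_ : A^c) * (_ * _)) w_idem opp_algM.
    by rewrite wE.
  rewrite (big_ord_widen _ (fun u => c' a u *: phi (pe a u)) le) big_mkcond.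
  apply: eq_bigr => u _; rewrite /c' ltn_ord phi_scal; case: ltnP => // lu.
  by rewrite -wE (proj2 (nd_w_eq0 D _ _)) ?scaler0.
by rewrite /c' tm.
Qed.
End Linear.

End DataExists.

(** * Vanishing of Ext between intervals *)

Lemma eq_mod_shift n x y : x = y %[mod n] -> exists q q', (x + n * q = y + n * q')%N.
Proof.
move=> e; exists (y %/ n)%N, (x %/ n)%N; rewrite ![(n * _)%N]mulnC.
rewrite {1}(divn_eq x n) {2}(divn_eq y n) e.
by move: (_ * _)%N (_ * _)%N (_ %% _)%N => a b c; lia.
Qed.

Section Syzygies.
Variables (K : fieldType) (R : pzRingType) (D : nakData K R).
Notation n := (nd_n D).
Notation ell := (nd_ell D).
Notation ep := (endp D).
Notation syz := (syz D).
Implicit Types (M N : lmodType R).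

(** An empty interval encodes the zero module and stays empty under [syz_step]. *)
Definition alive (s : nat * nat) := (s.1 < s.2)%N.

Lemma endp_shift x q : ep (x + n * q) = (ep x + n * q)%N.
Proof. by elim: q => [|q IH]; rewrite ?muln0 ?addn0 // mulnS addnCA addnC endp_addn IH; lia. Qed.

Lemma alive_pred i x y : alive (syz i.+1 x y) -> alive (syz i x y).
Proof. by rewrite syzS /alive /syz_step; case: ifP => //=; rewrite ltnn. Qed.

Lemma alive_le i j x y : (j <= i)%N -> alive (syz i x y) -> alive (syz j x y).
Proof. by move=> /subnKC <-; elim: (i - j)%N => [|m IH]; rewrite ?addn0 ?addnS // => /alive_pred. Qed.

Lemma syz_aliveS i x y : alive (syz i x y) ->
  syz i.+1 x y = ((syz i x y).2, ep (syz i x y).1).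
Proof. by rewrite /alive syzS /syz_step => ->. Qed.

Lemma syz_shift i x y q : syz i (x + n * q) (y + n * q) =
  ((syz i x y).1 + n * q, (syz i x y).2 + n * q)%N.
Proof.
elim: i => [//|i IH]; rewrite !syzS IH /syz_step /= ltn_add2r.
by case: ifP; rewrite ?endp_shift.
Qed.

Lemma alive_shift i x y q : alive (syz i (x + n * q) (y + n * q)) = alive (syz i x y).
Proof. by rewrite syz_shift /alive /= ltn_add2r. Qed.

Lemma ext_pos_shift x y q c l : ext_pos D (x + n * q) (y + n * q) c l <-> ext_pos D x y c l.
Proof.
have e : (y + n * q = y %[mod n])%N by rewrite addnC mulnC modnMDl.
have e1 : (ep (x + n * q) - (y + n * q) = ep x - y)%N by rewrite endp_shift subnDr.
have e2 : (y + n * q - (x + n * q) = y - x)%N by rewrite subnDr.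
by split=> -[z [zy cz zs zx]]; exists z; split; move: zy zs zx; rewrite ?e ?e1 ?e2.
Qed.

Section Basis.
Variables (M : lmodType R) (I : finType) (a L : I -> nat) (v : I -> M).
Hypothesis ib : ibasis D a L v.

Lemma Ext_zero_ibasis N (J : finType) (c L' : J -> nat) (u : J -> N) i : ibasis D c L' u ->
  Ext_zero i.+1 M N <-> forall j l, ~ ext_pos D (syz i (a j) (a j + L j)).1
    (syz i (a j) (a j + L j)).2 (c l) (L' l).
Proof.
move=> ibN; rewrite (ib_Ext_zero ib N i).
by split=> H j; apply/(ib_exact_at ibN (syz_at_ok ib i j)); exact: H.
Qed.

(** Equality of two intervals up to a multiple of n, with a shift on each side because the
    difference may have either sign. *)
Definition is_interval j x y := exists q q',
  (a j + n * q = x + n * q')%N /\ (a j + L j + n * q = y + n * q')%N.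

Lemma is_intervalP j x y : a j = x %[mod n] -> y = (x + L j)%N -> is_interval j x y.
Proof.
by move=> e ->; have [q [q' eq]] := eq_mod_shift e; exists q, q'; split=> //; lia.
Qed.

Lemma alive_interval i j x y : is_interval j x y ->
  alive (syz_at D a L i j) = alive (syz i x y).
Proof.
by move=> [q [q' [e1 e2]]]; rewrite -(alive_shift i x y q') -e1 -e2 alive_shift.
Qed.

Lemma ext_pos_interval i j x y c l : is_interval j x y ->
  ext_pos D (syz_at D a L i j).1 (syz_at D a L i j).2 c l <->
  ext_pos D (syz i x y).1 (syz i x y).2 c l.
Proof.
move=> [q [q' [e1 e2]]]; rewrite -(ext_pos_shift _ _ q) -(ext_pos_shift (syz i x y).1 _ q').
have := syz_shift i x y q'; rewrite -e1 -e2 syz_shift /syz_at.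
by case: (syz i (a j) _) => p r /=; case: (syz i x y) => p' r' /= [-> ->].
Qed.

(** If the (d+1)-st syzygy were nonzero, its projection onto its simple top would be a nonzero class
    in Ext^(d+1). *)
Lemma pd_dead d j x y : is_interval j x y -> (forall N, fin_gen N -> Ext_zero d.+1 M N) ->
  ~~ alive (syz d.+1 x y).
Proof.
move=> ij H; rewrite -(alive_interval d.+1 ij); apply/negP => al.
have al' := alive_pred al; pose s := syz_at D a L d j.
have L1 : (0 < 1 <= ell s.2)%N by rewrite nd_ell_gt0.
have fg := ib_fin_gen (uni_ibasis L1).
have /(Ext_zero_ibasis d (uni_ibasis L1)) /(_ j tt) := H _ fg; apply.
move: al; rewrite /syz_at syz_aliveS // -/(syz_at D a L d j) -/s /alive /= => al.
exists s.2; split=> //; first by rewrite addn1 ltnSn leqnn.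
  by rewrite leq_add2l subn_gt0.
by rewrite -[X in (X < _)%N]addn0 ltn_add2l subn_gt0.
Qed.

(** Write [x, y[ for the i-th syzygy. If [ep x = ep x.+1], the next syzygy [y, ep x[ embeds into the
    projective starting at x + 1; this embedding does not extend to the projective starting at x and
    is a nonzero class of Ext^(i+1). *)
Lemma ext_reg_step i j x y : is_interval j x y -> Ext_zero i.+1 M (R^o) ->
  alive (syz i x y) -> alive (syz i.+1 x y) -> (ep (syz i x y).1 < ep (syz i x y).1.+1)%N.
Proof.
move=> ij H al; rewrite syz_aliveS // /alive /= => al1.
rewrite ltnNge; apply/negP => le.
have n0 := nd_n_gt0 D; set s := syz i x y in al al1 le *.
have cn : (s.1.+1 %% n < n)%N by rewrite ltn_mod.
have /(Ext_zero_ibasis i (reg_ibasis D)) /(_ j (Ordinal cn)) := H; apply.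
apply/(ext_pos_interval i _ _ ij); rewrite -/s /=.
rewrite (@ell_mod _ _ D (s.1.+1 %% n) s.1.+1) ?modn_mod //.
exists (s.1.+1 %% n + (s.2 - s.1.+1))%N.
have le1 := endp_mono D (leqnSn s.1).
have e1 : (ep s.1.+1 = s.1.+1 + ell s.1.+1)%N by [].
rewrite /alive in al; split.
- by rewrite modnDml subnKC.
- by rewrite leq_addr ltn_add2l; move: al al1 le le1 e1; clear; lia.
- by rewrite -addnA leq_add2l; move: al al1 le le1 e1; clear; lia.
- by rewrite ltn_add2l; move: al; clear; lia.
Qed.

(** If [y, ep x[ is the last nonzero syzygy, then ep y <= ep x, while [ext_reg_step] would give ep x
    < ep (x+1) <= ep y. *)
Lemma pd_last p j x y : is_interval j x y -> alive (syz p.+1 x y) -> ~~ alive (syz p.+2 x y) ->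
  ~ Ext_zero p.+1 M (R^o).
Proof.
move=> ij al1 dead H; have al := alive_pred al1.
have := ext_reg_step ij H al al1; move: dead.
rewrite (syz_aliveS al1) (syz_aliveS al) /alive /= -leqNgt => le.
by rewrite ltnNge (leq_trans (endp_mono D al) le).
Qed.

End Basis.

Lemma Ext_zero_reg N i : Ext_zero i.+1 (R^o) N.
Proof.
apply/(ib_Ext_zero (reg_ibasis D)) => j.
have e : syz i j (ep j) = if i is 0 then (j : nat, ep j) else (ep j, ep j).
  elim: i => [//|i IH]; rewrite syzS IH /syz_step.
  by case: i {IH} => [|i] /=; rewrite ?endp_gt ?ltnn.
rewrite -[syz_at _ _ _ _ _]/(syz i j (ep j)) e; case: i {e} => [|i] m me m0 /=.
  by exists 0; rewrite /= subnn me in m0; rewrite m0 scaler0.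
by exists m; rewrite /= subnn me.
Qed.

(* Injectivity of the dual, read off from the intervals of its basis. *)
Lemma Ext_zero_dual M (I : finType) (a L : I -> nat) (v : I -> M) N (g : 'I_n -> N) i :
  ibasis D a L v -> ibasis D (fun l : 'I_n => inj_start D l) (fun l => inj_len D l) g ->
  Ext_zero i.+1 M N.
Proof.
move=> ibM ibN; apply/(Ext_zero_ibasis ibM i ibN) => j l.
have /andP[] := syz_at_ok ibM i j; rewrite /syz_at; case: (syz i _ _) => x y /= xy ye.
move=> [z [zy /andP[cz _] zs zx]]; rewrite inj_addlen in zs.
have n0 := nd_n_gt0 D; have base := inj_base_lt D l.
have ell_le : (ell x <= inj_base D)%N.
  have lx : (x %% n < n)%N by rewrite ltn_mod.
  rewrite -(@ell_mod _ _ D (x %% n) x) ?modn_mod //.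
  have := leq_bigmax (F := fun j : 'I_n => ell j) (Ordinal lx) => /= le.
  by apply: leq_trans le _; rewrite /inj_base leq_pmull.
have eE : ep x = (x + ell x)%N by [].
pose x' := (z - (y - x))%N.
have x'x : x' = x %[mod n].
  apply/eqP; rewrite -(eqn_modDr (y - x)) subnK ?subnKC ?zy //.
  by move: cz ye base ell_le eE; clear; lia.
have : (inj_start D l <= x')%N.
  apply: inj_start_min; rewrite /endp (ell_mod x'x).
  by move: zs cz ye base ell_le eE xy; rewrite /x'; clear; lia.
by move: zx cz base; rewrite /x'; clear; lia.
Qed.

Section Zigzag.
Notation zz := (zig ep).

Lemma syz_zig i x y : (forall j, (j < i)%N -> (zz x y j < zz x y j.+1)%N) ->
  syz i x y = (zz x y i, zz x y i.+1).
Proof.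
elim: i => [//|i IH] lt; rewrite syzS IH => [|j ji]; last by apply: lt; exact: ltnW.
by rewrite /syz_step /= lt // -zigS2.
Qed.

Lemma simple_zig d (M : lmodType R) (u : unit -> M) a :
    ibasis D (fun _ => a) (fun _ => 1%N) u -> (forall N, fin_gen N -> Ext_zero d.+1 M N) ->
  exists i, (i <= d)%N /\ zz a a.+1 i.+1 = zz a a.+1 i.+2.
Proof.
move=> ib H; have ij : is_interval (fun=> a) (fun=> 1%N) tt a a.+1.
  by apply: is_intervalP; rewrite ?addn1.
have dead := pd_dead ib ij H; apply: NNPP => no.
have lt j : (j < d.+2)%N -> (zz a a.+1 j < zz a a.+1 j.+1)%N.
  elim/ltn_ind: j => -[//|j] IH jd.
  have al i : (i < j)%N -> (zz a a.+1 i < zz a a.+1 i.+1)%N by move=> ij'; apply: IH; lia.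
  have al' i : (i < j.+1)%N -> (zz a a.+1 i < zz a a.+1 i.+1)%N by move=> ij'; apply: IH; lia.
  have := @syz_ok _ _ D j.+1 a a.+1; rewrite leqnSn (endp_gt D a) => /(_ isT) /andP[].
  rewrite (syz_zig al') /= => le _; rewrite ltn_neqAle le andbT; apply/eqP => e.
  by apply: no; exists j; split=> //; lia.
by move: dead; rewrite syz_zig => [|j jd]; [rewrite /alive /= lt|apply: lt; lia].
Qed.

(** Each use of [ext_reg_step] gives an inequality of [good_step] and also shows that the syzygy one
    degree further on is nonzero. Vanishing of Ext below d thus keeps the resolution alive up to
    degree d, where [pd_dead] stops it. *)
Lemma interval_good d (M : lmodType R) (I : finType) (a L : I -> nat) (v : I -> M) j x y :
    ibasis D a L v -> is_interval a L j x y -> (2 <= d)%N -> (x < y)%N -> (y < ep x)%N ->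
    (forall N, fin_gen N -> Ext_zero d.+1 M N) ->
    (forall i, (0 < i < d)%N -> Ext_zero i M (R^o)) ->
  good ep d x y.
Proof.
move=> ib ij d2 xy ye Hpd Hreg; have dead := pd_dead ib ij Hpd.
have lt i : (i <= d)%N -> (zz x y i < zz x y i.+1)%N.
  elim/ltn_ind: i => -[_ _ //|[_ _ //|i]] IH id.
  have al j' : (j' < i.+2)%N -> (zz x y j' < zz x y j'.+1)%N by move=> ij'; apply: IH; lia.
  have s0 : syz i x y = (zz x y i, zz x y i.+1) by apply: syz_zig => j' ij'; apply: al; lia.
  have s1 : syz i.+1 x y = (zz x y i.+1, zz x y i.+2) by apply: syz_zig => j' ij'; apply: al; lia.
  have := ext_reg_step ib ij (Hreg i.+1 _); rewrite s0 s1 /alive /= => /(_ ltac:(lia)).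
  move=> /(_ (al i ltac:(lia)) (al i.+1 ltac:(lia))) step.
  rewrite !zigS2; apply: leq_trans step _; apply: endp_mono; apply: al; lia.
split=> //.
- have s : syz d.+1 x y = (zz x y d.+1, zz x y d.+2) by apply: syz_zig => j' ij'; exact: lt.
  have := @syz_ok _ _ D d.+1 x y; rewrite (ltnW xy) (ltnW ye) => /(_ isT) /andP[].
  move: dead; rewrite s /alive /= -leqNgt => le1 le2 _; apply/eqP.
  by rewrite eqn_leq le1 le2.
- move=> i id.
  have s0 : syz i x y = (zz x y i, zz x y i.+1) by apply: syz_zig => j' ij'; apply: lt; lia.
  have s1 : syz i.+1 x y = (zz x y i.+1, zz x y i.+2) by apply: syz_zig => j' ij'; apply: lt; lia.
  have := ext_reg_step ib ij (Hreg i.+1 _); rewrite s0 s1 /alive /= => /(_ ltac:(lia)).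
  by apply; apply: lt; lia.
Qed.
End Zigzag.
End Syzygies.

(** * Necessary conditions for cluster tilting *)

Section DualOfAlgebra.
Variables (K : fieldType) (A : falgType K) (D : nakData K A^c).
Hypothesis std : standard D.
Notation n := (nd_n D).
Notation ell := (nd_ell D).

Definition dual_ev (f : dual_mod A) (x : A^c) : K := (f : 'Hom(A, K^o)) (x : A).

Lemma dual_functional (c : nat -> nat -> K) : exists f : dual_mod A, forall a t,
  (a < n)%N -> (t < ell a)%N -> dual_ev f (nd_w D a t) = c a t.
Proof.
have [co Hco] := choice _ (nd_w_span D).
have uniq x (b : nat -> nat -> K) : x = \sum_(a < n) \sum_(t < ell a) nd_k D (b a t) * nd_w D a t ->
    forall (a : 'I_n) t, (t < ell a)%N -> co x a t = b a t.
  move=> xE a t tl; apply: (ib_inj (reg_ibasis D) (c := fun a : 'I_n => co x a)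
    (c' := fun a : 'I_n => b a)) => //.
  transitivity x; first by rewrite {2}(Hco x); apply: eq_bigr => i _; apply: eq_bigr => u _;
    rewrite -[_ *: _]/(_ * (_ * _)) w_idem.
  by rewrite {1}xE; apply: eq_bigr => i _; apply: eq_bigr => u _;
    rewrite -[_ *: _]/(_ * (_ * _)) w_idem.
pose F (x : A) : K^o := \sum_(a < n) \sum_(t < ell a) c a t * co x a t.
have Flin : linear F.
  move=> r x y; rewrite /F scaler_sumr -big_split; apply: eq_bigr => a _.
  rewrite scaler_sumr -big_split; apply: eq_bigr => t _ /=.
  rewrite (uniq _ (fun a t => r * co x a t + co y a t)) //.
    by rewrite -[_ *: _]/(r * _) mulrDr mulrCA.
  rewrite -[r *: x](opp_algM r) -std [in LHS](Hco x) [in LHS](Hco y) mulr_sumr -big_split.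
  apply: eq_bigr => i _; rewrite mulr_sumr -big_split; apply: eq_bigr => u _.
  by rewrite rmorphD rmorphM mulrDl mulrA.
exists (linfun (mklin Flin)) => a t an tl.
rewrite /dual_ev lfunE /= mklinE /F (bigD1 (Ordinal an)) //= (bigD1 (Ordinal tl)) //=.
have coE (i : 'I_n) u : (u < ell i)%N -> co (nd_w D a t) i u = ((i == a :> nat) && (u == t))%:R.
  move=> ui; apply: (uniq _ (fun i u => ((i == a :> nat) && (u == t))%:R)) => //.
  rewrite (bigD1 (Ordinal an)) //= (bigD1 (Ordinal tl)) //= !eqxx rmorph1 mul1r.
  rewrite [X in _ + X + _]big1 ?addr0; last first.
    by move=> v /negPf; rewrite -val_eqE /= => ->; rewrite ?andbF rmorph0 mul0r.
  rewrite big1 ?addr0 // => v /negPf; rewrite -val_eqE /= => va.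
  by rewrite big1 // => u' _; rewrite va rmorph0 mul0r.
rewrite (coE (Ordinal an)) // !eqxx mulr1 [X in _ + X + _]big1 ?addr0; last first.
  by move=> v /negPf; rewrite -val_eqE /= => vt; rewrite (coE (Ordinal an)) //= vt andbF mulr0.
rewrite big1 ?addr0 // => v /negPf; rewrite -val_eqE /= => va.
by rewrite big1 // => u' _; rewrite coE // va mulr0.
Qed.

Lemma dual_mod_ibasis : exists g : 'I_n -> dual_mod A,
  ibasis D (fun l : 'I_n => inj_start D l) (fun l => inj_len D l) g.
Proof.
eexists; apply: (@dual_ibasis K _ D (dual_mod A) dual_ev).
- by move=> f g x; rewrite /dual_ev add_lfunE.
- by move=> f x y; rewrite /dual_ev raddfD.
- by move=> f c x; rewrite /dual_ev std opp_algM linearZ.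
- by move=> r f x; exact: dual_scaleE.
- by move=> f f0; apply/lfunP => x; rewrite zero_lfunE; exact: f0.
- exact: dual_functional.
Qed.
End DualOfAlgebra.

Section ClusterTilting.
Variables (K : fieldType) (A : falgType K) (D : nakData K A^c).
Hypothesis std : standard D.
Notation n := (nd_n D).
Notation ell := (nd_ell D).
Notation ep := (endp D).
Notation W := (reg_mod A * dual_mod A)%type.
Variable d : nat.
Hypothesis d_ge2 : (2 <= d)%N.

Lemma fin_gen_reg : fin_gen (reg_mod A).
Proof. exact: ib_fin_gen (reg_ibasis D). Qed.
Lemma fin_gen_dual : fin_gen (dual_mod A).
Proof. by have [g ib] := dual_mod_ibasis std; exact: ib_fin_gen ib. Qed.

Lemma Ext_dual (M : lmodType A^c) i : fin_gen M -> Ext_zero i.+1 M (dual_mod A).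
Proof.
move=> /(ibasis_exists D)[I [a [L [v [ib _]]]]]; have [g ibd] := dual_mod_ibasis std.
exact: Ext_zero_dual ib ibd.
Qed.

Section Properties.
Variable C : lmodType A^c -> Prop.
Hypothesis CT : cluster_tilting d C.

Lemma CT_reg : C (reg_mod A).
Proof.
case: CT => _ _ _ _ H; apply/H; split; first exact: fin_gen_reg.
by move=> Y [//|i] _ _; exact: (Ext_zero_reg D).
Qed.

Lemma CT_dual : C (dual_mod A).
Proof.
case: CT => Cfg _ _ H _; apply/H; split; first exact: fin_gen_dual.
by move=> Y [//|i] /Cfg fgY _; exact: Ext_dual.
Qed.

Lemma CT_Ext (X Y : lmodType A^c) i : C X -> C Y -> (0 < i < d)%N -> Ext_zero i X Y.
Proof. by case: CT => _ _ _ _ H CX CY id; have [_ H'] := proj1 (H X) CX; exact: H'. Qed.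

Lemma CT_W : C W.
Proof. case: CT => _ [Cp _] _ _ _; exact: Cp CT_reg CT_dual. Qed.
End Properties.

Lemma gldim_Ext (M N : lmodType A^c) : gldim_le A^c d -> fin_gen M -> Ext_zero d.+1 M N.
Proof. by move=> gl fg; apply: pd_le_Ext; exact: gl. Qed.

Lemma CT_good (C : lmodType A^c -> Prop) : cluster_tilting d C -> gldim_le A^c d ->
  forall a b, (ep (a + n).-1 < b + n)%N -> (b < ep a)%N -> good ep d a b.
Proof.
move=> CT gl a b ab ba; have [g ib] := dual_mod_ibasis std.
have n0 := nd_n_gt0 D.
have [i [ia il]] := inj_interval (D := D) (a := a + n) (b := b + n) ltac:(lia) ab
  ltac:(rewrite endp_addn leq_add2r; exact: ltnW).
have altb : (a < b)%N.
  by have := endp_gt D (a + n).-1; lia.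
have ij : is_interval D (fun l : 'I_n => inj_start D l) (fun l => inj_len D l) i a b.
  by apply: is_intervalP; [rewrite ia modnDr|rewrite il; lia].
apply: (interval_good ib ij) => //.
  by move=> N _; apply: gldim_Ext => //; exact: fin_gen_dual.
by move=> j jd; apply: (CT_Ext CT) => //; [exact: CT_dual CT|exact: CT_reg CT].
Qed.

Lemma gldim_simple a : gldim_le A^c d ->
  exists i, (i <= d)%N /\ zig ep a a.+1 i.+1 = zig ep a a.+1 i.+2.
Proof.
move=> gl; have L1 : (0 < 1 <= ell a)%N by rewrite nd_ell_gt0.
have ib := uni_ibasis L1; apply: (simple_zig ib) => N _.
by apply: gldim_Ext => //; exact: ib_fin_gen ib.
Qed.

Lemma cyclic_no_CT (C : lmodType A^c -> Prop) : cluster_tilting d C -> gldim_le A^c d ->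
  (forall x, (x.+2 <= ep x)%N) -> False.
Proof.
move=> CT gl ep2; have n0 := nd_n_gt0 D.
have pos x : (x < ep x)%N by exact: endp_gt.
have gd := CT_good CT gl; have sz a := gldim_simple a gl.
have := odd_double_half d; case: (odd d) => /= e; rewrite ?add0n ?add1n in e.
  exact: (cyclic_odd_absurd n0 (@endp_addn _ _ D) (@endp_mono _ _ D) pos d_ge2 gd ep2 sz (esym e)).
exact: (cyclic_even_absurd n0 (@endp_addn _ _ D) (@endp_mono _ _ D) pos d_ge2 gd ep2 sz (esym e)).
Qed.

End ClusterTilting.

(** * Linear quivers with homogeneous relations *)

Section Ladder.
Variable l : nat.
(* Starting points of the syzygies of [a, b[ when [endp x = x + l]. *)
Definition ladder a b i := (i./2 * l + (if odd i then b else a))%N.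

Lemma ladderS2 a b i : ladder a b i.+2 = (ladder a b i + l)%N.
Proof. by rewrite /ladder /= negbK mulSn; lia. Qed.

Lemma ladder_even a b j : ladder a b j.*2 = (j * l + a)%N.
Proof. by rewrite /ladder odd_double doubleK. Qed.

Lemma ladder_odd a b j : ladder a b j.*2.+1 = (j * l + b)%N.
Proof. by rewrite /ladder /= odd_double uphalf_double. Qed.

Hypothesis l_ge2 : (2 <= l)%N.

Lemma ladder_lt a b i : (a < b < a + l)%N -> (ladder a b i < ladder a b i.+1)%N.
Proof.
move=> /andP[ab bl]; have := odd_double_half i; case: (odd i) => /= <-; rewrite ?add0n ?add1n.
  by rewrite -doubleS ladder_odd ladder_even mulSn; lia.
by rewrite ladder_even ladder_odd ltn_add2l.
Qed.

Lemma ladder_mono a b i j : (a < b < a + l)%N -> (i <= j)%N -> (ladder a b i <= ladder a b j)%N.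
Proof.
move=> ab /subnKC <-; elim: (j - i)%N => [|q IH]; first by rewrite addn0.
by rewrite addnS (leq_trans IH) // ltnW // ladder_lt.
Qed.

(* The numerical form of Ext^(i+1)([0, b[, [c, e[) <> 0, where [0, b[ is injective. *)
Lemma ladder_cover c e : (0 < c)%N -> (c < e)%N -> (e < c + l)%N ->
  exists b i, [/\ (0 < b < l)%N, (ladder 0 b i < c <= ladder 0 b i.+1)%N,
    (ladder 0 b i.+1 < e <= ladder 0 b i.+2)%N &
    forall q, (c <= q * l)%N -> (i.+1 <= q.*2)%N].
Proof.
move=> c0 ce el; have l0 : (0 < l)%N by lia.
have [j [r [cE rl _]]] := divn_lt (x := c) (q := c.+1) l0 (leq_pmulr _ l0).
(* The choice of b makes c or e a rung of the ladder: b = e - c if l divides c, b = r if e does not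
   exceed the next multiple of l, and otherwise b is the excess of e over that multiple. *)
have [r0|r0] := posnP r.
  rewrite r0 addn0 in cE; have j0 : (0 < j)%N by case: (j) cE c0 => // ->.
  have jE : (j * l = j.-1 * l + l)%N by rewrite -{1}(prednK j0) mulSn addnC.
  exists (e - c)%N, (j.-1.*2.+1); rewrite -doubleS prednK // ladder_odd ladder_even ladder_odd.
  split; [lia| | |]; first by rewrite addn0 -cE leqnn andbT cE jE; lia.
    by rewrite addn0 -cE ce /=; lia.
  by move=> q; rewrite cE leq_pmul2r // leq_double.
have jS : (j.+1 * l = j * l + l)%N by rewrite mulSn addnC.
have bound q : (c <= q * l)%N -> (j.+1 <= q)%N.
  by move=> cq; rewrite -(ltn_pmul2r l0); lia.
have [le|lt] := leqP e (j.+1 * l).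
  exists r, j.*2; rewrite ladder_even ladder_odd -doubleS ladder_even.
  split; [by rewrite r0| | |]; [by lia|by lia|].
  by move=> q /bound; rewrite -leq_double doubleS => /ltnW.
exists (e - j.+1 * l)%N, (j.*2.+1); rewrite -doubleS ladder_odd ladder_even ladder_odd.
by split; [lia|lia|lia|] => q /bound; rewrite leq_double.
Qed.
End Ladder.

Section Homogeneous.
Variables (K : fieldType) (A : falgType K) (D : nakData K A^c).
Hypothesis std : standard D.
Variables (m l : nat).
Hypothesis (m_ge2 : (2 <= m)%N) (l_ge2 : (2 <= l)%N) (nm : nd_n D = m).
Notation n := (nd_n D).
Notation ell := (nd_ell D).
Notation ep := (endp D).
Notation W := (reg_mod A * dual_mod A)%type.
Hypothesis epE : forall x, (x < m)%N -> ep x = minn (x + l) m.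
Notation lad := (ladder l).

Lemma ep_m : ep m = (minn l m + m)%N.
Proof.
have e := endp_addn D 0; rewrite add0n nm in e.
by rewrite e epE ?add0n //; lia.
Qed.

Lemma ep_last : ep m.-1 = m.
Proof. by rewrite epE; lia. Qed.

(** A nonzero syzygy starts below m, where [ep] is translation by l cut off at m; so the cut is
    visible only at the right end. *)
Lemma syz_alive_ladder a b i : (a < b <= m)%N -> alive (syz D i a b) ->
  syz D i a b = (lad a b i, minn (lad a b i.+1) m) /\ (lad a b i < m)%N.
Proof.
move=> /andP[ab bm]; elim: i => [|i IH] al.
  rewrite /ladder /= !mul0n !add0n; split; last lia.
  by congr pair; apply/esym/minn_idPl.
have al' := alive_pred al; have [sE im] := IH al'.
move: al; rewrite (syz_aliveS al') sE /alive /= epE // => lt.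
have iS : (lad a b i.+1 < m)%N by move: lt; clear; lia.
have e : minn (lad a b i.+1) m = lad a b i.+1 by apply/minn_idPl; exact: ltnW.
by rewrite e ladderS2.
Qed.

Lemma syz_ladder a b i : (a < b < a + l)%N -> (b <= m)%N -> (lad a b i < m)%N ->
  syz D i a b = (lad a b i, minn (lad a b i.+1) m) /\ alive (syz D i a b).
Proof.
move=> abl bm; elim: i => [|i IH] im.
  rewrite /ladder /= !mul0n !add0n /alive /=; split; last by lia.
  by congr pair; apply/esym/minn_idPl.
have lt := ladder_lt l_ge2 i abl; have [sE al] := IH (ltn_trans lt im).
have e : minn (lad a b i.+1) m = lad a b i.+1 by apply/minn_idPl; exact: ltnW.
rewrite (syz_aliveS al) sE /alive /= epE ?(ltn_trans lt) // e ladderS2; split=> //.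
have := ladder_lt l_ge2 i.+1 abl; rewrite ladderS2; move: im; clear; lia.
Qed.

Section Normalize.
Variables (M : lmodType A^c) (I : finType) (a L : I -> nat) (v : I -> M).
Hypothesis ib : ibasis D a L v.
Hypothesis L_gt0 : forall j, (0 < L j)%N.
Notation s j := (a j %% m)%N.
Notation e j := (a j %% m + L j)%N.

Lemma start_lt j : (s j < m)%N. Proof. by rewrite ltn_mod; lia. Qed.

Lemma norm_interval j : is_interval D a L j (s j) (e j).
Proof. by apply: is_intervalP; rewrite // nm modn_mod. Qed.

Lemma e_le j : (e j <= ep (s j))%N.
Proof. by rewrite /endp leq_add2l (@ell_mod _ _ D _ (a j)) ?nm ?modn_mod // (ib_le ib). Qed.

Lemma e_le_m j : (e j <= m)%N.
Proof. by have := e_le j; rewrite epE ?start_lt //; lia. Qed.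

(** The intervals that are neither projective nor injective: the last two conditions say e < ep s,
    and the first with the last says e <= ep (s - 1). *)
Definition inner j := [&& (0 < s j)%N, (e j < m)%N & (e j < s j + l)%N].

Lemma add_of_inner : (forall j, ~~ inner j) -> add_subcat W M.
Proof.
move=> np; have [g ibd] := dual_mod_ibasis std.
apply: (add_of_ibasis ib (prod_ibasis (reg_ibasis D) ibd)) => j.
have sm := start_lt j; have el := e_le j.
have [lt|ge] := ltnP (e j) (ep (s j)); last first.
  have sn : (s j < n)%N by rewrite nm.
  exists (inl (Ordinal sn)) => /=; rewrite nm modn_mod; split=> //.
  have eE : e j = ep (s j) by apply/eqP; rewrite eqn_leq el.
  by move: eE; rewrite /endp; clear; lia.
have := np j; rewrite /inner; move: (lt); rewrite epE // => lt'.
have [s0|s0] := posnP (s j); last by rewrite /=; move: lt'; clear; lia.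
(* Position 0 has no predecessor, so [0, L[ is moved to [m, m + L[. *)
move=> _; have [i [ia il]] := @inj_interval _ _ D m (m + L j) ltac:(lia)
  ltac:(rewrite ep_last; have := L_gt0 j; lia)
  ltac:(rewrite ep_m; move: lt'; rewrite s0; lia).
exists (inr i) => /=; split; last by rewrite il; lia.
by rewrite ia nm modnn s0.
Qed.

(** If some syzygy up to degree d were zero, [pd_last] applied to the last nonzero one would give a
    nonzero Ext into A in a degree strictly between 0 and d. *)
Lemma inner_Ext_reg j d : inner j -> Ext_zero 1 M (reg_mod A) ->
  (forall i, (0 < i < d)%N -> Ext_zero i M (reg_mod A)) -> alive (syz D d (s j) (e j)).
Proof.
move=> /and3P[s0 em el] H1 H; have sm := start_lt j; have L0 := L_gt0 j.
elim: d H => [|d IH] H; first by rewrite /alive /=; lia.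
have al : alive (syz D d (s j) (e j)) by apply: IH => i id; apply: H; lia.
case: d al H {IH} => [al H|d al H].
  by rewrite syz_aliveS // /alive /= epE //; lia.
apply: contraT => dead; case: (pd_last ib (norm_interval j) al dead).
by apply: H; lia.
Qed.

(** The class comes from the injective [0, b[ found by [ladder_cover]. The two further conclusions
    control its degree: the first through [ld_bound], the second, in terms of the start of the
    interval, for the odd case. *)
Lemma inner_Ext_dual j : inner j -> exists i, [/\
  ~ Ext_zero i.+1 (dual_mod A) M, (exists b, (0 < b < l)%N /\ (lad 0 b i.+1 < m.-1)%N) &
  forall q, (s j <= q * l)%N -> (i.+1 <= q.*2)%N].
Proof.
move=> /and3P[s0 em el]; have L0 := L_gt0 j.
have [b [i [b0l ci ie bound]]] := ladder_cover l_ge2 s0 (ltac:(lia) : s j < e j)%N el.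
have [g ibd] := dual_mod_ibasis std.
exists i; split=> //; last by exists b; split=> //; lia.
have b0 : (0 < b < 0 + l)%N by rewrite add0n.
have im : (lad 0 b i < m)%N by lia.
have bm : (b <= m)%N.
  have := ladder_mono l_ge2 (i := 1) (j := i.+1) b0 isT.
  by rewrite {1}/ladder /= mul0n add0n; lia.
have [sE al] := syz_ladder b0 bm im.
have [t [ta tl]] := @inj_interval _ _ D m (m + b) ltac:(lia)
  ltac:(rewrite ep_last; lia)
  ltac:(rewrite ep_m; lia).
have tint : is_interval D (fun l : 'I_n => inj_start D l) (fun l => inj_len D l) t 0 b.
  by apply: is_intervalP; [rewrite ta nm modnn mod0n|rewrite tl; lia].
move=> /(Ext_zero_ibasis ibd i ib) /(_ t j); apply.
apply/(ext_pos_interval i _ _ tint); rewrite sE /=; have eE := epE im.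
have aE := divn_eq (a j) m; exists (lad 0 b i.+1 + a j %/ m * m)%N; rewrite nm; split.
- by rewrite addnC modnMDl; congr (_ %% m)%N; apply/esym/minn_idPl; lia.
- by lia.
- by rewrite ladderS2 in ie; rewrite eE; lia.
- by lia.
Qed.
End Normalize.
End Homogeneous.

(** * Additivity of Ext and its vanishing on an additive closure *)

Lemma Ext_zero_prodl (K : fieldType) (R : pzRingType) (D : nakData K R) (M M' N : lmodType R) i :
    fin_gen M -> fin_gen M' -> Ext_zero i.+1 M N -> Ext_zero i.+1 M' N ->
  Ext_zero i.+1 (M * M')%type N.
Proof.
move=> /(ibasis_exists D)[I [a [L [v [ib _]]]]] /(ibasis_exists D)[J [b [L' [u [ib' _]]]]].
move=> /(ib_Ext_zero ib) H /(ib_Ext_zero ib') H'.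
apply/(ib_Ext_zero (prod_ibasis ib ib')) => -[j|j]; [exact: H j|exact: H' j].
Qed.

Lemma Ext_zero_retract_fg (K : fieldType) (R : pzRingType) (D : nakData K R)
    (X M N : lmodType R) i :
  fin_gen M -> retract X M -> Ext_zero i.+1 M N -> Ext_zero i.+1 X N.
Proof.
move=> fg XM H; apply: (Ext_zero_retractl XM H).
have [I [a [L [v [ib _]]]]] := ibasis_exists D (fin_gen_retract XM fg).
by exists (interval_res ib).
Qed.

Lemma Ext_zero_add (K : fieldType) (R : pzRingType) (D : nakData K R) (W X Y : lmodType R) i :
  fin_gen W -> Ext_zero i.+1 W W -> add_subcat W X -> add_subcat W Y -> Ext_zero i.+1 Y X.
Proof.
move=> fg H /addP[p [j [r jr]]] /addP[q Yq].
have HX : Ext_zero i.+1 W X by apply: (Ext_zero_retractr jr); exact: Ext_zero_pow.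
apply: (Ext_zero_retract_fg D (fin_gen_pow q fg) Yq).
elim: (q) => [|q' IH]; first exact: (Ext_zero_retract_fg D fg (retract_pow0 _ _)).
apply: (Ext_zero_retract_fg D (fin_gen_prod fg (fin_gen_pow q' fg)) (retract_powS _ _)).
by apply: (Ext_zero_prodl D) => //; exact: fin_gen_pow.
Qed.

(** A projective carrying a class can be shifted so that it starts at some c' > x and ends no later
    than [endp D x]; monotonicity then bounds [endp D x.+1]. *)
Lemma ext_pos_reg (K : fieldType) (R : pzRingType) (D : nakData K R) x y c :
    ext_pos D x y c (nd_ell D c) ->
  [/\ (x < y)%N, (y < endp D x)%N & (endp D x.+1 <= endp D x)%N].
Proof.
move=> [z [zy /andP[cz zl] zs zx]]; have n0 := nd_n_gt0 D.
have xy : (x < y)%N by lia.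
have ye : (y < endp D x)%N by lia.
split=> //; pose c' := (y - (z - c))%N.
have c'c : c' = c %[mod nd_n D].
  by apply/eqP; rewrite -(eqn_modDr (z - c)) subnK ?subnKC ?zy //; lia.
have xc : (x < c')%N by rewrite /c'; lia.
apply: leq_trans (endp_mono D xc) _; rewrite {1}/endp (ell_mod c'c) /c'.
by lia.
Qed.

(** * Cluster tilting for the remaining linear algebras *)

Section LadderDimension.
Variables m l : nat.
Hypotheses (m_ge2 : (2 <= m)%N) (l_ge2 : (2 <= l)%N).
Notation lad := (ladder l).

(** What the two families m = kl + 1 and l = 2 have in common: no syzygy survives beyond degree d,
    none of an interval starting after 0 survives in degree d itself, and those of [0, b[ with 0 < b
    < l survive up to d. The last field bounds the degree of the class produced by
    [inner_Ext_dual]. *)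
Record ladder_dim d : Prop := LadderDim {
  ld_dead : forall a b, (a < b <= m)%N -> (m <= lad a b d.+1)%N;
  ld_dead_pos : forall a b, (0 < a < b)%N -> (m <= lad a b d)%N;
  ld_lt : forall b i, (0 < b < l)%N -> (i <= d)%N -> (lad 0 b i < m)%N;
  ld_bound : forall b i, (0 < b < l)%N -> (lad 0 b i < m.-1)%N -> (i < d)%N }.

Lemma ladder_dim_even k : m = (k * l).+1 -> ladder_dim k.*2.
Proof.
move=> mE; split.
- by move=> a b ab; rewrite ladder_odd; lia.
- by move=> a b ab; rewrite ladder_even; lia.
- move=> b i bl ik; have := ladder_mono l_ge2 (a := 0) (b := b) bl ik.
  by rewrite ladder_even; lia.
- move=> b i bl lt; rewrite ltnNge; apply/negP => /(ladder_mono l_ge2 (a := 0) (b := b) bl).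
  by rewrite ladder_even; lia.
Qed.

(** For l = 2 the only choice is b = 1, and the ladder of [0, 1[ climbs one position per degree,
    whatever the parity of m. *)
Lemma ladder_dim_two : l = 2%N -> ladder_dim m.-1.
Proof.
move=> l2; have ladE a b i : lad a b i = (i./2.*2 + (if odd i then b else a))%N.
  by rewrite /ladder l2 muln2.
have half i := odd_double_half i.
split.
- by move=> a b ab; rewrite ladE prednK; [have := half m; case: odd => /=|]; lia.
- by move=> a b ab; rewrite ladE; have := half m.-1; case: odd => /=; lia.
- by move=> b i bl id; rewrite ladE; have := half i; case: odd => /=; lia.
- by move=> b i bl; rewrite ladE; have := half i; case: odd => /=; lia.
Qed.

End LadderDimension.

Section HomogeneousTilting.
Variables (K : fieldType) (A : falgType K) (D : nakData K A^c).
Hypothesis std : standard D.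
Variables (m l : nat).
Hypothesis (m_ge2 : (2 <= m)%N) (l_ge2 : (2 <= l)%N) (nm : nd_n D = m).
Notation n := (nd_n D).
Notation ell := (nd_ell D).
Notation ep := (endp D).
Notation W := (reg_mod A * dual_mod A)%type.
Hypothesis epE : forall x, (x < m)%N -> ep x = minn (x + l) m.
Notation lad := (ladder l).

Variable d : nat.
Hypothesis ld : ladder_dim m l d.

Lemma ladder_dead a b : (a < b <= m)%N -> ~~ alive (syz D d.+1 a b).
Proof.
move=> ab; apply/negP => /(syz_alive_ladder m_ge2 l_ge2 nm epE ab)[_]; have := ld_dead ld ab; lia.
Qed.

Lemma ladder_gldim_le : gldim_le A^c d.
Proof.
move=> M /(ibasis_exists D)[I [a [L [v [ib L0]]]]]; apply: (ib_pd_le ib) => i j di.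
rewrite -/(alive _) (alive_interval i (norm_interval nm a L j)); apply/negP => al.
have ab : (a j %% m < a j %% m + L j <= m)%N.
  by rewrite (e_le_m m_ge2 l_ge2 nm epE ib) andbT; have := L0 j; lia.
by have /negP := ladder_dead ab; apply; exact: alive_le di al.
Qed.

(** The lower bound comes from the simple module at position 0, whose syzygies are nonzero up to
    degree d. *)
Lemma ladder_gldim_eq d' : gldim_eq A^c d' -> d' = d.
Proof.
move=> [gl min]; apply/eqP; rewrite eqn_leq min /=; last exact: ladder_gldim_le.
rewrite leqNgt; apply/negP => lt.
have L1 : (0 < 1 <= ell 0)%N by rewrite nd_ell_gt0.
have ib := uni_ibasis L1.
have ij : is_interval D (fun _ : unit => 0%N) (fun=> 1%N) tt 0 1.
  by apply: is_intervalP.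
have /negP := pd_dead ib ij (fun N _ => gldim_Ext N gl (ib_fin_gen ib)); apply.
have b1 : (0 < 1 < 0 + l)%N by lia.
have [] // := syz_ladder m_ge2 l_ge2 nm epE b1 (i := d'.+1) ltac:(lia).
by apply: (ld_lt ld).
Qed.

Hypothesis d_ge2 : (2 <= d)%N.

(** Only Ext groups from DA are involved; this gives the maximality of add W and, as every cluster
    tilting [C] contains DA, also the inclusion of [C] in it. *)
Lemma add_of_Ext_dual (X : lmodType A^c) : fin_gen X ->
  (forall i, (0 < i < d)%N -> Ext_zero i (dual_mod A) X) -> add_subcat W X.
Proof.
move=> /(ibasis_exists D)[I [a [L [v [ib L0]]]]] H.
apply: (add_of_inner std m_ge2 l_ge2 nm epE ib L0) => j; apply/negP => pj.
have [i [nE [b [bl lt]] _]] := inner_Ext_dual std m_ge2 l_ge2 nm epE ib L0 pj.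
by apply: nE; apply: H; rewrite /=; exact: (ld_bound ld bl lt).
Qed.

Lemma add_of_Ext_reg (X : lmodType A^c) : fin_gen X ->
  (forall i, (0 < i < d)%N -> Ext_zero i X (reg_mod A)) -> add_subcat W X.
Proof.
move=> /(ibasis_exists D)[I [a [L [v [ib L0]]]]] H.
apply: (add_of_inner std m_ge2 l_ge2 nm epE ib L0) => j; apply/negP => pj.
have := inner_Ext_reg m_ge2 l_ge2 nm epE ib L0 pj (H 1%N ltac:(lia)) H.
have /and3P[s0 em _] := pj; have lt : (a j %% m < a j %% m + L j <= m)%N by have := L0 j; lia.
move=> /(syz_alive_ladder m_ge2 l_ge2 nm epE lt)[_].
have := ld_dead_pos ld (a := a j %% m) (b := a j %% m + L j); have := L0 j; lia.
Qed.

(** A class would make [ep] stationary at the start x of the i-th syzygy. For an injective starting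
    at 0, [ld_lt] keeps x + l below m in these degrees, and there [ep] is strictly increasing. *)
Lemma Ext_dual_reg i : (0 < i < d)%N -> Ext_zero i (dual_mod A) (reg_mod A).
Proof.
case: i => // i id; have [g ib] := dual_mod_ibasis std.
apply/(Ext_zero_ibasis ib i (reg_ibasis D)) => j c.
have ij := norm_interval nm (fun j : 'I_n => inj_start D j) (fun j => inj_len D j) j.
move=> /(ext_pos_interval i _ _ ij).
set s := (inj_start D j %% m)%N; set e := (s + inj_len D j)%N.
have se : (s < e)%N.
  by rewrite /e; have := inj_start_lt_end D j; rewrite /inj_len; lia.
have em : (e <= m)%N := e_le_m m_ge2 l_ge2 nm epE ib j.
have sm : (s < m)%N by rewrite ltn_mod; lia.
move=> /ext_pos_reg[xy ye le]; have al : alive (syz D i s e) := xy.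
have al1 : alive (syz D i.+1 s e) by rewrite syz_aliveS.
have : alive (syz D 1 s e) by apply: alive_le al1.
rewrite syz_aliveS /alive //= epE // => elt.
(* For s > 0, the minimality of the start of an injective leaves no room below ep s: the interval is
   projective. *)
have [s0|s0] := posnP s; last first.
  have := inj_pred D j; rewrite -inj_addlen.
  have aE := divn_eq (inj_start D j) m; rewrite -/s in aE.
  set q := (inj_start D j %/ m)%N in aE; set a := inj_start D j in aE *.
  have qn : (n * q = q * m)%N by rewrite mulnC; congr (q * _)%N.
  have -> : a.-1 = (s.-1 + n * q)%N by rewrite qn aE; clear -s0; lia.
  rewrite endp_shift qn aE epE; last by clear -s0 sm; lia.
  by move: elt; rewrite /e; clear -s0 sm; lia.
have se' : (s < e <= m)%N by rewrite se em.
have e0l : (0 < e < l)%N by move: elt se; rewrite s0; lia.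
have [sE im] := syz_alive_ladder m_ge2 l_ge2 nm epE se' al.
move: le; rewrite sE /= !epE //; last first.
  have := ld_lt ld (i := i.+1) e0l ltac:(lia); rewrite -{1}s0.
  have := ladder_lt l_ge2 (a := s) (b := e) i; rewrite s0 add0n => /(_ e0l).
  by lia.
have := ld_lt ld (i := i.+2) e0l ltac:(lia); rewrite ladderS2 -{1}s0.
by lia.
Qed.

Lemma Ext_WW i : (0 < i < d)%N -> Ext_zero i W W.
Proof.
case: i => // i id; apply: (Ext_zero_prodl D).
- exact: fin_gen_reg D.
- exact: fin_gen_dual std.
- exact: Ext_zero_reg D _ _.
- apply: Ext_zero_prod; first exact: Ext_dual_reg.
  by apply: (Ext_dual std); exact: fin_gen_dual std.
Qed.

Lemma fin_gen_W : fin_gen W.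
Proof. by apply: fin_gen_prod; [exact: fin_gen_reg D|exact: fin_gen_dual std]. Qed.

Lemma ladder_cluster_tilting : cluster_tilting d (add_subcat W).
Proof.
have [g ibd] := dual_mod_ibasis std; have WW := add_self W.
have EE X Y i : add_subcat W X -> add_subcat W Y -> (0 < i < d)%N -> Ext_zero i Y X.
  case: i => // i CX CY id; apply: (Ext_zero_add D fin_gen_W) CX CY; exact: Ext_WW.
split.
- by move=> X; exact: add_fin_gen fin_gen_W.
- exact: add_closed.
- exact: (add_functorially_finite (prod_ibasis (reg_ibasis D) ibd)).
- move=> X; split=> [CX|[fg H]].
    by split=> [|Y i CY id]; [exact: add_fin_gen fin_gen_W CX|exact: EE].
  apply: add_of_Ext_dual => // -[//|i] id.
  by apply: (Ext_zero_retract_fg D fin_gen_W (retract_inr _ _)); exact: H.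
- move=> X; split=> [CX|[fg H]].
    by split=> [|Y i CY id]; [exact: add_fin_gen fin_gen_W CX|exact: EE].
  apply: add_of_Ext_reg => // -[//|i] id.
  have [j [r jr]] := retract_inl (reg_mod A) (dual_mod A).
  by apply: (Ext_zero_retractr jr); exact: H.
Qed.

Lemma ladder_CT_unique (C : lmodType A^c -> Prop) : cluster_tilting d C ->
  forall X, C X <-> add_subcat W X.
Proof.
move=> CT X; split=> [CX|]; last first.
  by case: (CT) => _ Ccl _ _ _; exact: closed_add Ccl (CT_W std CT).
apply: add_of_Ext_dual; first by case: CT => Cfg _ _ _ _; exact: Cfg.
by move=> i id; apply: (CT_Ext CT _ CX id); exact: (CT_dual std CT).
Qed.

End HomogeneousTilting.

Section OddHomogeneous.
Variables (K : fieldType) (A : falgType K) (D : nakData K A^c).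
Hypothesis std : standard D.
Variables (m l k : nat).
Hypothesis (l_ge3 : (3 <= l)%N) (k_gt0 : (0 < k)%N).
Hypothesis (nm : nd_n D = m) (mE : m = (k.+1 * l)%N).
Notation ep := (endp D).
Notation lad := (ladder l).
Hypothesis epE : forall x, (x < m)%N -> ep x = minn (x + l) m.

Let l_ge2 : (2 <= l)%N. Proof. exact: ltnW. Qed.
Let klm : (k * l + l)%N = m. Proof. by rewrite mE mulSn addnC. Qed.
Let m_ge2 : (2 <= m)%N. Proof. by move: klm l_ge3; clear; lia. Qed.

(* With [d] odd and [l >= 3] the simple module at position [m - 2] would lie in
   every [d]-cluster tilting subcategory although Ext^1 from it to A is nonzero. *)
Lemma odd_ladder_no_CT (C : lmodType A^c -> Prop) : cluster_tilting k.*2.+1 C -> False.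
Proof.
move=> CT; have d2 : (0 < 1 < k.*2.+1)%N by move: k_gt0; clear; lia.
have L1 : (0 < 1 <= nd_ell D (m - 2))%N by rewrite nd_ell_gt0.
have ibX := uni_ibasis L1.
have CX : C (uni_mod L1).
  case: (CT) => Cfg _ _ H _; apply/H; split=> [|Y [//|i] CY id]; first exact: ib_fin_gen ibX.
  have [I [a [L [v [ib L0]]]]] := ibasis_exists D (Cfg _ CY).
  apply/(Ext_zero_ibasis ib i ibX) => j _.
  have ij := norm_interval nm a L j.
  move=> /(ext_pos_interval i _ _ ij).
  set s := (a j %% m)%N; set e := (s + L j)%N => -[z [zy z1 z2 z3]].
  have em : (e <= m)%N := e_le_m m_ge2 l_ge2 nm epE ib j.
  have sm : (s < m)%N by exact: (start_lt m_ge2 l_ge2 nm).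
  have se : (s < e <= m)%N by rewrite em andbT /e; have := L0 j; clear; lia.
  have al : alive (syz D i s e) by move: z1 z3; rewrite /alive; clear; lia.
  have alS : alive (syz D i.+1 s e).
    by rewrite syz_aliveS // /alive /=; move: z1 z2; clear; lia.
  have al1 : alive (syz D 1 s e) by exact: alive_le alS.
  have e1 : (e < ep s)%N.
    by have al0 := alive_pred al1; move: al1; rewrite syz_aliveS.
  have [sE im] := syz_alive_ladder m_ge2 l_ge2 nm epE se alS.
  (* A class into the simple module puts the top of the next syzygy at its position. *)
  have y2 : lad s e i.+1 = (m - 2)%N.
    have : (syz D i s e).2 = lad s e i.+1.
      by move: sE; rewrite syz_aliveS // => -[].
    have zm : z = (m - 2)%N by move: z1; clear; lia.
    have z2m : (m - 2 < m)%N by move: m_ge2; clear; lia.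
    move: (zy) => + yE; rewrite nm yE zm => zy'.
    by rewrite -(modn_small im) -zy' modn_small.
  have [pj|np] := boolP (inner m l a L j).
    (* For s <= kl there is a nonzero Ext from DA to [Y] in degree at most 2k; for larger s the
       interval has projective dimension 1 and thus a nonzero Ext^1 into A. *)
    have [sk|sk] := leqP s (k * l).
      have [i' [nE _ bound]] := inner_Ext_dual std m_ge2 l_ge2 nm epE ib L0 pj.
      apply: nE; apply: (CT_Ext CT _ CY); first exact: (CT_dual std CT).
      by rewrite /= ltnS; exact: bound.
    have eps : ep s = m by rewrite epE //; move: sk klm; clear; lia.
    have epe : (ep e <= m)%N.
      by rewrite epE ?geq_minr // -eps.
    apply: (pd_last ib ij (p := 0)) (CT_Ext CT CY (CT_reg D CT) d2); first exact: al1.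
    by rewrite (syz_aliveS al1) (syz_aliveS (alive_pred al1)) /alive /= -leqNgt eps.
  have el : (e < l)%N /\ s = 0%N.
    move: np e1; rewrite /inner -/s -/e epE //; clear.
    case: (posnP s) => [->|]; lia.
  have [el' s0] := el; have e0 : (0 < e < 0 + l)%N by move: se el'; rewrite s0; clear; lia.
  (* Here l >= 3 enters: in degrees up to 2k a ladder starting at 0 stays at or below kl, which is
     less than m - 2. *)
  have := ladder_mono l_ge2 (i := i.+1) (j := k.*2) e0 ltac:(move: id; clear; lia).
  rewrite ladder_even -{1}s0 y2 addn0; move: klm l_ge3; clear; lia.
(* The first syzygy of the simple module is the projective [m - 1, m[, so its Ext^1 into A is
   nonzero. *)
have ijX : is_interval D (fun _ : unit => m - 2)%N (fun=> 1%N) tt (m - 2) m.-1.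
  by apply: is_intervalP => //; move: m_ge2; clear; lia.
have m2 : (m - 2 < m)%N by move: m_ge2; clear; lia.
have ep2 : ep (m - 2) = m by rewrite epE //; move: m_ge2 l_ge2; clear; lia.
have al : alive (syz D 1 (m - 2) m.-1).
  by rewrite syz_aliveS /alive /= ?ep2; move: m_ge2; clear; lia.
apply: (pd_last ibX ijX (p := 0)) (CT_Ext CT CX (CT_reg D CT) d2); first exact: al.
by rewrite (syz_aliveS al) (syz_aliveS (alive_pred al)) /alive /= ep2 (ep_last m_ge2 l_ge2 nm epE) ltnn.
Qed.
End OddHomogeneous.

(** * The algebras Lambda_{m,l} and the two directions of the equivalence *)

Lemma lambda_data (K : fieldType) (A : falgType K) m l : (0 < m)%N -> (2 <= l)%N ->
    iso_Lambda m l A ->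
  exists D : nakData K A^c, [/\ standard D, nd_n D = m &
    forall x, (x < m)%N -> endp D x = minn (x + l) m].
Proof.
move=> m0 l2 [phi [phi_scal phi_surj phi_ker]].
have ker x : phi x = 0 <-> long_paths l x.
  by split=> [/phi_ker /(ideal_pow_jacobson m0)|/(ideal_pow_jacobson m0) /phi_ker].
have [D [std nm wE _ _]] := linear_data m0 (fun x => long_paths_le l2 (f := x))
  (ex_intro _ l (fun x H => H)) phi_scal phi_surj ker.
exists D; split=> // x xm; rewrite /endp.
suff -> : nd_ell D x = minn l (m - x) by lia.
apply/eqP; rewrite eqn_leq; apply/andP; split.
  apply/(nd_w_eq0 D); rewrite wE; have [lm|ml] := leqP l (m - x).
    by apply/ker; exact: path_elt_long.
  by rewrite lin_path_elt0 ?rmorph0 //; lia.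
rewrite leqNgt; apply/negP => lt.
have [p [ps pE]] := lin_path_elt_pelt K m0 xm (t := nd_ell D x) ltac:(lia).
have : nd_w D x (nd_ell D x) = 0 by apply/(nd_w_eq0 D).
by rewrite wE pE => /ker /pelt_long_paths; rewrite ps; lia.
Qed.

(** Excludes the linear quiver with one vertex, where no arrow ensures l >= 2. *)
Lemma gldim0_trivial (K : fieldType) (R : pzRingType) (D : nakData K R) :
  nd_n D = 1%N -> endp D 0 = 1%N -> gldim_le R 0.
Proof.
move=> n1 e0 M /(ibasis_exists D)[I [a [L [v [ib L0]]]]].
apply: (ib_pd_le ib) => -[//|i] j _; rewrite -/(alive _); apply/negP => al.
have al1 : alive (syz D 1 (a j) (a j + L j)) by exact: alive_le al.
have := endp_shift D 0 (a j); rewrite n1 mul1n e0 add0n => ea.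
move: (al1); rewrite (syz_aliveS (alive_pred al1)) /alive /= ea; have := L0 j; clear; lia.
Qed.

Lemma cluster_tilting_lambda (K : fieldType) (A : falgType K) d (C : lmodType A^c -> Prop) :
    nakayama A -> (2 <= d)%N -> gldim_eq A^c d -> cluster_tilting d C ->
  exists m l, [/\ (3 <= m)%N, (2 <= l)%N, (l %| m - 1)%N \/ l = 2%N & iso_Lambda m l A].
Proof.
move=> hA d2 [gl gmin] CT.
case: hA => [[m m0 [I adm [phi [phi_scal phi_surj phi_ker]]]]|[n n0 [I adm iso]]]; last first.
  by have [D [std ep2]] := cyclic_data n0 adm iso; case: (cyclic_no_CT std d2 CT gl ep2).
have [D [std nm wE ep2 epl]] :=
  linear_data m0 (admissible_long adm) (long_admissible adm) phi_scal phi_surj phi_ker.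
have [m1|m_gt1] := leqP m 1.
  have m1' : m = 1%N by apply/eqP; rewrite eqn_leq m1.
  have g0 : gldim_le A^c 0.
    by apply: (@gldim0_trivial K _ D); [rewrite nm|move: epl; rewrite m1'].
  by have := leq_trans d2 (gmin 0%N g0).
pose l := endp D 0; have l2 : (2 <= l)%N by apply: ep2; move: m_gt1; clear; lia.
have gd := CT_good std d2 CT gl.
have n1 : (1 < nd_n D)%N by rewrite nm.
have iso_of : (forall x, (x < m)%N -> endp D x = minn (x + l) m) -> iso_Lambda m l A.
  move=> epE; exists phi; split=> // x.
  rewrite (linear_kernel phi_scal std nm (ltnW l2) wE epE).
  by split=> /(ideal_pow_jacobson m0).
rewrite -nm in ep2 epl; have := odd_double_half d; set k := d./2.
case: (odd d) => dE; rewrite ?add0n ?add1n in dE.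
  have [mE epE] := linear_odd (nd_n_gt0 D) (@endp_addn _ _ D) (@endp_mono _ _ D) d2 gd n1 ep2
    epl (esym dE).
  rewrite nm in mE epE; have k0 : (0 < k)%N by move: d2 dE; clear; lia.
  have [l3|l3] := leqP 3 l.
    by rewrite -dE in CT; case: (odd_ladder_no_CT std l3 k0 nm mE epE CT).
  (* The surviving odd case m = 2(k + 1), in which l does not divide m - 1: the origin of the
     alternative l = 2. *)
  have l2E : l = 2%N by apply/eqP; rewrite eqn_leq l2 andbT -ltnS.
  exists m, l; split=> //; [|by right|exact: iso_of].
  by rewrite mE -/l l2E; move: k0; clear; lia.
have [mE epE] := linear_even (nd_n_gt0 D) (@endp_addn _ _ D) (@endp_mono _ _ D)
  (@endp_gt _ _ D) d2 gd n1 ep2 epl (esym dE).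
rewrite nm -/l in mE epE; have k0 : (0 < k)%N by move: d2 dE; clear; lia.
exists m, l; split=> //; [|left|exact: iso_of].
  by rewrite mE !ltnS; apply: leq_trans l2 _; exact: leq_pmull.
by rewrite mE subn1 dvdn_mull.
Qed.

(** The dimension is first computed from m and l and then identified with d by uniqueness of the
    global dimension; its formula comes with it. *)
Lemma lambda_cluster_tilting (K : fieldType) (A : falgType K) d m l :
    (2 <= d)%N -> gldim_eq A^c d -> (3 <= m)%N -> (2 <= l)%N ->
    (l %| m - 1)%N \/ l = 2%N -> iso_Lambda m l A ->
  [/\ cluster_tilting d (add_subcat (reg_mod A * dual_mod A)%type),
    forall C : lmodType A^c -> Prop, cluster_tilting d C ->
      forall X, C X <-> add_subcat (reg_mod A * dual_mod A)%type X &
    (d * l = 2 * (m - 1))%N].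
Proof.
move=> d2 gl m3 l2 H iso.
have m2 : (2 <= m)%N by exact: ltnW.
have [D [std nm epE]] := lambda_data (ltnW m2) l2 iso.
have [d0 [ld dE]] : exists d0, ladder_dim m l d0 /\ (d0 * l = 2 * (m - 1))%N.
  case: H => [/dvdnP[k kE]|l2E].
    have mE : m = (k * l).+1 by rewrite -kE; move: m2; clear; lia.
    exists k.*2; split; last by rewrite kE -mul2n mulnA.
    exact: (ladder_dim_even m2 l2 mE).
  exists m.-1; split; last by rewrite l2E mulnC subn1.
  exact: (ladder_dim_two m2 l2 l2E).
have e := ladder_gldim_eq m2 l2 nm epE ld gl; rewrite -e in ld dE.
split=> //.
  exact: (ladder_cluster_tilting std m2 l2 nm epE ld d2).
exact: (ladder_CT_unique std m2 l2 nm epE ld).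
Qed.

Theorem theorem3 (K : fieldType) (A : falgType K) (d : nat)
    (hA : nakayama A) (hd : (2 <= d)%N) (hgl : gldim_eq A^c d) :
  ((exists C : lmodType A^c -> Prop, cluster_tilting d C) <->
   (exists m l : nat,
      [/\ (3 <= m)%N, (2 <= l)%N, (l %| m - 1)%N \/ l = 2%N & iso_Lambda m l A]))
  /\
  (forall m l : nat,
     (3 <= m)%N -> (2 <= l)%N -> (l %| m - 1)%N \/ l = 2%N -> iso_Lambda m l A ->
     (forall C : lmodType A^c -> Prop, cluster_tilting d C ->
        forall X : lmodType A^c, C X <-> add_subcat (reg_mod A * dual_mod A)%type X)
     /\ (d%:R = 2%:R * ((m%:R - 1) / l%:R) :> rat)).
Proof.
split=> [|m l m3 l2 H iso].
  split=> [[C CT]|[m [l [m3 l2 H iso]]]]; first exact: cluster_tilting_lambda hA hd hgl CT.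
  have [CT _ _] := lambda_cluster_tilting hd hgl m3 l2 H iso.
  by exists (add_subcat (reg_mod A * dual_mod A)%type).
have [_ uniq dl] := lambda_cluster_tilting hd hgl m3 l2 H iso; split=> //.
have l0 : l%:R != 0 :> rat by rewrite Num.Theory.pnatr_eq0 -lt0n ltnW.
apply: (mulIf l0); rewrite mulrA divfK // -natrM dl natrM natrB //.
exact: leq_trans m3.
Qed.
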